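(* Let $\Lambda<0$, $\ell^2=-3/\Lambda$ and $r_h>0$. There exists a neighbourhood $U\subset\mathbb{R}^3$ of the trivial initial data point $(S_h,\omega_h,\alpha_h')=(1,1,0)$ such that for all $(S_h,\omega_h,\alpha_h')\in U$, the corresponding unique static black hole solution $(\mu_0,S_0,\alpha_0,\omega_0)$ on $[r_h,\infty)$ of the static $\mathfrak{su}(2)$ Einstein-Yang-Mills equations (displayed in the context) satisfies $$\mathcal{K}_1(r)>0\quad\text{and}\quad \mathcal{K}_2(r)>0\qquad\text{for all } r>r_h,$$ where $\mathcal{K}_1,\mathcal{K}_2$ are the functions defined in the context from the solution, and thus this solution is linearly stable under spherically symmetric perturbations (in the sense defined in the context).
   Context: Static equations. The unknowns are real functions $m_0,S_0,\alpha_0,\omega_0$ of $r$, with $\mu_0(r)=1-\frac{2m_0(r)}{r}+\frac{r^2}{\ell^2}$ and $'=d/dr$. The static, spherically symmetric $\mathfrak{su}(2)$ Einstein-Yang-Mills equations with cosmological constant $\Lambda=-3/\ell^2$, for the metric $ds^2=-\mu_0S_0^2dt^2+\mu_0^{-1}dr^2+r^2(d\theta^2+\sin^2\theta\,d\phi^2)$, with electric gauge field function $\alpha_0$ and magnetic gauge field function $\omega_0$, are $$m_0'=\frac{r^2\alpha_0'^2}{2S_0^2}+\frac{\alpha_0^2\omega_0^2}{\mu_0S_0^2}+\mu_0\omega_0'^2+\frac{(1-\omega_0^2)^2}{2r^2},\qquad \frac{S_0'}{S_0}=\frac{2\omega_0'^2}{r}+\frac{2\alpha_0^2\omega_0^2}{r\mu_0^2S_0^2},$$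 $$0=\mu_0\alpha_0''+\Big(\frac{2\mu_0}{r}-\frac{\mu_0S_0'}{S_0}\Big)\alpha_0'-\frac{2\alpha_0\omega_0^2}{r^2},$$ $$0=\mu_0\omega_0''+\Big(\mu_0'+\frac{\mu_0S_0'}{S_0}\Big)\omega_0'+\frac{\omega_0(1-\omega_0^2)}{r^2}+\frac{\alpha_0^2\omega_0}{\mu_0S_0^2}.$$ They are invariant under $(S_0,\alpha_0)\to(\lambda S_0,\lambda\alpha_0)$ for any constant $\lambda\neq0$. Black hole initial data. Data $(S_h,\omega_h,\alpha_h')$ are imposed at the event horizon $r=r_h$: $\mu_0(r_h)=0$ (i.e. $m_0(r_h)=\frac{r_h}{2}+\frac{r_h^3}{2\ell^2}$), $S_0(r_h)=S_h$, $\omega_0(r_h)=\omega_h$, $\alpha_0(r_h)=0$, $\alpha_0'(r_h)=\alpha_h'$, with $\mu_0'(r_h)>0$ (regularity then forces $\omega_0'(r_h)=\omega_h(\omega_h^2-1)/(r_h^2\mu_0'(r_h))$). Known existence result (from earlier work, may be assumed). For all data in a neighbourhood of the trivial point $(1,1,0)$ there is a unique global solution $(\mu_0,S_0,\alpha_0,\omega_0)\in C^1([r_h,\infty),\mathbb{R}^2)\times C^2([r_h,\infty),\mathbb{R}^2)$ with these data; it depends continuously on the data; it satisfies $\mu_0>0$, $\omega_0>0$, $S_0>0$ for $r>r_h$; and it is asymptotically anti-de Sitter: after a scaling $(S_0,\alpha_0)\to(\lambda S_0,\lambda\alpha_0)$ making $S_0\to1$ as $r\to\infty$, one has $m_0=M+O(r^{-1})$,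 $S_0=1+O(r^{-4})$, $\alpha_0=\alpha_\infty+d_1/r+O(r^{-2})$, $\omega_0=\omega_\infty+c_1/r+O(r^{-2})$ as $r\to\infty$, for constants $M,\alpha_\infty,d_1,\omega_\infty,c_1$. The data $(1,1,0)$ give the trivial (Schwarzschild-anti-de Sitter) solution $\alpha_0\equiv0$, $\omega_0\equiv1$, $S_0\equiv1$, $m_0\equiv M$ constant. This is the ''corresponding unique static black hole solution'' in the claim. The functions $\mathcal{E}_i$, $\mathcal{Z}_{12},\mathcal{Z}_{21}$, $\mathcal{K}_i$. For the unique global static black hole solution $(\mu_0,S_0,\alpha_0,\omega_0)$ on $[r_h,\infty)$ with horizon data $(S_h,\omega_h,\alpha_h')$ in a neighbourhood of $(1,1,0)$ (so that $\mu_0>0$, $\omega_0>0$, $S_0>0$ for $r>r_h$) define $$\mathcal{E}_1=\alpha_0^2+\frac{\mu_0S_0^2(1+\omega_0^2)}{r^2}+\frac{2\mu_0^2S_0^2\omega_0'^2}{\omega_0^2}+\frac{8\alpha_0\alpha_0'\omega_0^2}{r}-\frac{4\alpha_0^2\omega_0^2}{r}\Big(\frac1r+\frac{\mu_0'}{\mu_0}+\frac{S_0'}{S_0}\Big),$$ $$\mathcal{E}_2=2\mu_0S_0\alpha_0'-\frac{4S_0\alpha_0\omega_0^2(1-\omega_0^2)}{r^3}+\frac{4\mu_0S_0\omega_0\omega_0'\alpha_0'}{r}-\frac{4\mu_0S_0\alpha_0\omega_0\omega_0'}{r}\Big(\frac1r+\frac{r}{2\omega_0^2}+\frac{\mu_0'}{\mu_0}+\frac{S_0'}{S_0}\Big),$$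 $$\mathcal{E}_3=\mathcal{E}_2-2\mu_0S_0\alpha_0',$$ $$\mathcal{E}_4=3\alpha_0^2-\frac{\mu_0S_0^2(1-3\omega_0^2)}{r^2}-\frac{4\mu_0^2S_0^2\omega_0'^2}{r}\Big(\frac{\mu_0'}{\mu_0}+\frac{S_0'}{S_0}\Big)-\frac{4\mu_0S_0^2\omega_0'}{r^3}\big[2\omega_0(1-\omega_0^2)+r\mu_0\omega_0'\big],$$ $$\mathcal{Z}_{12}(r)=\int_{r_h}^r\frac{\mathcal{E}_2(s)}{\mu_0(s)S_0(s)}ds,\qquad \mathcal{Z}_{21}(r)=\int_{r_h}^r\frac{\mathcal{E}_3(s)}{\mu_0(s)S_0(s)}ds,$$ $$\mathcal{K}_1=\mathcal{E}_1-\mathcal{Z}_{21}^2,\qquad \mathcal{K}_2=\mathcal{E}_4-\mathcal{Z}_{12}^2 .$$ Linear stability. Let $r_*$ be the tortoise coordinate, $dr_*/dr=1/(\mu_0S_0)$, normalized so that $r_*\to0$ as $r\to\infty$; then $r_*$ ranges over $(-\infty,0)$ for $r\in(r_h,\infty)$. Linear spherically symmetric perturbations of the solution reduce to the system $-\ddot{v}=\mathcal{U}v$ for $v=(\delta\kappa,\delta\omega)^T$ (the remaining perturbations being determined by $v$ up to coordinate gauge freedom), where $$\mathcal{U}=-\partial_{r_*}^2+\begin{pmatrix}0&2\alpha_0\\-2\alpha_0&0\end{pmatrix}\partial_{r_*}+\begin{pmatrix}\mathcal{E}_1&\mathcal{E}_2\\ \mathcal{E}_3&\mathcal{E}_4\end{pmatrix}.$$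 The solution is called linearly stable under spherically symmetric perturbations if $\mathcal{U}$ is a symmetric, positive operator with respect to the $L^2$ inner product $\langle u,v\rangle=\int u\cdot v\,dr_*$ over the range of $r_*$, acting on perturbations vanishing at both ends; explicitly, $\langle u,\mathcal{U}v\rangle=\langle\mathcal{U}u,v\rangle$ and $\langle v,\mathcal{U}v\rangle>0$ for $v\ne0$, for all $C^2$ functions $u,v$ of $r_*$ with values in $\mathbb{R}^2$ that tend to $0$ at both ends of the range of $r_*$ and for which the function, its $r_*$-derivative and its image under $\mathcal{U}$ are square integrable. *)

(* Defs.v *)
From Stdlib Require Export Reals.
From Coquelicot Require Export Coquelicot.
Open Scope R_scope.

(** * Calculus on the closed half-line [[a, +oo)] *)

Definition halfline (a : R) : R -> Prop := fun r => a <= r.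

(* Derivatives are taken relative to the half-line, hence one-sided at [a];
   at interior points they agree with [Derive f]. *)
Definition C1_on (a : R) (f : R -> R) : Prop :=
  exists f1 : R -> R,
    forall r, a <= r ->
      D_in f f1 (halfline a) r /\ continue_in f1 (halfline a) r.

Definition C2_on (a : R) (f : R -> R) : Prop :=
  exists f1 f2 : R -> R,
    forall r, a <= r ->
      D_in f f1 (halfline a) r /\ D_in f1 f2 (halfline a) r /\
      continue_in f2 (halfline a) r.

Definition right_derivative (a : R) (f : R -> R) (l : R) : Prop :=
  D_in f (fun _ => l) (halfline a) a.

(** * Static su(2) Einstein-Yang-Mills fields *)

(* Only the values on [[rh, +oo)] are meaningful. *)
Record fields := Fields {
  fm : R -> R;
  fS : R -> R;
  falpha : R -> R;
  fomega : R -> R }.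

Definition fmu (ell : R) (s : fields) (r : R) : R :=
  1 - 2 * fm s r / r + r ^ 2 / ell ^ 2.

Section AtRadius.
Variables (ell : R) (s : fields) (r : R).

Let m1 := Derive (fm s) r.
Let mu := fmu ell s r.
Let mu1 := Derive (fmu ell s) r.
Let S0 := fS s r.
Let S1 := Derive (fS s) r.
Let al := falpha s r.
Let al1 := Derive (falpha s) r.
Let al2 := Derive_n (falpha s) 2 r.
Let om := fomega s r.
Let om1 := Derive (fomega s) r.
Let om2 := Derive_n (fomega s) 2 r.

Definition static_eym : Prop :=
  m1 = r ^ 2 * al1 ^ 2 / (2 * S0 ^ 2) + al ^ 2 * om ^ 2 / (mu * S0 ^ 2)
       + mu * om1 ^ 2 + (1 - om ^ 2) ^ 2 / (2 * r ^ 2) /\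
  S1 / S0 = 2 * om1 ^ 2 / r
            + 2 * al ^ 2 * om ^ 2 / (r * mu ^ 2 * S0 ^ 2) /\
  0 = mu * al2 + (2 * mu / r - mu * S1 / S0) * al1
      - 2 * al * om ^ 2 / r ^ 2 /\
  0 = mu * om2 + (mu1 + mu * S1 / S0) * om1
      + om * (1 - om ^ 2) / r ^ 2 + al ^ 2 * om / (mu * S0 ^ 2).

Definition E1 : R :=
  al ^ 2 + mu * S0 ^ 2 * (1 + om ^ 2) / r ^ 2
  + 2 * mu ^ 2 * S0 ^ 2 * om1 ^ 2 / om ^ 2
  + 8 * al * al1 * om ^ 2 / r
  - 4 * al ^ 2 * om ^ 2 / r * (1 / r + mu1 / mu + S1 / S0).

Definition E2 : R :=
  2 * mu * S0 * al1
  - 4 * S0 * al * om ^ 2 * (1 - om ^ 2) / r ^ 3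
  + 4 * mu * S0 * om * om1 * al1 / r
  - 4 * mu * S0 * al * om * om1 / r
    * (1 / r + r / (2 * om ^ 2) + mu1 / mu + S1 / S0).

Definition E3 : R := E2 - 2 * mu * S0 * al1.

Definition E4 : R :=
  3 * al ^ 2
  - mu * S0 ^ 2 * (1 - 3 * om ^ 2) / r ^ 2
  - 4 * mu ^ 2 * S0 ^ 2 * om1 ^ 2 / r * (mu1 / mu + S1 / S0)
  - 4 * mu * S0 ^ 2 * om1 / r ^ 3
    * (2 * om * (1 - om ^ 2) + r * mu * om1).

End AtRadius.

(* The value of the integrands at the single point [rh], where [fmu] vanishes,
   does not affect the integrals. *)
Definition Z12 (ell rh : R) (s : fields) (r : R) : R :=
  RInt (fun x => E2 ell s x / (fmu ell s x * fS s x)) rh r.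

Definition Z21 (ell rh : R) (s : fields) (r : R) : R :=
  RInt (fun x => E3 ell s x / (fmu ell s x * fS s x)) rh r.

Definition K1 (ell rh : R) (s : fields) (r : R) : R :=
  E1 ell s r - Z21 ell rh s r ^ 2.

Definition K2 (ell rh : R) (s : fields) (r : R) : R :=
  E4 ell s r - Z12 ell rh s r ^ 2.

(** * Black hole solutions *)

Definition horizon_data : Type := (R * R * R)%type.
Definition data_S (p : horizon_data) : R := fst (fst p).
Definition data_omega (p : horizon_data) : R := snd (fst p).
Definition data_alpha1 (p : horizon_data) : R := snd p.

Definition trivial_data : horizon_data := (1, 1, 0).

(* The neighbourhood filter of the product (sup) metric of R^3. *)
Definition nbhd (p : horizon_data) (U : horizon_data -> Prop) : Prop :=
  locally (T := prod_UniformSpace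
                  (prod_UniformSpace R_UniformSpace R_UniformSpace)
                  R_UniformSpace) p U.

(* The horizon is a singular point of the equations, which are therefore
   imposed for [r > rh] only. *)
Definition static_black_hole (ell rh : R) (p : horizon_data) (s : fields)
  : Prop :=
  C1_on rh (fmu ell s) /\ C1_on rh (fS s) /\
  C2_on rh (falpha s) /\ C2_on rh (fomega s) /\
  (forall r, rh < r -> static_eym ell s r) /\
  fmu ell s rh = 0 /\
  (exists d, 0 < d /\ right_derivative rh (fmu ell s) d) /\
  fS s rh = data_S p /\
  fomega s rh = data_omega p /\
  falpha s rh = 0 /\
  right_derivative rh (falpha s) (data_alpha1 p).

Definition agree_from (rh : R) (s t : fields) : Prop :=
  forall r, rh <= r ->
    fm s r = fm t r /\ fS s r = fS t r /\
    falpha s r = falpha t r /\ fomega s r = fomega t r.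

Definition unique_static_black_hole (ell rh : R) (p : horizon_data)
    (s : fields) : Prop :=
  static_black_hole ell rh p s /\
  forall t, static_black_hole ell rh p t -> agree_from rh s t.

Definition asymptotically_AdS (s : fields) : Prop :=
  exists lambda M alpha_inf d1 omega_inf c1 C R0 : R,
    lambda <> 0 /\ 0 < R0 /\
    forall r, R0 <= r ->
      Rabs (fm s r - M) <= C / r /\
      Rabs (lambda * fS s r - 1) <= C / r ^ 4 /\
      Rabs (lambda * falpha s r - (alpha_inf + d1 / r)) <= C / r ^ 2 /\
      Rabs (fomega s r - (omega_inf + c1 / r)) <= C / r ^ 2.

Definition close_Ck (k : nat) (eps : R) (f g : R -> R) (r : R) : Prop :=
  forall j, (j <= k)%nat -> Rabs (Derive_n f j r - Derive_n g j r) <= eps.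

(* Continuity into C^1([rh,oo),R^2) x C^2([rh,oo),R^2) with its usual topology
   of uniform convergence of the functions and their derivatives on compact
   subsets.  Leaving out the point [rh] does not change the suprema, the
   derivatives being continuous up to [rh]. *)
Definition depends_continuously (ell rh : R) (V : horizon_data -> Prop)
    (sol : horizon_data -> fields) : Prop :=
  forall p, V p ->
  forall (R1 eps : R), rh < R1 -> 0 < eps ->
    nbhd p (fun q => V q ->
      forall r, rh < r <= R1 ->
        close_Ck 1 eps (fmu ell (sol q)) (fmu ell (sol p)) r /\
        close_Ck 1 eps (fS (sol q)) (fS (sol p)) r /\
        close_Ck 2 eps (falpha (sol q)) (falpha (sol p)) r /\
        close_Ck 2 eps (fomega (sol q)) (fomega (sol p)) r).

(* Existence theory near the Schwarzschild-anti-de Sitter solution, used as a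
   hypothesis. *)
Definition global_existence (ell rh : R) : Prop :=
  exists (V : horizon_data -> Prop) (sol : horizon_data -> fields),
    nbhd trivial_data V /\
    (forall p, V p ->
       unique_static_black_hole ell rh p (sol p) /\
       (forall r, rh < r ->
          0 < fmu ell (sol p) r /\ 0 < fomega (sol p) r /\
          0 < fS (sol p) r) /\
       asymptotically_AdS (sol p)) /\
    depends_continuously ell rh V sol.

(** * Linear stability *)

(* [rs] is the tortoise coordinate as a function of r in (rh, +oo), and [rad]
   its inverse, the radius as a function of the tortoise coordinate in
   (-oo, 0). *)
Definition tortoise (ell rh : R) (s : fields) (rs rad : R -> R) : Prop :=
  (forall r, rh < r -> is_derive rs r (1 / (fmu ell s r * fS s r))) /\
  is_lim rs p_infty 0 /\
  (forall r, rh < r -> rs r < 0 /\ rad (rs r) = r) /\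
  (forall x, x < 0 -> rh < rad x /\ rs (rad x) = x).

(* Perturbations are functions of the tortoise coordinate x < 0; their values
   for x >= 0 are irrelevant. *)
Definition comp1 (v : R -> R * R) (x : R) : R := fst (v x).
Definition comp2 (v : R -> R * R) (x : R) : R := snd (v x).

Definition derivative (v : R -> R * R) (x : R) : R * R :=
  (Derive (comp1 v) x, Derive (comp2 v) x).

Definition Uop (ell : R) (s : fields) (rad : R -> R) (v : R -> R * R) (x : R)
  : R * R :=
  (- Derive_n (comp1 v) 2 x
   + 2 * falpha s (rad x) * Derive (comp2 v) x
   + E1 ell s (rad x) * comp1 v x + E2 ell s (rad x) * comp2 v x,
   - Derive_n (comp2 v) 2 x
   - 2 * falpha s (rad x) * Derive (comp1 v) x
   + E3 ell s (rad x) * comp1 v x + E4 ell s (rad x) * comp2 v x).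

Definition dot (a b : R * R) : R := fst a * fst b + snd a * snd b.

Definition square_integrable (v : R -> R * R) : Prop :=
  ex_RInt_gen (fun x => dot (v x) (v x)) (Rbar_locally m_infty) (at_left 0).

(* For continuous square integrable [u] and [v] this (absolutely convergent)
   improper integral is the L^2 inner product over (-oo, 0). *)
Definition inner (u v : R -> R * R) : R :=
  RInt_gen (fun x => dot (u x) (v x)) (Rbar_locally m_infty) (at_left 0).

Definition C2_negative (f : R -> R) : Prop :=
  forall x, x < 0 ->
    ex_derive f x /\ ex_derive (Derive f) x /\ continuous (Derive_n f 2) x.

Definition vanishes_at_ends (f : R -> R) : Prop :=
  is_lim f m_infty 0 /\ filterlim f (at_left 0) (locally 0).

Definition admissible (ell : R) (s : fields) (rad : R -> R) (v : R -> R * R)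
  : Prop :=
  C2_negative (comp1 v) /\ C2_negative (comp2 v) /\
  vanishes_at_ends (comp1 v) /\ vanishes_at_ends (comp2 v) /\
  square_integrable v /\ square_integrable (derivative v) /\
  square_integrable (Uop ell s rad v).

(* The tortoise chart is unique, so the existential selects it rather than
   leaving a choice. *)
Definition linearly_stable (ell rh : R) (s : fields) : Prop :=
  exists rs rad : R -> R,
    tortoise ell rh s rs rad /\
    (forall u v, admissible ell s rad u -> admissible ell s rad v ->
       inner u (Uop ell s rad v) = inner (Uop ell s rad u) v) /\
    (forall v, admissible ell s rad v ->
       (exists x, x < 0 /\ v x <> (0, 0)) ->
       0 < inner v (Uop ell s rad v)).

(* Main.v *)
Require Import Defs.
From Stdlib Require Import Reals.
From Coquelicot Require Import Coquelicot.
From Stdlib Require Import Lra Psatz Classical ClassicalEpsilon.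
Open Scope R_scope.

(* For data near (1,1,0) the solution stays uniformly close to Schwarzschild-AdS.
   On a compact interval [(rh, R1]] this is continuous dependence.  Beyond [R1] the
   fluxes [r^2 alpha'/S] and [mu S omega'] are the right variables: together with
   [alpha], [omega - 1], [S - 1] and [m - m_h] they satisfy a system whose right-hand
   side is [O(size)/r^2], so a continuity argument closes as soon as [R1] is large
   compared with constants depending only on [ell] and [rh].

   In terms of [n = mu/r^2], [q = alpha r^2/mu], [w = r^2 omega'], [a = r^2 alpha'],
   all of which are bounded up to the horizon and up to infinity, one gets
   [K1 = n (S^2 (1 + omega^2) + small)] and [K2 = n (S^2 (3 omega^2 - 1) + small)];
   the squares of [Z21] and [Z12] are absorbed because
   [Z = O(small (r - rh)/r)] and [((r - rh)/r)^2 = O(n)].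

   With [z12' = E2], [z21' = E3] and [z12 - z21 = 2 alpha] along the tortoise
   coordinate, [v . U v] is the derivative of a boundary term plus
   [(v1' - z12 v2)^2 + (v2' - z21 v1)^2 + K1 v1^2 + K2 v2^2].  The boundary terms
   vanish along suitable sequences: at minus infinity because [v'] is square
   integrable, at [0] because in addition [v = O(sqrt |x|)]. *)

(** * One-sided calculus and continuous induction *)

(** Three obstacles shape the proof. [K1] and [K2] vanish at the horizon together with [mu], so an
    error that is small in absolute terms is worthless there: smallness must be measured relative to
    [n]. The vacuum has [K1 = K2 = 2 n], and this margin on the scale of [n] is what a perturbation
    may consume.

    Continuous dependence is local in [r], whereas one neighbourhood must serve all radii. Hence the
    order of choices: the comparison constant [K] for [mu] and the radius [R1] depend only on [ell]
    and [rh], the admissible size [d] of the perturbation depends on [K], and the closeness demanded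
    on [(rh, R1]] comes last.

    Admissible perturbations have square integrable derivatives, which need not have limits at the
    ends, so boundary terms cannot be evaluated there. They are made small at selected endpoints
    only. This suffices because the improper integrals converge for every choice of endpoints
    tending to the two ends. *)

Lemma locally_gt (a x : R) : a < x -> locally x (fun y => a < y).
Proof. intros H. apply (open_gt a x H). Qed.

Lemma locally_lt (a x : R) : x < a -> locally x (fun y => y < a).
Proof. intros H. apply (open_lt a x H). Qed.

Lemma is_derive_cont (f : R -> R) (x l : R) : is_derive f x l -> continuous f x.
Proof. intros H. exact (ex_derive_continuous f x (ex_intro _ l H)). Qed.

(** Monotonicity of [g - f] and [g + f], through the mean value theorem, integrates a derivative
    bound without any Riemann integral of [f']. *)
Lemma increment_bound (f g f' g' : R -> R) (a b : R) :
  a <= b ->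
  (forall s, a <= s <= b -> is_derive f s (f' s)) ->
  (forall s, a <= s <= b -> is_derive g s (g' s)) ->
  (forall s, a <= s <= b -> Rabs (f' s) <= g' s) ->
  Rabs (f b - f a) <= g b - g a.
Proof.
  intros Hab Hf Hg Hle.
  assert (Hmono : forall h h' : R -> R,
    (forall s, a <= s <= b -> is_derive h s (h' s)) ->
    (forall s, a <= s <= b -> 0 <= h' s) -> h a <= h b).
  { intros h h' Hh Hp.
    destruct (MVT_gen h a b h') as [c [Hc Heq]];
      rewrite ?Rmin_left, ?Rmax_right in * by lra.
    - intros x Hx. apply Hh. lra.
    - intros x Hx. apply continuity_pt_filterlim.
      apply (is_derive_cont h x (h' x)). apply Hh. lra.
    - specialize (Hp c Hc). nra. }
  assert (H1 := Hmono (fun s => minus (g s) (f s)) (fun s => minus (g' s) (f' s))).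
  assert (H2 := Hmono (fun s => plus (g s) (f s)) (fun s => plus (g' s) (f' s))).
  unfold minus, plus, opp in H1, H2; simpl in H1, H2.
  assert (H1' : g a + - f a <= g b + - f b).
  { apply H1; intros s Hs.
    - apply (is_derive_minus g f s (g' s) (f' s)); auto.
    - specialize (Hle s Hs). apply Rabs_le_between in Hle. lra. }
  assert (H2' : g a + f a <= g b + f b).
  { apply H2; intros s Hs.
    - apply (is_derive_plus g f s (g' s) (f' s)); auto.
    - specialize (Hle s Hs). apply Rabs_le_between in Hle. lra. }
  apply Rabs_le. lra.
Qed.

Lemma is_derive_linear (k x : R) : is_derive (fun s => k * s) x k.
Proof. auto_derive; auto; ring. Qed.

Lemma is_derive_opp_inv (k x : R) :
  x <> 0 -> is_derive (fun s => - k / s) x (k / x ^ 2).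
Proof. intros Hx. auto_derive; auto. field. auto. Qed.

(** The inverse square is integrable at infinity, so the bound is uniform in [b]; the control of the
    fields up to infinity rests on this. *)
Lemma increment_bound_inverse_square (f f' : R -> R) (k a b : R) :
  0 < a <= b -> 0 <= k ->
  (forall s, a <= s <= b -> is_derive f s (f' s)) ->
  (forall s, a <= s <= b -> Rabs (f' s) <= k / s ^ 2) ->
  Rabs (f b - f a) <= k / a.
Proof.
  intros Hab Hk Hf Hle.
  apply Rle_trans with ((fun s => - k / s) b - (fun s => - k / s) a).
  - apply (increment_bound f _ f' (fun s => k / s ^ 2)); auto; try lra.
    intros s Hs. apply is_derive_opp_inv. lra.
  - simpl. assert (0 <= k / b) by (apply Rdiv_le_0_compat; lra). lra.
Qed.

Definition right_limit (f : R -> R) (a l : R) : Prop :=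
  filterlim f (at_right a) (locally l).

Lemma right_limit_eps (f : R -> R) (a l : R) :
  right_limit f a l <->
  forall eps, 0 < eps ->
    exists d, 0 < d /\ forall x, a < x < a + d -> Rabs (f x - l) < eps.
Proof.
  split.
  - intros H eps He.
    destruct (proj1 (filterlim_locally f l) H (mkposreal _ He)) as [d Hd].
    exists d. split. apply cond_pos. intros x Hx.
    apply (Hd x); [|lra].
    change (Rabs (x - a) < d). rewrite Rabs_right; lra.
  - intros H. apply filterlim_locally. intros [eps He].
    destruct (H eps He) as [d [Hd Hx]].
    exists (mkposreal d Hd). intros x Hb Hax. apply Hx.
    change (Rabs (x - a) < d) in Hb. apply Rabs_lt_between in Hb. lra.
Qed.

Lemma right_limit_le (f : R -> R) (a l c b : R) :
  a < b -> right_limit f a l -> (forall x, a < x < b -> f x <= c) -> l <= c.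
Proof.
  intros Hab Hf Hle. apply Rnot_lt_le. intros Hc.
  destruct (proj1 (right_limit_eps f a l) Hf (l - c)) as [d [Hd Hx]]; [lra|].
  set (x := a + Rmin d (b - a) / 2).
  assert (0 < Rmin d (b - a)) by (apply Rmin_pos; lra).
  assert (Rmin d (b - a) <= d) by apply Rmin_l.
  assert (Rmin d (b - a) <= b - a) by apply Rmin_r.
  assert (Hxx : Rabs (f x - l) < l - c) by (apply Hx; unfold x; lra).
  assert (f x <= c) by (apply Hle; unfold x; lra).
  apply Rabs_lt_between in Hxx. lra.
Qed.

Lemma right_limit_abs_minus (f : R -> R) (a l c : R) :
  right_limit f a l -> right_limit (fun x => Rabs (c - f x)) a (Rabs (c - l)).
Proof.
  intros H. apply right_limit_eps. intros eps He.
  destruct (proj1 (right_limit_eps f a l) H eps He) as [d [Hd Hx]].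
  exists d. split; auto. intros x Hax. specialize (Hx x Hax).
  eapply Rle_lt_trans; [apply Rabs_triang_inv2|].
  replace (c - f x - (c - l)) with (- (f x - l)) by ring.
  now rewrite Rabs_Ropp.
Qed.

(** The interval is cut at some [x > a], and then [x] tends to [a]: at the horizon a limit is
    available but no two-sided derivative. *)
Lemma increment_bound_right (f f' : R -> R) (k a b : R) :
  a < b -> 0 <= k -> right_limit f a (f a) ->
  (forall s, a < s <= b -> is_derive f s (f' s)) ->
  (forall s, a < s <= b -> Rabs (f' s) <= k) ->
  Rabs (f b - f a) <= k * (b - a).
Proof.
  intros Hab Hk Hlim Hf Hle.
  apply (right_limit_le (fun x => Rabs (f b - f x)) a _ _ b Hab).
  - now apply right_limit_abs_minus.
  - intros x Hx.
    apply Rle_trans with ((fun s => k * s) b - (fun s => k * s) x).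
    + apply (increment_bound f _ f' (fun _ => k)); try lra.
      * intros s Hs. apply Hf. lra.
      * intros s _. apply is_derive_linear.
      * intros s Hs. apply Hle. lra.
    + simpl. nra.
Qed.

Lemma D_in_is_derive (a : R) (f f1 : R -> R) (r : R) :
  a < r -> D_in f f1 (halfline a) r -> is_derive f r (f1 r).
Proof.
  intros Har H. apply is_derive_Reals. intros eps He.
  destruct (H eps He) as [d [Hd Hx]].
  assert (Hm : 0 < Rmin d (r - a)) by (apply Rmin_pos; lra).
  exists (mkposreal _ Hm). intros h Hh0 Hh; simpl in Hh.
  assert (Rmin d (r - a) <= d) by apply Rmin_l.
  assert (Rmin d (r - a) <= r - a) by apply Rmin_r.
  specialize (Hx (r + h)). simpl in Hx. unfold Rdist in Hx.
  replace (r + h - r) with h in Hx by ring.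
  apply Hx. repeat split.
  - unfold halfline. apply Rabs_lt_between in Hh. lra.
  - lra.
  - lra.
Qed.

Lemma D_in_slope (a : R) (f f1 : R -> R) :
  D_in f f1 (halfline a) a ->
  right_limit (fun x => (f x - f a) / (x - a)) a (f1 a).
Proof.
  intros H. apply right_limit_eps. intros eps He.
  destruct (H eps He) as [d [Hd Hx]].
  exists d. split; auto. intros x Hax. apply (Hx x). simpl. unfold Rdist.
  rewrite Rabs_right by lra. repeat split; unfold halfline; lra.
Qed.

Lemma continue_in_interior (a : R) (f : R -> R) (r : R) :
  a < r -> continue_in f (halfline a) r -> continuous f r.
Proof.
  intros Har H. apply filterlim_locally. intros [eps He].
  destruct (H eps He) as [d [Hd Hx]].
  assert (Hm : 0 < Rmin d (r - a)) by (apply Rmin_pos; lra).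
  exists (mkposreal _ Hm). intros y Hy.
  change (Rabs (y - r) < Rmin d (r - a)) in Hy. change (Rabs (f y - f r) < eps).
  destruct (Req_dec y r) as [->|Hne].
  { rewrite Rminus_diag, Rabs_R0. lra. }
  assert (Rmin d (r - a) <= d) by apply Rmin_l.
  assert (Rmin d (r - a) <= r - a) by apply Rmin_r.
  apply (Hx y). simpl. unfold Rdist. apply Rabs_lt_between in Hy as Hy'.
  repeat split; unfold halfline; lra.
Qed.

Lemma continue_in_right (a : R) (f : R -> R) :
  continue_in f (halfline a) a -> right_limit f a (f a).
Proof.
  intros H. apply right_limit_eps. intros eps He.
  destruct (H eps He) as [d [Hd Hx]].
  exists d. split; auto. intros x Hax. apply (Hx x). simpl. unfold Rdist.
  rewrite Rabs_right by lra. repeat split; unfold halfline; lra.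
Qed.

Lemma slope_right_limit (f : R -> R) (a l : R) :
  right_limit (fun x => (f x - f a) / (x - a)) a l -> right_limit f a (f a).
Proof.
  intros H. apply right_limit_eps. intros eps He.
  destruct (proj1 (right_limit_eps _ a l) H 1 Rlt_0_1) as [d [Hd Hx]].
  set (k := Rabs l + 1).
  assert (0 < k) by (unfold k; generalize (Rabs_pos l); lra).
  assert (Hek : 0 < eps / k) by (apply Rdiv_lt_0_compat; lra).
  exists (Rmin d (eps / k)). split; [now apply Rmin_pos|].
  intros x Hax.
  assert (Rmin d (eps / k) <= d) by apply Rmin_l.
  assert (Rmin d (eps / k) <= eps / k) by apply Rmin_r.
  assert (Hs : Rabs ((f x - f a) / (x - a) - l) < 1) by (apply Hx; lra).
  replace (f x - f a) with ((f x - f a) / (x - a) * (x - a)) by (field; lra).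
  rewrite Rabs_mult, (Rabs_right (x - a)) by lra.
  assert (Rabs ((f x - f a) / (x - a)) < k).
  { unfold k. generalize (Rabs_triang ((f x - f a) / (x - a) - l) l).
    replace ((f x - f a) / (x - a) - l + l) with ((f x - f a) / (x - a)) by ring.
    lra. }
  apply Rle_lt_trans with (k * (x - a)).
  - apply Rmult_le_compat_r; lra.
  - replace eps with (k * (eps / k)) by (field; lra).
    apply Rmult_lt_compat_l; lra.
Qed.

(* Everything that is used of [C1_on]: [Derive f] only makes sense inside. *)
Definition C1_right (a : R) (f : R -> R) (l : R) : Prop :=
  (forall r, a < r -> ex_derive f r /\ continuous (Derive f) r) /\
  right_limit f a (f a) /\ right_limit (Derive f) a l /\
  right_limit (fun x => (f x - f a) / (x - a)) a l.

Lemma right_limit_ext (f g : R -> R) (a l : R) :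
  (forall x, a < x -> f x = g x) -> right_limit f a l -> right_limit g a l.
Proof.
  intros He Hf. apply right_limit_eps. intros eps Hp.
  destruct (proj1 (right_limit_eps f a l) Hf eps Hp) as [d [Hd Hx]].
  exists d. split; auto. intros x Hax. rewrite <- He by lra. auto.
Qed.

Lemma C1_on_right (a : R) (f : R -> R) : C1_on a f -> exists l, C1_right a f l.
Proof.
  intros [f1 H].
  assert (Hd : forall r, a < r -> is_derive f r (f1 r)).
  { intros r Hr. apply (D_in_is_derive a); auto. apply H. lra. }
  assert (Hd' : forall r, a < r -> Derive f r = f1 r).
  { intros r Hr. apply is_derive_unique; auto. }
  exists (f1 a). repeat split.
  - exists (f1 r). apply Hd. lra.
  - apply (continuous_ext_loc _ f1).
    + generalize (locally_gt a r H0). apply filter_imp. intros x Hx.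
      symmetry. auto.
    + apply (continue_in_interior a); auto. apply H. lra.
  - apply (slope_right_limit f a (f1 a)). apply D_in_slope. apply H. lra.
  - apply (right_limit_ext f1). intros; symmetry; auto.
    apply continue_in_right. apply H. lra.
  - apply D_in_slope. apply H. lra.
Qed.

Lemma C2_on_C1_on (a : R) (f : R -> R) : C2_on a f -> C1_on a f.
Proof.
  intros [f1 [f2 H]]. exists f1. intros r Hr. destruct (H r Hr) as [H1 [H2 H3]].
  split; auto. unfold continue_in. intros eps He.
  assert (Hc := cont_deriv f1 f2 (halfline a) r H2). apply (Hc eps He).
Qed.

Lemma C2_on_interior (a : R) (f : R -> R) (r : R) :
  C2_on a f -> a < r -> ex_derive (Derive f) r.
Proof.
  intros [f1 [f2 H]] Hr.
  exists (f2 r). apply (is_derive_ext_loc f1).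
  - generalize (locally_gt a r Hr). apply filter_imp. intros x Hx. symmetry.
    apply is_derive_unique. apply (D_in_is_derive a); auto. apply H. lra.
  - apply (D_in_is_derive a); auto. apply H. lra.
Qed.

Lemma D_in_of_is_derive (a : R) (f f1 : R -> R) (r : R) :
  is_derive f r (f1 r) -> D_in f f1 (halfline a) r.
Proof.
  intros H. apply is_derive_Reals in H. intros eps He.
  destruct (H eps He) as [[d Hd] Hx].
  exists d. split; auto. intros x [[_ Hne] Hxd]. simpl in *. unfold Rdist in *.
  replace (f x) with (f (r + (x - r))) by (f_equal; ring).
  apply Hx; auto. lra.
Qed.

Lemma continue_in_of_continuous (a : R) (f : R -> R) (r : R) :
  continuous f r -> continue_in f (halfline a) r.
Proof.
  intros H eps He.
  destruct (proj1 (filterlim_locally f (f r)) H (mkposreal _ He)) as [d Hd].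
  exists d. split. apply cond_pos. intros x [_ Hx]. apply (Hd x Hx).
Qed.

(** A bootstrap. Let [sg] be the supremum of the radii up to which [f <= 1]. The step improves the
    bound to [f sg <= k < 1], and continuity carries [f <= 1] beyond [sg], a contradiction. *)
Lemma continuous_induction (f : R -> R) (a k : R) :
  (forall r, a <= r -> continuous f r) -> k < 1 -> f a <= k ->
  (forall r, a <= r -> (forall s, a <= s <= r -> f s <= 1) -> f r <= k) ->
  forall r, a <= r -> f r <= k.
Proof.
  intros Hc Hk H0 Hstep r Hr. apply Hstep; auto. intros s Hs.
  apply Rnot_lt_le. intros Hbad.
  set (E := fun t => a <= t <= s /\ forall x, a <= x <= t -> f x <= 1).
  assert (HEa : E a).
  { split; [lra|]. intros x Hx. replace x with a by lra. lra. }
  destruct (completeness E) as [sg [Hub Hlub]].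
  { exists s. intros t [Ht _]. lra. }
  { now exists a. }
  assert (Has : a <= sg) by (apply Hub; auto).
  assert (Hss : sg <= s) by (apply Hlub; intros t [Ht _]; lra).
  assert (Hbelow : forall x, a <= x < sg -> f x <= 1).
  { intros x Hx. apply Rnot_lt_le. intros Hfx.
    assert (sg <= x); [|lra].
    apply Hlub. intros t [Ht1 Ht2]. apply Rnot_lt_le. intros Hxt.
    specialize (Ht2 x). lra. }
  assert (Hfs : f sg <= 1).
  { destruct (Req_dec sg a) as [->|Hne]; [lra|].
    apply Rnot_lt_le. intros Hgt.
    destruct (proj1 (filterlim_locally f (f sg)) (Hc sg Has)
                (mkposreal (f sg - 1) ltac:(lra))) as [d Hd].
    set (x := sg - Rmin d (sg - a) / 2).
    assert (0 < Rmin d (sg - a)) by (apply Rmin_pos; [apply cond_pos | lra]).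
    assert (Rmin d (sg - a) <= d) by apply Rmin_l.
    assert (Rmin d (sg - a) <= sg - a) by apply Rmin_r.
    assert (Hx : Rabs (f x - f sg) < f sg - 1).
    { apply (Hd x). change (Rabs (x - sg) < d). unfold x.
      rewrite Rabs_left; lra. }
    assert (f x <= 1) by (apply Hbelow; unfold x; lra).
    apply Rabs_lt_between in Hx. lra. }
  assert (Hfk : f sg <= k).
  { apply Hstep; auto. intros x Hx. destruct (Req_dec x sg) as [->|]; auto.
    apply Hbelow. lra. }
  destruct (proj1 (filterlim_locally f (f sg)) (Hc sg Has)
              (mkposreal (1 - k) ltac:(lra))) as [d Hd].
  assert (Hlt : sg < s) by (destruct (Req_dec sg s) as [<-|]; lra).
  set (t := sg + Rmin d (s - sg) / 2).
  assert (0 < Rmin d (s - sg)) by (apply Rmin_pos; [apply cond_pos | lra]).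
  assert (Rmin d (s - sg) <= d) by apply Rmin_l.
  assert (Rmin d (s - sg) <= s - sg) by apply Rmin_r.
  assert (t <= sg); [|unfold t in *; lra].
  apply Hub. split; [unfold t; lra|]. intros x Hx.
  destruct (Rlt_le_dec sg x) as [Hlx|Hlx].
  - assert (Hfx : Rabs (f x - f sg) < 1 - k).
    { apply (Hd x). change (Rabs (x - sg) < d). unfold t in Hx.
      rewrite Rabs_right; lra. }
    apply Rabs_lt_between in Hfx. lra.
  - destruct (Req_dec x sg) as [->|]; auto. apply Hbelow. lra.
Qed.

(** * Improper integrals over the negative half-line *)

Definition continuous_neg (f : R -> R) : Prop := forall x, x < 0 -> continuous f x.

Lemma ex_RInt_neg (f : R -> R) (a b : R) :
  continuous_neg f -> a < 0 -> b < 0 -> ex_RInt f a b.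
Proof.
  intros Hf Ha Hb. apply (ex_RInt_continuous (V := R_CompleteNormedModule)).
  intros z Hz. apply Hf. apply Rle_lt_trans with (Rmax a b); [lra|].
  now apply Rmax_lub_lt.
Qed.

Lemma RInt_neg_Chasles (f : R -> R) (a b c : R) :
  continuous_neg f -> a < 0 -> b < 0 -> c < 0 ->
  RInt f a b + RInt f b c = RInt f a c.
Proof.
  intros Hf Ha Hb Hc.
  apply (RInt_Chasles (V := R_CompleteNormedModule) f a b c);
    now apply ex_RInt_neg.
Qed.

(** Convergence of [RInt f a b] when [a] and [b] approach the two ends independently. This form
    allows the endpoints to be chosen afterwards, where boundary terms happen to be small. *)
Definition improper (f : R -> R) (l : R) : Prop :=
  forall eps, 0 < eps -> exists X Y, X < Y < 0 /\
    forall a b, a < X -> Y < b < 0 -> Rabs (RInt f a b - l) < eps.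

Lemma at_left_0_interval (Q : R -> Prop) :
  at_left 0 Q -> exists Y, Y < 0 /\ forall b, Y < b < 0 -> Q b.
Proof.
  intros [d Hd]. exists (- d). split.
  - generalize (cond_pos d). lra.
  - intros b Hb. apply Hd; [|lra]. change (Rabs (b - 0) < d).
    rewrite Rabs_left; lra.
Qed.

Lemma m_infty_interval (P : R -> Prop) :
  Rbar_locally m_infty P -> exists X, forall a, a < X -> P a.
Proof. auto. Qed.

Lemma at_left_0_ge (Y : R) : Y < 0 -> at_left 0 (fun b => Y < b < 0).
Proof.
  intros HY. exists (mkposreal (- Y) ltac:(lra)). intros b Hb Hb0.
  change (Rabs (b - 0) < - Y) in Hb. rewrite Rabs_left in Hb by lra. lra.
Qed.

Lemma improper_filterlim (f : R -> R) (l : R) :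
  improper f l <->
  filterlim (fun ab : R * R => RInt f (fst ab) (snd ab))
    (filter_prod (Rbar_locally m_infty) (at_left 0)) (locally l).
Proof.
  split.
  - intros H. apply filterlim_locally. intros [eps He].
    destruct (H eps He) as [X [Y [HXY Hab]]].
    exists (fun a => a < X) (fun b => Y < b < 0).
    + now exists X.
    + apply at_left_0_ge. lra.
    + intros a b Ha Hb. apply (Hab a b Ha Hb).
  - intros H eps He.
    destruct (proj1 (filterlim_locally _ l) H (mkposreal _ He)) as [P Q HP HQ Hab].
    destruct (m_infty_interval P HP) as [X HX].
    destruct (at_left_0_interval Q HQ) as [Y [HY0 HY]].
    exists (Rmin X (Y - 1)), Y. split.
    + generalize (Rmin_r X (Y - 1)). lra.
    + intros a b Ha Hb. apply (Hab a b).
      * apply HX. generalize (Rmin_l X (Y - 1)). lra.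
      * apply HY. lra.
Qed.

Lemma improper_is_RInt_gen (f : R -> R) (l : R) :
  continuous_neg f ->
  (is_RInt_gen f (Rbar_locally m_infty) (at_left 0) l <-> improper f l).
Proof.
  intros Hf. rewrite improper_filterlim. split.
  - intros H P HP. specialize (H P HP).
    unfold filtermapi, filtermap in *.
    revert H. apply filter_imp. intros [a b] [y [Hy HPy]]. simpl in *.
    now rewrite (is_RInt_unique f a b y Hy).
  - intros H P HP. specialize (H P HP). unfold filtermapi, filtermap in *.
    assert (Hneg : filter_prod (Rbar_locally m_infty) (at_left 0)
              (fun ab : R * R => fst ab < 0 /\ snd ab < 0)).
    { exists (fun a => a < 0) (fun b => -1 < b < 0).
      - now exists 0.
      - apply at_left_0_ge. lra.
      - intros a b Ha Hb. simpl. lra. }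
    generalize (filter_and _ _ Hneg H). apply filter_imp.
    intros [a b] [[Ha Hb] HPy]. simpl in *. exists (RInt f a b). split; auto.
    apply (RInt_correct (V := R_CompleteNormedModule)). now apply ex_RInt_neg.
Qed.

Lemma improper_tails (f : R -> R) (l : R) :
  continuous_neg f -> improper f l ->
  forall eps, 0 < eps -> exists X Y, X < Y < 0 /\
    (forall a a', a < X -> a' < X -> Rabs (RInt f a a') < eps) /\
    (forall b b', Y < b < 0 -> Y < b' < 0 -> Rabs (RInt f b b') < eps).
Proof.
  intros Hf H eps He.
  destruct (H (eps / 2)) as [X [Y [HXY Hab]]]; [lra|].
  exists X, Y. split; auto. split.
  - intros a a' Ha Ha'.
    assert (Hb : Y < Y / 2 < 0) by lra.
    assert (H1 := Hab a (Y / 2) Ha Hb). assert (H2 := Hab a' (Y / 2) Ha' Hb).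
    assert (H3 := RInt_neg_Chasles f a a' (Y / 2) Hf
                    ltac:(lra) ltac:(lra) ltac:(lra)).
    apply Rabs_lt_between in H1. apply Rabs_lt_between in H2.
    apply Rabs_lt_between. lra.
  - intros b b' Hb Hb'.
    assert (Ha : X - 1 < X) by lra.
    assert (H1 := Hab _ b Ha Hb). assert (H2 := Hab _ b' Ha Hb').
    assert (H3 := RInt_neg_Chasles f (X - 1) b b' Hf
                    ltac:(lra) ltac:(lra) ltac:(lra)).
    apply Rabs_lt_between in H1. apply Rabs_lt_between in H2.
    apply Rabs_lt_between. lra.
Qed.

Lemma RInt_neg_abs_le (f g : R -> R) (a b : R) :
  continuous_neg f -> continuous_neg g -> (forall x, x < 0 -> Rabs (f x) <= g x) ->
  a < 0 -> b < 0 -> Rabs (RInt f a b) <= Rabs (RInt g a b).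
Proof.
  intros Hf Hg Hfg.
  assert (Hord : forall a b, a <= b -> b < 0 -> Rabs (RInt f a b) <= Rabs (RInt g a b)).
  { intros c d Hcd Hd.
    eapply Rle_trans; [|apply Rle_abs].
    assert (Hfi := ex_RInt_neg f c d Hf ltac:(lra) Hd).
    assert (Hgi := ex_RInt_neg g c d Hg ltac:(lra) Hd).
    apply (norm_RInt_le (V := R_NormedModule) f g c d); auto.
    - intros x Hx. apply Hfg. lra.
    - now apply (RInt_correct (V := R_CompleteNormedModule)).
    - now apply (RInt_correct (V := R_CompleteNormedModule)). }
  intros Ha Hb. destruct (Rle_lt_dec a b) as [Hab|Hab]; auto.
  rewrite <- (opp_RInt_swap (V := R_CompleteNormedModule) f b a)
    by now apply ex_RInt_neg.
  rewrite <- (opp_RInt_swap (V := R_CompleteNormedModule) g b a)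
    by now apply ex_RInt_neg.
  unfold opp; simpl. rewrite !Rabs_Ropp. apply Hord; lra.
Qed.

Lemma improper_dominated (f g : R -> R) (lg : R) :
  continuous_neg f -> continuous_neg g -> (forall x, x < 0 -> Rabs (f x) <= g x) ->
  improper g lg -> exists l, improper f l.
Proof.
  intros Hf Hg Hfg H.
  destruct (proj1 (filterlim_locally_cauchy (U := R_CompleteSpace)
    (F := filter_prod (Rbar_locally m_infty) (at_left 0))
    (fun ab : R * R => RInt f (fst ab) (snd ab)))) as [l Hl].
  - intros [eps He].
    destruct (improper_tails g lg Hg H (eps / 2)) as [X [Y [HXY [HX HY]]]]; [lra|].
    exists (fun ab => fst ab < X /\ Y < snd ab < 0). split.
    + exists (fun a => a < X) (fun b => Y < b < 0); auto.
      * now exists X.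
      * apply at_left_0_ge. lra.
    + intros [a b] [a' b'] [Ha Hb] [Ha' Hb']. simpl in *.
      change (Rabs (RInt f a' b' - RInt f a b) < eps).
      assert (E1 := RInt_neg_Chasles f a' a b Hf ltac:(lra) ltac:(lra) ltac:(lra)).
      assert (E2 := RInt_neg_Chasles f a' b b' Hf ltac:(lra) ltac:(lra) ltac:(lra)).
      assert (L1 := RInt_neg_abs_le f g a' a Hf Hg Hfg ltac:(lra) ltac:(lra)).
      assert (L2 := RInt_neg_abs_le f g b b' Hf Hg Hfg ltac:(lra) ltac:(lra)).
      specialize (HX a' a Ha' Ha). specialize (HY b b' Hb Hb').
      replace (RInt f a' b' - RInt f a b) with (RInt f a' a + RInt f b b') by lra.
      eapply Rle_lt_trans; [apply Rabs_triang|]. lra.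
  - exists l. now apply improper_filterlim.
Qed.

Lemma RInt_neg_ge (g : R -> R) (a b k : R) :
  continuous_neg g -> a <= b -> b < 0 -> (forall x, a <= x <= b -> k <= g x) ->
  k * (b - a) <= RInt g a b.
Proof.
  intros Hg Hab Hb Hk.
  replace (k * (b - a)) with (RInt (fun _ => k) a b).
  - apply RInt_le; auto.
    + apply (ex_RInt_const (V := R_NormedModule)).
    + apply ex_RInt_neg; auto; lra.
    + intros x Hx. apply Hk. lra.
  - rewrite (RInt_const (V := R_CompleteNormedModule)).
    unfold scal; simpl; unfold mult; simpl. ring.
Qed.

(** Otherwise an interval of unit length inside the tail would carry the mass [eps], against the
    Cauchy criterion. *)
Lemma improper_small_at_m_infty (g : R -> R) (l eps X : R) :
  continuous_neg g -> improper g l -> 0 < eps ->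
  exists a, a < X /\ g a < eps.
Proof.
  intros Hg H He.
  destruct (improper_tails g l Hg H eps He) as [X' [Y [HXY [HX' _]]]].
  set (m := Rmin X X').
  assert (m <= X) by apply Rmin_l. assert (m <= X') by apply Rmin_r.
  apply NNPP. intros Hno.
  assert (Hge : forall x, m - 2 <= x <= m - 1 -> eps <= g x).
  { intros x Hx. apply Rnot_lt_le. intros Hlt. apply Hno. exists x. lra. }
  assert (Hi := RInt_neg_ge g (m - 2) (m - 1) eps Hg
                  ltac:(lra) ltac:(lra) Hge).
  specialize (HX' (m - 2) (m - 1) ltac:(lra) ltac:(lra)).
  apply Rabs_lt_between in HX'. lra.
Qed.

(** The function [1 / |x|] is not integrable at [0]: if [|x| g x >= eps] held near [0], each block
    [[m / 2, m / 4]] would carry at least [eps / 2], however close to [0] it lies. *)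
Lemma improper_small_at_0 (g : R -> R) (l eps Y : R) :
  continuous_neg g -> improper g l -> 0 < eps -> Y < 0 ->
  exists b, Y < b < 0 /\ - b * g b < eps.
Proof.
  intros Hg H He HY0.
  destruct (improper_tails g l Hg H (eps / 2)) as [X [Y' [HXY [_ HY']]]]; [lra|].
  set (m := Rmax Y Y').
  assert (Y <= m) by apply Rmax_l. assert (Y' <= m) by apply Rmax_r.
  assert (m < 0) by (apply Rmax_lub_lt; lra).
  apply NNPP. intros Hno.
  assert (Hge : forall x, m / 2 <= x <= m / 4 -> eps / (- m / 2) <= g x).
  { intros x Hx. apply Rnot_lt_le. intros Hlt. apply Hno. exists x.
    split; [lra|].
    apply Rlt_le_trans with (- x * (eps / (- m / 2))).
    - apply Rmult_lt_compat_l; lra.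
    - replace eps with (- m / 2 * (eps / (- m / 2))) at 2 by (field; lra).
      apply Rmult_le_compat_r; [|lra]. apply Rlt_le, Rdiv_lt_0_compat; lra. }
  assert (Hi := RInt_neg_ge g (m / 2) (m / 4) _ Hg ltac:(lra) ltac:(lra) Hge).
  replace (eps / (- m / 2) * (m / 4 - m / 2)) with (eps / 2) in Hi by (field; lra).
  specialize (HY' (m / 2) (m / 4) ltac:(lra) ltac:(lra)).
  apply Rabs_lt_between in HY'. lra.
Qed.

Definition tends_to_0_at_0 (f : R -> R) : Prop :=
  forall eps, 0 < eps -> exists Y, Y < 0 /\ forall b, Y < b < 0 -> Rabs (f b) < eps.

Definition tends_to_0_at_m_infty (f : R -> R) : Prop :=
  forall eps, 0 < eps -> exists X, forall a, a < X -> Rabs (f a) < eps.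

(* Cauchy-Schwarz for [f x = - int_x^0 f'], through
   [|f'| <= (t + f'^2/t)/2] with [t = 1/sqrt|x|]. *)
Lemma sqrt_decay_at_0 (f f' g : R -> R) (l : R) :
  (forall x, x < 0 -> is_derive f x (f' x)) ->
  continuous_neg g -> (forall x, x < 0 -> f' x ^ 2 <= g x) ->
  improper g l -> tends_to_0_at_0 f ->
  exists Y k, Y < 0 /\ 0 < k /\ forall x, Y < x < 0 -> f x ^ 2 <= k * - x.
Proof.
  intros Hf Hg Hfg H H0.
  destruct (improper_tails g l Hg H 1 Rlt_0_1) as [X [Y [HXY [_ HY]]]].
  exists Y, 1. repeat split; try lra. intros x Hx.
  assert (Hkey : forall t, 0 < t -> Rabs (f x) <= (t * - x + 1 / t) / 2).
  { intros t Ht. apply Rnot_lt_le. intros Hlt.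
    destruct (H0 (Rabs (f x) - (t * - x + 1 / t) / 2)) as [Y' [HY'0 HY']]; [lra|].
    (* Halving a negative number moves it towards [0], so [b] lies to the right of both [x] and
       [Y']. *)
    set (b := Rmax x Y' / 2).
    assert (x <= Rmax x Y') by apply Rmax_l. assert (Y' <= Rmax x Y') by apply Rmax_r.
    assert (Rmax x Y' < 0) by (apply Rmax_lub_lt; lra).
    assert (Hb : x < b < 0) by (unfold b; lra).
    assert (Hfb := HY' b ltac:(unfold b; lra)).
    set (G := fun y => (t * y + RInt g x y / t) / 2).
    assert (Hinc : Rabs (f b - f x) <= G b - G x).
    { apply (increment_bound f G f' (fun s => (t + g s / t) / 2)); try lra.
      - intros s Hs. apply Hf. lra.
      - intros s Hs. unfold G.
        assert (HI : is_derive (fun y => RInt g x y) s (g s)).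
        { apply (is_derive_RInt g _ x).
          - generalize (locally_lt 0 s ltac:(lra)). apply filter_imp. intros y Hy.
            apply (RInt_correct (V := R_CompleteNormedModule)).
            apply ex_RInt_neg; auto; lra.
          - apply Hg. lra. }
        apply (is_derive_ext (fun y => plus (t / 2 * y) (/ (2 * t) * RInt g x y))).
        { intros y. unfold plus; simpl. field. lra. }
        replace ((t + g s / t) / 2) with (plus (t / 2) (/ (2 * t) * g s))
          by (unfold plus; simpl; field; lra).
        apply (is_derive_plus (V := R_NormedModule)).
        + apply is_derive_linear.
        + apply is_derive_scal. exact HI.
      - intros s Hs. specialize (Hfg s ltac:(lra)).
        assert (Hgt : (f' s) ^ 2 / t <= g s / t).
        { apply Rmult_le_compat_r; auto. apply Rlt_le, Rinv_0_lt_compat, Ht. }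
        assert (Hsq : 0 <= (Rabs (f' s) - t) ^ 2 / t).
        { apply Rdiv_le_0_compat; auto. apply pow2_ge_0. }
        replace ((Rabs (f' s) - t) ^ 2 / t)
          with (Rabs (f' s) ^ 2 / t - 2 * Rabs (f' s) + t) in Hsq by (field; lra).
        rewrite pow2_abs in Hsq. lra. }
    assert (HG : G b - G x <= (t * - x + 1 / t) / 2).
    { unfold G. rewrite (RInt_point (V := R_CompleteNormedModule)).
      unfold zero; simpl. specialize (HY x b ltac:(lra) ltac:(lra)).
      apply Rabs_lt_between in HY.
      assert (RInt g x b / t <= 1 / t).
      { apply Rmult_le_compat_r; [|lra]. apply Rlt_le, Rinv_0_lt_compat, Ht. }
      assert (t * b <= 0) by nra. replace (0 / t) with 0 by (unfold Rdiv; ring). lra. }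
    assert (Rabs (f x) <= Rabs (f b) + Rabs (f b - f x)).
    { replace (f x) with (f b - (f b - f x)) at 1 by ring.
      unfold Rminus at 1. eapply Rle_trans; [apply Rabs_triang|].
      rewrite Rabs_Ropp. lra. }
    lra. }
  assert (Hs : 0 < sqrt (- x)) by (apply sqrt_lt_R0; lra).
  assert (Hss : sqrt (- x) * sqrt (- x) = - x) by (apply sqrt_sqrt; lra).
  specialize (Hkey (/ sqrt (- x)) ltac:(now apply Rinv_0_lt_compat)).
  replace ((/ sqrt (- x) * - x + 1 / / sqrt (- x)) / 2) with (sqrt (- x)) in Hkey.
  - rewrite <- pow2_abs. generalize (Rabs_pos (f x)). nra.
  - set (q := sqrt (- x)) in *. rewrite <- Hss. field. lra.
Qed.

(** * Boundary behaviour of admissible perturbations *)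

Lemma improper_plus (f g : R -> R) (lf lg : R) :
  continuous_neg f -> continuous_neg g -> improper f lf -> improper g lg ->
  improper (fun x => f x + g x) (lf + lg).
Proof.
  intros Cf Cg Hf Hg eps He.
  destruct (Hf (eps / 2)) as [X [Y [HXY H]]]; [lra|].
  destruct (Hg (eps / 2)) as [X' [Y' [HXY' H']]]; [lra|].
  assert (HX1 := Rmin_l X X'). assert (HX2 := Rmin_r X X').
  assert (HY1 := Rmax_l Y Y'). assert (HY2 := Rmax_r Y Y').
  exists (Rmin X X'), (Rmax Y Y').
  assert (Rmax Y Y' < 0) by (apply Rmax_lub_lt; lra).
  split; [lra|].
  intros a b Ha Hb.
  replace (RInt (fun x => f x + g x) a b) with (RInt f a b + RInt g a b).
  2: { symmetry. apply (RInt_plus (V := R_CompleteNormedModule) f g a b);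
         apply ex_RInt_neg; auto; lra. }
  specialize (H a b ltac:(lra) ltac:(lra)). specialize (H' a b ltac:(lra) ltac:(lra)).
  apply Rabs_lt_between in H. apply Rabs_lt_between in H'.
  apply Rabs_lt_between. lra.
Qed.

(** In the applications [N] is [|v|^2] and [g] is [|v'|^2]. At minus infinity [N] is small
    everywhere and [g] is small somewhere. Near [0] the remaining length is finite and [g] may blow
    up; integrability makes only [|x| g x] small somewhere, and the missing factor [|x|] is supplied
    by the linear bound on [N]. *)
Lemma boundary_points (N g : R -> R) (l k Y0 : R) :
  continuous_neg g -> improper g l -> (forall x, x < 0 -> 0 <= g x) ->
  (forall x, x < 0 -> 0 <= N x) ->
  tends_to_0_at_m_infty N ->
  Y0 < 0 -> 0 < k -> (forall x, Y0 < x < 0 -> N x <= k * - x) ->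
  forall eps X Y, 0 < eps -> X < 0 -> Y < 0 ->
    exists a b, a < X /\ Y < b < 0 /\
      N a <= eps /\ N a * g a <= eps ^ 2 /\ N b <= eps /\ N b * g b <= eps ^ 2.
Proof.
  intros Cg Hg Hg0 HN0 HNm HY0 Hk HN eps X Y He HX HY.
  destruct (HNm eps He) as [X' HX'].
  destruct (improper_small_at_m_infty g l eps (Rmin X X') Cg Hg He) as [a [Ha Hga]].
  assert (H1 := Rmin_l X X'). assert (H2 := Rmin_r X X').
  (* To the right of [- eps / k] the bound [k * - x] is below [eps]. *)
  set (Y1 := Rmax (Rmax Y Y0) (- eps / k)).
  assert (H3 := Rmax_l Y Y0). assert (H4 := Rmax_r Y Y0).
  assert (H5 := Rmax_l (Rmax Y Y0) (- eps / k)).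
  assert (H6 := Rmax_r (Rmax Y Y0) (- eps / k)). fold Y1 in H5, H6.
  assert (Hek : 0 < eps / k) by (apply Rdiv_lt_0_compat; lra).
  assert (HY1 : Y1 < 0).
  { unfold Y1. repeat apply Rmax_lub_lt; auto. unfold Rdiv in *. lra. }
  assert (He2 : 0 < eps ^ 2 / k) by (apply Rdiv_lt_0_compat; nra).
  destruct (improper_small_at_0 g l _ Y1 Cg Hg He2 HY1) as [b [Hb Hgb]].
  assert (Hab : Rabs (N a) < eps) by (apply HX'; lra).
  apply Rabs_lt_between in Hab.
  assert (Hga0 := Hg0 a ltac:(lra)). assert (HNa0 := HN0 a ltac:(lra)).
  assert (Hgb0 := Hg0 b ltac:(lra)). assert (HNb := HN b ltac:(lra)).
  exists a, b. repeat split; try lra.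
  - nra.
  - apply Rle_trans with (1 := HNb).
    replace eps with (k * (eps / k)) by (field; lra).
    apply Rmult_le_compat_l; [lra|]. unfold Rdiv in *. lra.
  - apply Rle_trans with (k * - b * g b).
    + apply Rmult_le_compat_r; auto.
    + replace (eps ^ 2) with (k * (eps ^ 2 / k)) by (field; lra).
      rewrite Rmult_assoc. apply Rmult_le_compat_l; lra.
Qed.

Lemma dot_nonneg (p : R * R) : 0 <= dot p p.
Proof. unfold dot. nra. Qed.

Lemma continuous_Rplus (f g : R -> R) (x : R) :
  continuous f x -> continuous g x -> continuous (fun y => f y + g y) x.
Proof. apply (continuous_plus (V := R_NormedModule)). Qed.

Lemma continuous_Rmult (f g : R -> R) (x : R) :
  continuous f x -> continuous g x -> continuous (fun y => f y * g y) x.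
Proof. apply (continuous_mult (K := R_AbsRing)). Qed.

Lemma continuous_Ropp (f : R -> R) (x : R) :
  continuous f x -> continuous (fun y => - f y) x.
Proof. apply (continuous_opp (V := R_NormedModule)). Qed.

Lemma continuous_Rminus (f g : R -> R) (x : R) :
  continuous f x -> continuous g x -> continuous (fun y => f y - g y) x.
Proof. apply (continuous_minus (V := R_NormedModule)). Qed.

Lemma continuous_Rpow (f : R -> R) (n : nat) (x : R) :
  continuous f x -> continuous (fun y => f y ^ n) x.
Proof.
  intros Hf. induction n as [|n IH]; simpl.
  - apply continuous_const.
  - now apply continuous_Rmult.
Qed.

Lemma continuous_Rinv_comp (f : R -> R) (x : R) :
  continuous f x -> f x <> 0 -> continuous (fun y => / f y) x.
Proof.
  intros Hf Hx. apply (continuous_comp f Rinv); auto. now apply continuous_Rinv.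
Qed.

Ltac cont_leaf :=
  match goal with
  | H : continuous ?f ?x |- continuous ?g ?x =>
      let a := eval cbv beta in (f x) in
      let b := eval cbv beta in (g x) in
      constr_eq a b; exact H
  | |- continuous (fun y => y) _ => apply continuous_id
  | |- _ => idtac
  end.

(* Purely syntactic: unification up to conversion would unfold [Derive]. *)
Ltac cont :=
  cbv beta; unfold Rdiv;
  lazymatch goal with
  | |- continuous (fun _ => ?c) _ => apply continuous_const
  | |- continuous (fun y => @?f y + @?g y) ?x => apply (continuous_Rplus f g x); cont
  | |- continuous (fun y => @?f y - @?g y) ?x => apply (continuous_Rminus f g x); cont
  | |- continuous (fun y => @?f y * @?g y) ?x => apply (continuous_Rmult f g x); cont
  | |- continuous (fun y => - @?f y) ?x => apply (continuous_Ropp f x); cont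
  | |- continuous (fun y => @?f y ^ ?n) ?x => apply (continuous_Rpow f n x); cont
  | |- continuous (fun y => / @?f y) ?x => apply (continuous_Rinv_comp f x); [cont | cbv beta]
  | |- continuous _ _ => cont_leaf
  end.

Definition perturbation_regular (v : R -> R * R) : Prop :=
  C2_negative (comp1 v) /\ C2_negative (comp2 v).

Lemma C2_negative_derive (f : R -> R) (x : R) :
  C2_negative f -> x < 0 ->
  is_derive f x (Derive f x) /\ is_derive (Derive f) x (Derive_n f 2 x) /\
  continuous (Derive_n f 2) x /\ continuous f x /\ continuous (Derive f) x.
Proof.
  intros H Hx. destruct (H x Hx) as [H1 [H2 H3]].
  assert (D1 := Derive_correct f x H1).
  assert (D2 := Derive_correct (Derive f) x H2).
  split; [exact D1|split; [exact D2|split; [exact H3|split]]].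
  - apply (is_derive_cont _ _ _ D1).
  - apply (is_derive_cont _ _ _ D2).
Qed.

(* [Defs.E1] is qualified because [Reals] exports another [E1]. *)
Definition coefficients (ell : R) (s : fields) (rad : R -> R) (z12 z21 : R -> R)
    (M : R) : Prop :=
  forall x, x < 0 ->
    is_derive z12 x (E2 ell s (rad x)) /\ is_derive z21 x (E3 ell s (rad x)) /\
    z12 x = z21 x + 2 * falpha s (rad x) /\
    Rabs (z12 x) <= M /\ Rabs (z21 x) <= M /\
    continuous (fun y => Defs.E1 ell s (rad y)) x /\
    continuous (fun y => E2 ell s (rad y)) x /\
    continuous (fun y => E3 ell s (rad y)) x /\
    continuous (fun y => E4 ell s (rad y)) x.

(** [2 alpha] is the difference of the differentiable functions [z12] and [z21], which spares
    [coefficients] a separate continuity clause. *)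
Lemma continuous_falpha_rad ell s rad z12 z21 M x :
  coefficients ell s rad z12 z21 M -> x < 0 ->
  continuous (fun y => falpha s (rad y)) x.
Proof.
  intros H Hx.
  apply (continuous_ext_loc _ (fun y => / 2 * (z12 y - z21 y))).
  - generalize (locally_lt 0 x Hx). apply filter_imp. intros y Hy.
    destruct (H y Hy) as (_ & _ & E & _).
    change (/ 2 * (z12 y - z21 y) = falpha s (rad y)). rewrite E. field.
  - destruct (H x Hx) as (D1 & D2 & _).
    apply is_derive_cont in D1. apply is_derive_cont in D2. cont.
Qed.

Lemma continuous_Uop ell s rad z12 z21 M v x :
  coefficients ell s rad z12 z21 M -> perturbation_regular v -> x < 0 ->
  continuous (fun y => fst (Uop ell s rad v y)) x /\
  continuous (fun y => snd (Uop ell s rad v y)) x.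
Proof.
  intros H [R1 R2] Hx.
  assert (Ca := continuous_falpha_rad _ _ _ _ _ _ _ H Hx).
  destruct (H x Hx) as (_ & _ & _ & _ & _ & C1 & C2 & C3 & C4).
  destruct (C2_negative_derive _ x R1 Hx) as (_ & _ & A2 & A0 & A1).
  destruct (C2_negative_derive _ x R2 Hx) as (_ & _ & B2 & B0 & B1).
  unfold Uop; cbn [fst snd].
  split; cont.
Qed.

Lemma continuous_neg_dot (p q : R -> R * R) :
  (forall x, x < 0 -> continuous (fun y => fst (p y)) x /\
                      continuous (fun y => snd (p y)) x) ->
  (forall x, x < 0 -> continuous (fun y => fst (q y)) x /\
                      continuous (fun y => snd (q y)) x) ->
  continuous_neg (fun x => dot (p x) (q x)).
Proof.
  intros Hp Hq x Hx. destruct (Hp x Hx). destruct (Hq x Hx). unfold dot. cont.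
Qed.

Lemma continuous_perturbation v x :
  perturbation_regular v -> x < 0 ->
  continuous (fun y => fst (v y)) x /\ continuous (fun y => snd (v y)) x.
Proof.
  intros [R1 R2] Hx. split.
  - apply (C2_negative_derive (comp1 v) x R1 Hx).
  - apply (C2_negative_derive (comp2 v) x R2 Hx).
Qed.

Lemma continuous_derivative v x :
  perturbation_regular v -> x < 0 ->
  continuous (fun y => fst (derivative v y)) x /\
  continuous (fun y => snd (derivative v y)) x.
Proof.
  intros [R1 R2] Hx. split.
  - apply (C2_negative_derive (comp1 v) x R1 Hx).
  - apply (C2_negative_derive (comp2 v) x R2 Hx).
Qed.

Lemma square_integrable_improper (v : R -> R * R) :
  continuous_neg (fun x => dot (v x) (v x)) -> square_integrable v ->
  exists l, improper (fun x => dot (v x) (v x)) l.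
Proof.
  intros Hc [l Hl]. exists l. now apply improper_is_RInt_gen.
Qed.

(** [RInt_gen] denotes an integral only once convergence is known. That comes from domination:
    [|p . q| <= p . p + q . q]. *)
Lemma inner_improper (p q : R -> R * R) :
  (forall x, x < 0 -> continuous (fun y => fst (p y)) x /\
                      continuous (fun y => snd (p y)) x) ->
  (forall x, x < 0 -> continuous (fun y => fst (q y)) x /\
                      continuous (fun y => snd (q y)) x) ->
  square_integrable p -> square_integrable q ->
  improper (fun x => dot (p x) (q x)) (inner p q).
Proof.
  intros Hp Hq Sp Sq.
  assert (Cp := continuous_neg_dot p p Hp Hp).
  assert (Cq := continuous_neg_dot q q Hq Hq).
  assert (Cpq := continuous_neg_dot p q Hp Hq).
  destruct (square_integrable_improper p Cp Sp) as [lp Lp].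
  destruct (square_integrable_improper q Cq Sq) as [lq Lq].
  destruct (improper_dominated (fun x => dot (p x) (q x))
    (fun x => dot (p x) (p x) + dot (q x) (q x)) (lp + lq)) as [l Hl]; auto.
  - intros x Hx. specialize (Cp x Hx). specialize (Cq x Hx). cont.
  - intros x Hx. unfold dot. destruct (p x) as [p1 p2], (q x) as [q1 q2]; simpl.
    assert (H1 := pow2_ge_0 (p1 - q1)). assert (H2 := pow2_ge_0 (p2 - q2)).
    assert (H3 := pow2_ge_0 (p1 + q1)). assert (H4 := pow2_ge_0 (p2 + q2)).
    apply Rabs_le. nra.
  - now apply improper_plus.
  - assert (E : inner p q = l).
    { exact (@is_RInt_gen_unique R_CompleteNormedModule (Rbar_locally m_infty)
               (at_left 0)
               (Proper_StrongProper _ (Rbar_locally_filter m_infty))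
               (Proper_StrongProper _ (at_left_proper_filter 0))
               (fun x => dot (p x) (q x)) l
               (proj2 (improper_is_RInt_gen _ l Cpq) Hl)). }
    now rewrite E.
Qed.

Lemma vanishes_m_infty (f : R -> R) :
  vanishes_at_ends f -> tends_to_0_at_m_infty f.
Proof.
  intros [H _] eps He.
  destruct (H (fun y => Rabs y < eps)) as [X HX].
  - exists (mkposreal _ He). intros y Hy. change (Rabs (y - 0) < eps) in Hy.
    now rewrite Rminus_0_r in Hy.
  - exists X. auto.
Qed.

Lemma vanishes_0 (f : R -> R) : vanishes_at_ends f -> tends_to_0_at_0 f.
Proof.
  intros [_ H] eps He.
  destruct (at_left_0_interval (fun x => Rabs (f x) < eps)) as [Y [HY0 HY]].
  - apply (H (fun y => Rabs y < eps)).
    exists (mkposreal _ He). intros y Hy. change (Rabs (y - 0) < eps) in Hy.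
    now rewrite Rminus_0_r in Hy.
  - exists Y. auto.
Qed.

Lemma tends_to_0_at_m_infty_sum_sq (f g : R -> R) :
  tends_to_0_at_m_infty f -> tends_to_0_at_m_infty g ->
  tends_to_0_at_m_infty (fun x => f x * f x + g x * g x).
Proof.
  intros Hf Hg eps He.
  set (e := Rmin 1 (eps / 2)).
  assert (0 < e) by (apply Rmin_pos; lra).
  assert (e <= 1) by apply Rmin_l. assert (e <= eps / 2) by apply Rmin_r.
  destruct (Hf e) as [X HX]; auto. destruct (Hg e) as [X' HX']; auto.
  exists (Rmin X X'). intros a Ha.
  assert (H3 := Rmin_l X X'). assert (H4 := Rmin_r X X').
  specialize (HX a ltac:(lra)). specialize (HX' a ltac:(lra)).
  apply Rabs_lt_between in HX. apply Rabs_lt_between in HX'.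
  apply Rabs_lt_between. nra.
Qed.

Lemma Rabs_le_of_sq (p eps : R) : 0 <= eps -> p ^ 2 <= eps ^ 2 -> Rabs p <= eps.
Proof. intros He Hp. apply Rabs_le. nra. Qed.

Lemma perturbation_decay_at_0 (v : R -> R * R) (g : R -> R) (l : R) :
  perturbation_regular v ->
  vanishes_at_ends (comp1 v) -> vanishes_at_ends (comp2 v) ->
  continuous_neg g -> improper g l ->
  (forall x, x < 0 -> dot (derivative v x) (derivative v x) <= g x) ->
  exists Y k, Y < 0 /\ 0 < k /\ forall x, Y < x < 0 -> dot (v x) (v x) <= k * - x.
Proof.
  intros [R1 R2] V1 V2 Cg Hg Hle.
  destruct (sqrt_decay_at_0 (comp1 v) (Derive (comp1 v)) g l) as (Y & k & HY & Hk & H);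
    auto using vanishes_0.
  { intros x Hx. exact (proj1 (C2_negative_derive _ x R1 Hx)). }
  { intros x Hx. specialize (Hle x Hx). unfold dot, derivative in Hle. simpl in Hle. nra. }
  destruct (sqrt_decay_at_0 (comp2 v) (Derive (comp2 v)) g l)
    as (Y' & k' & HY' & Hk' & H'); auto using vanishes_0.
  { intros x Hx. exact (proj1 (C2_negative_derive _ x R2 Hx)). }
  { intros x Hx. specialize (Hle x Hx). unfold dot, derivative in Hle. simpl in Hle. nra. }
  exists (Rmax Y Y'), (k + k'). repeat split; try lra.
  { now apply Rmax_lub_lt. }
  intros x Hx. assert (H3 := Rmax_l Y Y'). assert (H4 := Rmax_r Y Y').
  specialize (H x ltac:(lra)). specialize (H' x ltac:(lra)).
  unfold dot, comp1, comp2 in *. nra.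
Qed.

(** The same endpoints must serve [u] and [v], so [boundary_points] is applied to the sums of their
    squares. Then [n * d] dominates the square of every product of a component with a derivative of
    a component. *)
Lemma admissible_boundary ell s rad u v :
  admissible ell s rad u -> admissible ell s rad v ->
  forall eps X Y, 0 < eps -> X < 0 -> Y < 0 ->
    exists a b, a < X /\ Y < b < 0 /\
      forall c, c = a \/ c = b ->
        let n := dot (u c) (u c) + dot (v c) (v c) in
        let d := dot (derivative u c) (derivative u c)
                 + dot (derivative v c) (derivative v c) in
        n <= eps /\ n * d <= eps ^ 2.
Proof.
  intros (U1 & U2 & VU1 & VU2 & SU & SU' & _) (V1 & V2 & VV1 & VV2 & SV & SV' & _)
    eps X Y He HX HY.
  assert (RU : perturbation_regular u) by (split; auto).
  assert (RV : perturbation_regular v) by (split; auto).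
  set (gu := fun x => dot (derivative u x) (derivative u x)).
  set (gv := fun x => dot (derivative v x) (derivative v x)).
  assert (Cu : continuous_neg gu)
    by (apply continuous_neg_dot; intros; now apply continuous_derivative).
  assert (Cv : continuous_neg gv)
    by (apply continuous_neg_dot; intros; now apply continuous_derivative).
  destruct (square_integrable_improper _ Cu SU') as [lu Lu].
  destruct (square_integrable_improper _ Cv SV') as [lv Lv].
  destruct (perturbation_decay_at_0 u gu lu) as (Yu & ku & HYu & Hku & Hu); auto.
  { intros; unfold gu; lra. }
  destruct (perturbation_decay_at_0 v gv lv) as (Yv & kv & HYv & Hkv & Hv); auto.
  { intros; unfold gv; lra. }
  assert (H3 := Rmax_l Yu Yv). assert (H4 := Rmax_r Yu Yv).
  destruct (boundary_points (fun x => dot (u x) (u x) + dot (v x) (v x))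
    (fun x => gu x + gv x) (lu + lv) (ku + kv) (Rmax Yu Yv)) with (eps := eps) (X := X) (Y := Y)
    as (a & b & Ha & Hb & H1 & H2 & H5 & H6); auto.
  - intros x Hx. specialize (Cu x Hx). specialize (Cv x Hx). cont.
  - now apply improper_plus.
  - intros x Hx. generalize (dot_nonneg (derivative u x)) (dot_nonneg (derivative v x)).
    unfold gu, gv. lra.
  - intros x Hx. generalize (dot_nonneg (u x)) (dot_nonneg (v x)). lra.
  - intros e Hee.
    destruct (tends_to_0_at_m_infty_sum_sq (comp1 u) (comp2 u)
      (vanishes_m_infty _ VU1) (vanishes_m_infty _ VU2) (e / 2)) as [X1 HX1]; [lra|].
    destruct (tends_to_0_at_m_infty_sum_sq (comp1 v) (comp2 v)
      (vanishes_m_infty _ VV1) (vanishes_m_infty _ VV2) (e / 2)) as [X2 HX2]; [lra|].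
    exists (Rmin X1 X2). intros x Hx.
    assert (H7 := Rmin_l X1 X2). assert (H8 := Rmin_r X1 X2).
    specialize (HX1 x ltac:(lra)). specialize (HX2 x ltac:(lra)).
    apply Rabs_lt_between in HX1. apply Rabs_lt_between in HX2.
    apply Rabs_lt_between. unfold dot, comp1, comp2 in *. lra.
  - now apply Rmax_lub_lt.
  - lra.
  - intros x Hx. specialize (Hu x ltac:(lra)). specialize (Hv x ltac:(lra)). lra.
  - exists a, b. repeat split; try lra; destruct H as [->| ->]; auto.
Qed.

(** * Symmetry and positivity of the perturbation operator *)

Lemma wronskian_derive (u1 u2 v1 v2 u1' u2' v1' v2' w1 w2 : R -> R)
    (x U1 U2 V1 V2 W1 W2 : R) :
  is_derive u1 x (u1' x) -> is_derive u2 x (u2' x) ->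
  is_derive v1 x (v1' x) -> is_derive v2 x (v2' x) ->
  is_derive u1' x U1 -> is_derive u2' x U2 ->
  is_derive v1' x V1 -> is_derive v2' x V2 ->
  is_derive w1 x W1 -> is_derive w2 x W2 ->
  is_derive (fun y => - (u1 y * v1' y + u2 y * v2' y) + (u1' y * v1 y + u2' y * v2 y)
                      + (w1 y - w2 y) * (u1 y * v2 y - u2 y * v1 y)) x
    (- (u1 x * V1 + u2 x * V2) + (U1 * v1 x + U2 * v2 x)
     + (W1 - W2) * (u1 x * v2 x - u2 x * v1 x)
     + (w1 x - w2 x) * (u1' x * v2 x + u1 x * v2' x - u2' x * v1 x - u2 x * v1' x)).
Proof.
  intros. auto_derive.
  - repeat split; eexists; eassumption.
  - repeat match goal with
    | H : is_derive ?f ?y ?l |- context [Derive (fun z => ?f z) ?y] =>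
        change (Derive (fun z => f z) y) with (Derive f y);
        rewrite (is_derive_unique f y l H)
    end. ring.
Qed.

Lemma energy_derive (v1 v2 v1' v2' w1 w2 : R -> R) (x V1 V2 W1 W2 : R) :
  is_derive v1 x (v1' x) -> is_derive v2 x (v2' x) ->
  is_derive v1' x V1 -> is_derive v2' x V2 ->
  is_derive w1 x W1 -> is_derive w2 x W2 ->
  is_derive (fun y => - (v1 y * v1' y + v2 y * v2' y)
                      + (w1 y + w2 y) * (v1 y * v2 y)) x
    (- (v1 x * V1 + v2 x * V2) - (v1' x ^ 2 + v2' x ^ 2)
     + (W1 + W2) * (v1 x * v2 x)
     + (w1 x + w2 x) * (v1' x * v2 x + v1 x * v2' x)).
Proof.
  intros. auto_derive.
  - repeat split; eexists; eassumption.
  - repeat match goal with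
    | H : is_derive ?f ?y ?l |- context [Derive (fun z => ?f z) ?y] =>
        change (Derive (fun z => f z) y) with (Derive f y);
        rewrite (is_derive_unique f y l H)
    end. ring.
Qed.

Lemma RInt_neg_derive (W w : R -> R) (a b : R) :
  a <= b -> b < 0 -> (forall x, x < 0 -> is_derive W x (w x)) -> continuous_neg w ->
  RInt w a b = W b - W a.
Proof.
  intros Hab Hb HW Hw.
  apply (is_RInt_unique (V := R_CompleteNormedModule)).
  apply (is_RInt_derive (V := R_CompleteNormedModule) W w a b); intros x Hx;
    rewrite Rmin_left, Rmax_right in Hx by lra.
  - apply HW. lra.
  - apply Hw. lra.
Qed.

Lemma Rabs_mult_le_of_sq (p q n d eps : R) :
  0 <= eps -> p ^ 2 <= n -> q ^ 2 <= d -> n * d <= eps ^ 2 -> Rabs (p * q) <= eps.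
Proof.
  intros He Hp Hq Hnd. apply Rabs_le_of_sq; auto.
  apply Rle_trans with (2 := Hnd). rewrite Rpow_mult_distr.
  apply Rmult_le_compat; auto; apply pow2_ge_0.
Qed.

(** [E2 - E3 = 2 mu S alpha'] is the derivative of [2 alpha] along the tortoise coordinate. The
    asymmetry of the potential matrix therefore completes the first-order part to the total
    derivative of [2 alpha (u1 v2 - u2 v1)]. Together with the Wronskian of [- d^2] this makes
    [u . U v - U u . v] the derivative of [W]. *)
Lemma Uop_symmetric ell s rad z12 z21 M u v :
  coefficients ell s rad z12 z21 M ->
  admissible ell s rad u -> admissible ell s rad v ->
  inner u (Uop ell s rad v) = inner (Uop ell s rad u) v.
Proof.
  intros H Au Av.
  assert (RU : perturbation_regular u) by (split; apply Au).
  assert (RV : perturbation_regular v) by (split; apply Av).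
  assert (Cu := fun x => continuous_perturbation u x RU).
  assert (Cv := fun x => continuous_perturbation v x RV).
  assert (CUu := fun x => continuous_Uop _ _ _ _ _ _ u x H RU).
  assert (CUv := fun x => continuous_Uop _ _ _ _ _ _ v x H RV).
  set (p := Uop ell s rad v) in *. set (q := Uop ell s rad u) in *.
  assert (I1 : improper (fun x => dot (u x) (p x)) (inner u p)).
  { apply inner_improper; auto; [apply Au | apply Av]. }
  assert (I2 : improper (fun x => dot (q x) (v x)) (inner q v)).
  { apply inner_improper; auto; [apply Au | apply Av]. }
  assert (C1 := continuous_neg_dot u p Cu CUv).
  assert (C2 := continuous_neg_dot q v CUu Cv).
  set (W := fun y =>
    - (comp1 u y * Derive (comp1 v) y + comp2 u y * Derive (comp2 v) y)
    + (Derive (comp1 u) y * comp1 v y + Derive (comp2 u) y * comp2 v y)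
    + (z12 y - z21 y) * (comp1 u y * comp2 v y - comp2 u y * comp1 v y)).
  assert (DW : forall x, x < 0 ->
    is_derive W x (dot (u x) (p x) - dot (q x) (v x))).
  { intros x Hx. destruct (H x Hx) as (D12 & D21 & E12 & _).
    destruct RU as [RU1 RU2], RV as [RV1 RV2].
    destruct (C2_negative_derive _ x RU1 Hx) as (A1 & A2 & _).
    destruct (C2_negative_derive _ x RU2 Hx) as (B1 & B2 & _).
    destruct (C2_negative_derive _ x RV1 Hx) as (F1 & F2 & _).
    destruct (C2_negative_derive _ x RV2 Hx) as (G1 & G2 & _).
    assert (D := wronskian_derive _ _ _ _ _ _ _ _ _ _ _ _ _ _ _ _ _
                   A1 B1 F1 G1 A2 B2 F2 G2 D12 D21).
    unfold W. evar_last; [exact D|].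
    unfold p, q, dot, Uop, comp1, comp2 in *. cbn [fst snd].
    rewrite E12. ring. }
  assert (CW : continuous_neg (fun x => dot (u x) (p x) - dot (q x) (v x))).
  { intros x Hx. specialize (C1 x Hx). specialize (C2 x Hx). cont. }
  assert (HM : 0 <= M).
  { destruct (H (-1) ltac:(lra)) as (_ & _ & _ & HM & _).
    generalize (Rabs_pos (z12 (-1))). lra. }
  destruct (Req_dec (inner u p) (inner q v)) as [E|Hne]; auto. exfalso.
  set (del := Rabs (inner u p - inner q v)).
  assert (Hdel : 0 < del) by (apply Rabs_pos_lt; lra).
  (* [W] consists of four products of size at most [eps] and a term of size at most [2 * M * eps],
     so [|W| <= del / 4] at each endpoint. With the two truncation errors [del / 8] the total stays
     below [del]. *)
  set (eps := del / (4 * (4 + 2 * M))).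
  assert (Heps : 0 < eps) by (apply Rdiv_lt_0_compat; lra).
  destruct (I1 (del / 8)) as (X1 & Y1 & HXY1 & H1); [lra|].
  destruct (I2 (del / 8)) as (X2 & Y2 & HXY2 & H2); [lra|].
  assert (HX1 := Rmin_l X1 X2). assert (HX2 := Rmin_r X1 X2).
  assert (HY1 := Rmax_l Y1 Y2). assert (HY2 := Rmax_r Y1 Y2).
  assert (HY0 : Rmax Y1 Y2 < 0) by (apply Rmax_lub_lt; lra).
  destruct (admissible_boundary ell s rad u v Au Av eps (Rmin X1 X2) (Rmax Y1 Y2))
    as (a & b & Ha & Hb & Hc); auto; try lra.
  assert (HW : forall c, c < 0 -> c = a \/ c = b -> Rabs (W c) <= del / 4).
  { intros c Hc0 Hcab. destruct (Hc c Hcab) as [Hn Hnd].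
    destruct (H c Hc0) as (_ & _ & _ & M1 & M2 & _).
    set (n := dot (u c) (u c) + dot (v c) (v c)) in *.
    set (d := dot (derivative u c) (derivative u c)
              + dot (derivative v c) (derivative v c)) in *.
    assert (T : forall i j, i ^ 2 <= n -> j ^ 2 <= d -> Rabs (i * j) <= eps).
    { intros i j Hi Hj. apply (Rabs_mult_le_of_sq i j n d); auto. lra. }
    assert (T1 : Rabs (comp1 u c * Derive (comp1 v) c) <= eps)
      by (apply T; unfold n, d, dot, derivative, comp1, comp2; cbn [fst snd]; nra).
    assert (T2 : Rabs (comp2 u c * Derive (comp2 v) c) <= eps)
      by (apply T; unfold n, d, dot, derivative, comp1, comp2; cbn [fst snd]; nra).
    assert (T3 : Rabs (comp1 v c * Derive (comp1 u) c) <= eps)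
      by (apply T; unfold n, d, dot, derivative, comp1, comp2; cbn [fst snd]; nra).
    assert (T4 : Rabs (comp2 v c * Derive (comp2 u) c) <= eps)
      by (apply T; unfold n, d, dot, derivative, comp1, comp2; cbn [fst snd]; nra).
    assert (T5 : Rabs (comp1 u c * comp2 v c - comp2 u c * comp1 v c) <= eps).
    { apply Rle_trans with (2 := Hn). unfold n, dot, comp1, comp2.
      apply Rabs_le.
      assert (S1 := pow2_ge_0 (fst (u c) - snd (v c))).
      assert (S2 := pow2_ge_0 (fst (u c) + snd (v c))).
      assert (S3 := pow2_ge_0 (snd (u c) - fst (v c))).
      assert (S4 := pow2_ge_0 (snd (u c) + fst (v c))). nra. }
    assert (T6 : Rabs ((z12 c - z21 c) *
      (comp1 u c * comp2 v c - comp2 u c * comp1 v c)) <= 2 * M * eps).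
    { rewrite Rabs_mult. apply Rmult_le_compat; auto using Rabs_pos.
      unfold Rminus. eapply Rle_trans; [apply Rabs_triang|].
      rewrite Rabs_Ropp. lra. }
    assert (Hfin : (4 + 2 * M) * eps = del / 4) by (unfold eps; field; lra).
    unfold W.
    apply Rabs_le_between in T1. apply Rabs_le_between in T2.
    apply Rabs_le_between in T3. apply Rabs_le_between in T4.
    apply Rabs_le_between in T6. apply Rabs_le. lra. }
  assert (Ea := HW a ltac:(lra) ltac:(auto)). assert (Eb := HW b ltac:(lra) ltac:(auto)).
  assert (EW := RInt_neg_derive W _ a b ltac:(lra) ltac:(lra) DW CW).
  assert (ED : RInt (fun x => dot (u x) (p x) - dot (q x) (v x)) a b
               = RInt (fun x => dot (u x) (p x)) a b
                 - RInt (fun x => dot (q x) (v x)) a b).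
  { apply (RInt_minus (V := R_CompleteNormedModule) (fun x => dot (u x) (p x))
      (fun x => dot (q x) (v x)) a b); apply ex_RInt_neg; auto; lra. }
  specialize (H1 a b ltac:(lra) ltac:(lra)). specialize (H2 a b ltac:(lra) ltac:(lra)).
  assert (Hlt : del < del); [|lra].
  unfold del at 1. apply Rabs_lt_between in H1. apply Rabs_lt_between in H2.
  apply Rabs_le_between in Ea. apply Rabs_le_between in Eb.
  apply Rabs_lt_between. lra.
Qed.

(** The first-order part contributes [(z12 - z21) (v1 v2' - v2 v1')] and the boundary term
    contributes [- (z12 + z21) (v1 v2)']. Their sum is [- 2 z12 v1' v2 - 2 z21 v1 v2'], exactly the
    cross terms of the two squares; completing these costs [z21^2 v1^2 + z12^2 v2^2], the squares
    subtracted in [K1] and [K2]. Strict positivity comes from the mass of [Q] near a point where [v]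
    does not vanish, which is fixed before the endpoints are chosen. *)
Lemma Uop_positive ell s rad z12 z21 M v :
  coefficients ell s rad z12 z21 M ->
  (forall x, x < 0 -> 0 < Defs.E1 ell s (rad x) - z21 x ^ 2 /\
                      0 < E4 ell s (rad x) - z12 x ^ 2) ->
  admissible ell s rad v ->
  (exists x, x < 0 /\ v x <> (0, 0)) ->
  0 < inner v (Uop ell s rad v).
Proof.
  intros H HK Av [x0 [Hx0 Hv0]].
  assert (RV : perturbation_regular v) by (split; apply Av).
  assert (Cv := fun x => continuous_perturbation v x RV).
  assert (CUv := fun x => continuous_Uop _ _ _ _ _ _ v x H RV).
  set (p := Uop ell s rad v) in *.
  assert (I1 : improper (fun x => dot (v x) (p x)) (inner v p)).
  { apply inner_improper; auto; apply Av. }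
  assert (C1 := continuous_neg_dot v p Cv CUv).
  set (Q := fun x =>
    (Derive (comp1 v) x - z12 x * comp2 v x) ^ 2
    + (Derive (comp2 v) x - z21 x * comp1 v x) ^ 2
    + ((Defs.E1 ell s (rad x) - z21 x ^ 2) * comp1 v x ^ 2
       + (E4 ell s (rad x) - z12 x ^ 2) * comp2 v x ^ 2)).
  set (W := fun y =>
    - (comp1 v y * Derive (comp1 v) y + comp2 v y * Derive (comp2 v) y)
    + (z12 y + z21 y) * (comp1 v y * comp2 v y)).
  assert (DW : forall x, x < 0 -> is_derive W x (dot (v x) (p x) - Q x)).
  { intros x Hx. destruct (H x Hx) as (D12 & D21 & E12 & _).
    destruct RV as [RV1 RV2].
    destruct (C2_negative_derive _ x RV1 Hx) as (F1 & F2 & _).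
    destruct (C2_negative_derive _ x RV2 Hx) as (G1 & G2 & _).
    assert (D := energy_derive _ _ _ _ _ _ _ _ _ _ _ F1 G1 F2 G2 D12 D21).
    unfold W. evar_last; [exact D|].
    unfold Q, p, dot, Uop, comp1, comp2 in *. cbn [fst snd].
    replace (falpha s (rad x)) with ((z12 x - z21 x) / 2) by (rewrite E12; field).
    field. }
  assert (CQ : continuous_neg Q).
  { intros x Hx. destruct (H x Hx) as (D12 & D21 & _ & _ & _ & K1 & _ & _ & K4).
    apply is_derive_cont in D12. apply is_derive_cont in D21.
    destruct RV as [RV1 RV2].
    destruct (C2_negative_derive _ x RV1 Hx) as (_ & _ & _ & A0 & A1).
    destruct (C2_negative_derive _ x RV2 Hx) as (_ & _ & _ & B0 & B1).
    unfold Q. cont. }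
  assert (Q0 : forall x, x < 0 -> 0 <= Q x).
  { intros x Hx. destruct (HK x Hx). unfold Q.
    assert (S1 := pow2_ge_0 (comp1 v x)). assert (S2 := pow2_ge_0 (comp2 v x)).
    assert (S3 := pow2_ge_0 (Derive (comp1 v) x - z12 x * comp2 v x)).
    assert (S4 := pow2_ge_0 (Derive (comp2 v) x - z21 x * comp1 v x)). nra. }
  assert (Qx0 : 0 < Q x0).
  { destruct (HK x0 Hx0) as [K1 K2]. unfold Q.
    assert (S3 := pow2_ge_0 (Derive (comp1 v) x0 - z12 x0 * comp2 v x0)).
    assert (S4 := pow2_ge_0 (Derive (comp2 v) x0 - z21 x0 * comp1 v x0)).
    assert (S1 := pow2_ge_0 (comp1 v x0)). assert (S2 := pow2_ge_0 (comp2 v x0)).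
    assert (S : 0 < comp1 v x0 ^ 2 \/ 0 < comp2 v x0 ^ 2).
    { unfold comp1, comp2 in *. destruct (v x0) as [c1 c2]; cbn [fst snd] in *.
      destruct (Req_dec c1 0) as [->|]; [destruct (Req_dec c2 0) as [->|]|].
      - now elim Hv0.
      - right. nra.
      - left. nra. }
    destruct S; nra. }
  destruct (proj1 (filterlim_locally Q (Q x0)) (CQ x0 Hx0)
              (mkposreal (Q x0 / 2) ltac:(lra))) as [r Hr].
  set (h := Rmin r (- x0) / 2).
  assert (R1 := Rmin_l r (- x0)). assert (R2 := Rmin_r r (- x0)).
  assert (R3 : 0 < Rmin r (- x0)) by (apply Rmin_pos; [apply cond_pos | lra]).
  assert (Hint : 0 < RInt Q (x0 - h) (x0 + h)).
  { apply Rlt_le_trans with (Q x0 / 2 * ((x0 + h) - (x0 - h))).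
    - unfold h. nra.
    - apply RInt_neg_ge; auto; try (unfold h; lra).
      intros y Hy. assert (Hb : Rabs (Q y - Q x0) < Q x0 / 2).
      { apply (Hr y). change (Rabs (y - x0) < r). unfold h in Hy.
        apply Rabs_lt_between. lra. }
      apply Rabs_lt_between in Hb. lra. }
  set (q := RInt Q (x0 - h) (x0 + h)) in *.
  assert (HM : 0 <= M).
  { destruct (H (-1) ltac:(lra)) as (_ & _ & _ & HM & _).
    generalize (Rabs_pos (z12 (-1))). lra. }
  (* Now [|W| <= q / 4] at each endpoint: of the mass [q] the boundary terms consume at most [q / 2]
     and the truncation less than [q / 4]. *)
  set (eps := q / (4 * (2 + 2 * M))).
  assert (Heps : 0 < eps) by (apply Rdiv_lt_0_compat; lra).
  destruct (I1 (q / 4)) as (X1 & Y1 & HXY1 & H1); [lra|].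
  assert (HX1 := Rmin_l X1 (x0 - h)). assert (HX2 := Rmin_r X1 (x0 - h)).
  assert (HY1 := Rmax_l Y1 (x0 + h)). assert (HY2 := Rmax_r Y1 (x0 + h)).
  assert (HY0 : Rmax Y1 (x0 + h) < 0) by (apply Rmax_lub_lt; unfold h; lra).
  destruct (admissible_boundary ell s rad v v Av Av eps (Rmin X1 (x0 - h))
              (Rmax Y1 (x0 + h)))
    as (a & b & Ha & Hb & Hc); auto; try lra.
  assert (HW : forall c, c < 0 -> c = a \/ c = b -> Rabs (W c) <= q / 4).
  { intros c Hc0 Hcab. destruct (Hc c Hcab) as [Hn Hnd].
    destruct (H c Hc0) as (_ & _ & _ & M1 & M2 & _).
    set (n := dot (v c) (v c) + dot (v c) (v c)) in *.
    set (d := dot (derivative v c) (derivative v c)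
              + dot (derivative v c) (derivative v c)) in *.
    assert (T : forall i j, i ^ 2 <= n -> j ^ 2 <= d -> Rabs (i * j) <= eps).
    { intros i j Hi Hj. apply (Rabs_mult_le_of_sq i j n d); auto. lra. }
    assert (T1 : Rabs (comp1 v c * Derive (comp1 v) c) <= eps)
      by (apply T; unfold n, d, dot, derivative, comp1, comp2; cbn [fst snd]; nra).
    assert (T2 : Rabs (comp2 v c * Derive (comp2 v) c) <= eps)
      by (apply T; unfold n, d, dot, derivative, comp1, comp2; cbn [fst snd]; nra).
    assert (T5 : Rabs (comp1 v c * comp2 v c) <= eps).
    { apply Rle_trans with (2 := Hn). unfold n, dot, comp1, comp2.
      apply Rabs_le.
      assert (S1 := pow2_ge_0 (fst (v c) - snd (v c))).
      assert (S2 := pow2_ge_0 (fst (v c) + snd (v c))). nra. }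
    assert (T6 : Rabs ((z12 c + z21 c) * (comp1 v c * comp2 v c)) <= 2 * M * eps).
    { rewrite Rabs_mult. apply Rmult_le_compat; auto using Rabs_pos.
      eapply Rle_trans; [apply Rabs_triang|]. lra. }
    assert (Hfin : (2 + 2 * M) * eps = q / 4) by (unfold eps; field; lra).
    unfold W.
    apply Rabs_le_between in T1. apply Rabs_le_between in T2.
    apply Rabs_le_between in T6. apply Rabs_le. lra. }
  assert (Ea := HW a ltac:(lra) ltac:(auto)). assert (Eb := HW b ltac:(lra) ltac:(auto)).
  assert (CW : continuous_neg (fun x => dot (v x) (p x) - Q x)).
  { intros x Hx. specialize (C1 x Hx). specialize (CQ x Hx). cont. }
  assert (EW := RInt_neg_derive W _ a b ltac:(lra) ltac:(lra) DW CW).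
  assert (ED : RInt (fun x => dot (v x) (p x) - Q x) a b
               = RInt (fun x => dot (v x) (p x)) a b - RInt Q a b).
  { apply (RInt_minus (V := R_CompleteNormedModule) (fun x => dot (v x) (p x))
      Q a b); apply ex_RInt_neg; auto; lra. }
  assert (Hh0 : 0 < h) by (unfold h; lra).
  assert (G1 := RInt_neg_Chasles Q a (x0 - h) b CQ ltac:(lra) ltac:(lra) ltac:(lra)).
  assert (G2 := RInt_neg_Chasles Q (x0 - h) (x0 + h) b CQ
                  ltac:(lra) ltac:(lra) ltac:(lra)).
  assert (P1 : 0 * (x0 - h - a) <= RInt Q a (x0 - h)).
  { apply RInt_neg_ge; auto; try lra. intros; apply Q0; lra. }
  assert (P2 : 0 * (b - (x0 + h)) <= RInt Q (x0 + h) b).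
  { apply RInt_neg_ge; auto; try lra. intros; apply Q0; lra. }
  fold q in G2.
  specialize (H1 a b ltac:(lra) ltac:(lra)).
  apply Rabs_lt_between in H1.
  apply Rabs_le_between in Ea. apply Rabs_le_between in Eb. lra.
Qed.

(** * The tortoise coordinate *)

Lemma ex_RInt_right (f : R -> R) (rh a b : R) :
  (forall r, rh < r -> continuous f r) -> rh < a -> rh < b -> ex_RInt f a b.
Proof.
  intros Hf Ha Hb. apply (ex_RInt_continuous (V := R_CompleteNormedModule)).
  intros z Hz. apply Hf. apply Rlt_le_trans with (Rmin a b); [|lra].
  now apply Rmin_glb_lt.
Qed.

Lemma is_derive_RInt_right (f : R -> R) (rh a r : R) :
  (forall r, rh < r -> continuous f r) -> rh < a -> rh < r ->
  is_derive (fun y => RInt f a y) r (f r).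
Proof.
  intros Hf Ha Hr. apply (is_derive_RInt (V := R_NormedModule) f _ a).
  - generalize (locally_gt rh r Hr). apply filter_imp. intros y Hy.
    apply (RInt_correct (V := R_CompleteNormedModule)).
    now apply (ex_RInt_right f rh).
  - now apply Hf.
Qed.

Lemma mean_value (f f' : R -> R) (a b : R) :
  a < b -> (forall x, a <= x <= b -> is_derive f x (f' x)) ->
  exists c, a <= c <= b /\ f b - f a = f' c * (b - a).
Proof.
  intros Hab Hf.
  destruct (MVT_gen f a b f') as [c [Hc Heq]];
    rewrite ?Rmin_left, ?Rmax_right in * by lra.
  - intros x Hx. apply Hf. lra.
  - intros x Hx. apply continuity_pt_filterlim.
    apply (is_derive_cont f x (f' x)). apply Hf. lra.
  - now exists c.
Qed.

(** Monotonicity of [f] yields continuity of its inverse [g]; after that each difference quotient of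
    [g] is the reciprocal of one of [f] with a small increment. *)
Lemma is_derive_reciprocal (f g : R -> R) (x l rh : R) :
  x < 0 -> (forall r s, rh < r -> r < s -> f r < f s) ->
  (forall y, y < 0 -> rh < g y /\ f (g y) = y) ->
  is_derive f (g x) l -> 0 < l -> is_derive g x (/ l).
Proof.
  intros Hx Hmono Hg Hf Hl. apply is_derive_Reals. apply is_derive_Reals in Hf.
  assert (Hinj : forall r y, rh < r -> y < 0 -> f r < y -> r < g y).
  { intros r y Hr Hy Hlt. destruct (Hg y Hy) as [G1 G2].
    apply Rnot_le_lt. intros [Hle|Hle].
    - specialize (Hmono (g y) r G1 Hle). lra.
    - rewrite Hle in G2. lra. }
  assert (Hinj' : forall r y, rh < r -> y < 0 -> y < f r -> g y < r).
  { intros r y Hr Hy Hlt. destruct (Hg y Hy) as [G1 G2].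
    apply Rnot_le_lt. intros [Hle|Hle].
    - specialize (Hmono r (g y) Hr Hle). lra.
    - rewrite Hle in Hlt. lra. }
  destruct (Hg x Hx) as [G1 G2].
  assert (Hcont : forall eps, 0 < eps -> exists d, 0 < d /\
    forall h, Rabs h < d -> x + h < 0 /\ Rabs (g (x + h) - g x) < eps).
  { intros eps He.
    set (e := Rmin eps ((g x - rh) / 2)).
    assert (E1 := Rmin_l eps ((g x - rh) / 2)). assert (E2 := Rmin_r eps ((g x - rh) / 2)).
    assert (E3 : 0 < e) by (apply Rmin_pos; lra). fold e in E1, E2.
    assert (L1 : f (g x - e) < f (g x)) by (apply Hmono; lra).
    assert (L2 : f (g x) < f (g x + e)) by (apply Hmono; lra).
    rewrite G2 in L1, L2.
    set (d := Rmin (- x) (Rmin (x - f (g x - e)) (f (g x + e) - x))).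
    assert (D1 : d <= - x) by apply Rmin_l.
    assert (D2 : d <= x - f (g x - e)).
    { eapply Rle_trans; [apply Rmin_r | apply Rmin_l]. }
    assert (D3 : d <= f (g x + e) - x).
    { eapply Rle_trans; [apply Rmin_r | apply Rmin_r]. }
    exists d. split; [repeat apply Rmin_pos; lra|].
    intros h Hh. apply Rabs_lt_between in Hh. split; [lra|].
    assert (g x - e < g (x + h)) by (apply Hinj; lra).
    assert (g (x + h) < g x + e) by (apply Hinj'; lra).
    apply Rabs_lt_between. lra. }
  intros eps He.
  assert (Hinv : continuous Rinv l) by (apply continuous_Rinv; lra).
  destruct (proj1 (filterlim_locally Rinv (/ l)) Hinv (mkposreal _ He)) as [eta Heta].
  destruct (Hf eta (cond_pos eta)) as [[d1 Hd1] Hslope].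
  destruct (Hcont d1 Hd1) as [d [Hd Hgd]].
  exists (mkposreal d Hd). intros h Hh0 Hh; simpl in Hh.
  destruct (Hgd h Hh) as [Hxh Hk].
  destruct (Hg (x + h) Hxh) as [G3 G4].
  set (k := g (x + h) - g x) in *.
  assert (Hk0 : k <> 0).
  { intros Hk0. unfold k in Hk0. assert (E : g (x + h) = g x) by lra.
    rewrite E, G2 in G4. lra. }
  specialize (Hslope k Hk0 Hk).
  replace (g x + k) with (g (x + h)) in Hslope by (unfold k; ring).
  rewrite G4, G2 in Hslope.
  replace (x + h - x) with h in Hslope by ring.
  specialize (Heta (h / k) Hslope).
  change (Rabs (/ (h / k) - / l) < eps) in Heta.
  replace (k / h) with (/ (h / k)); [exact Heta|]. field. auto.
Qed.

(** Comparison with [c * ln (r - rh)]: the simple zero of [mu] sends the tortoise coordinate to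
    minus infinity at the horizon. *)
Lemma log_divergent_radius (F f : R -> R) (rh c y : R) :
  (forall r, rh < r -> is_derive F r (f r)) -> 0 < c ->
  (forall r, rh < r <= rh + 1 -> c / (r - rh) <= f r) ->
  exists r, rh < r < rh + 1 /\ F r < y.
Proof.
  intros HF Hc Hf.
  (* Chosen so that [c * d > F (rh + 1) - y]. The maximum with [1] in [D] keeps [rh + D] strictly
     below [rh + 1]. *)
  set (d := (F (rh + 1) + Rabs y + Rabs (F (rh + 1)) + Rabs y) / c + 1).
  set (D := exp (- Rmax d 1)).
  assert (HD0 : 0 < D) by apply exp_pos.
  assert (Hm1 : 1 <= Rmax d 1) by apply Rmax_r.
  assert (Hmd : d <= Rmax d 1) by apply Rmax_l.
  assert (HD1 : D < 1).
  { unfold D. apply Rlt_le_trans with (exp 0).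
    - apply exp_increasing. lra.
    - rewrite exp_0. lra. }
  exists (rh + D). split; [lra|].
  assert (HI : Rabs ((fun s => c * ln (s - rh)) (rh + 1)
                     - (fun s => c * ln (s - rh)) (rh + D)) <= F (rh + 1) - F (rh + D)).
  { apply (increment_bound (fun s => c * ln (s - rh)) F (fun s => c / (s - rh)) f); try lra.
    - intros s Hs. auto_derive; [lra|]. field. lra.
    - intros s Hs. apply HF. lra.
    - intros s Hs. rewrite Rabs_right.
      + apply Hf. lra.
      + apply Rle_ge, Rlt_le, Rdiv_lt_0_compat; lra. }
  cbv beta in HI.
  replace (rh + 1 - rh) with 1 in HI by ring.
  replace (rh + D - rh) with D in HI by ring.
  rewrite ln_1 in HI. unfold D at 1 in HI. rewrite ln_exp in HI.
  apply Rabs_le_between in HI.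
  assert (Hcd : c * d <= c * Rmax d 1) by (apply Rmult_le_compat_l; lra).
  assert (Ed : c * d = F (rh + 1) + Rabs y + Rabs (F (rh + 1)) + Rabs y + c)
    by (unfold d; field; lra).
  assert (A1 := Rle_abs (- y)). rewrite Rabs_Ropp in A1.
  assert (A2 := Rabs_pos y). assert (A3 := Rabs_pos (F (rh + 1))). lra.
Qed.

(** The primitive from the arbitrary base point [rh + 1] is increasing and, by the inverse square
    decay, bounded above. Subtracting its supremum normalizes the limit at infinity to [0], and the
    logarithmic divergence at the horizon makes the range the whole negative half-line. *)
Lemma tortoise_exists (f : R -> R) (rh c C R1 : R) :
  (forall r, rh < r -> continuous f r) -> (forall r, rh < r -> 0 < f r) ->
  0 < c -> (forall r, rh < r <= rh + 1 -> c / (r - rh) <= f r) ->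
  0 < R1 -> rh < R1 -> 0 <= C -> (forall r, R1 <= r -> f r <= C / r ^ 2) ->
  exists rs rad : R -> R,
    (forall r, rh < r -> is_derive rs r (f r)) /\
    is_lim rs p_infty 0 /\
    (forall r, rh < r -> rs r < 0 /\ rad (rs r) = r) /\
    (forall x, x < 0 -> rh < rad x /\ rs (rad x) = x) /\
    (forall x, x < 0 -> is_derive rad x (/ f (rad x))).
Proof.
  intros Hc Hpos Hc0 Hlow HR1 HrhR1 HC Hup.
  set (F := fun r => RInt f (rh + 1) r : R).
  assert (DF : forall r, rh < r -> is_derive F r (f r)).
  { intros r Hr. apply (is_derive_RInt_right f rh); auto. lra. }
  assert (Hmono : forall r s, rh < r -> r < s -> F r < F s).
  { intros r s Hr Hrs. destruct (mean_value F f r s Hrs) as [t [Ht Heq]].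
    - intros t Ht. apply DF. lra.
    - specialize (Hpos t ltac:(lra)). nra. }
  assert (Hbd : forall r, rh < r -> F r <= F R1 + C / R1).
  { intros r Hr.
    assert (0 <= C / R1) by (apply Rdiv_le_0_compat; lra).
    destruct (Rle_lt_dec r R1) as [[Hle| ->]|Hlt].
    - specialize (Hmono r R1 Hr Hle). lra.
    - lra.
    - assert (HI : Rabs (F r - F R1) <= C / R1).
      { apply (increment_bound_inverse_square F f); auto; try lra.
        - intros t Ht. apply DF. lra.
        - intros t Ht. rewrite Rabs_right.
          + apply Hup. lra.
          + apply Rle_ge, Rlt_le, Hpos. lra. }
      apply Rabs_le_between in HI. lra. }
  set (E := fun y : R => exists r, rh < r /\ y = F r).
  destruct (completeness E) as [l [Hub Hlub]].
  { exists (F R1 + C / R1). intros y [r [Hr ->]]. auto. }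
  { exists (F R1). now exists R1. }
  assert (Hsup : forall eps, 0 < eps -> exists r, rh < r /\ l - eps < F r).
  { intros eps He. apply NNPP. intros Hno. assert (l <= l - eps); [|lra].
    apply Hlub. intros y [r [Hr ->]]. apply Rnot_lt_le. intros Hlt.
    apply Hno. now exists r. }
  set (rs := fun r => F r - l).
  assert (Drs : forall r, rh < r -> is_derive rs r (f r)).
  { intros r Hr. unfold rs. evar_last.
    - apply (is_derive_minus (V := R_NormedModule) F (fun _ => l) r (f r) 0); auto.
      apply (is_derive_const (K := R_AbsRing) (V := R_NormedModule) l r).
    - unfold minus, plus, opp; simpl. ring. }
  assert (Mrs : forall r s, rh < r -> r < s -> rs r < rs s).
  { intros r s Hr Hs. specialize (Hmono r s Hr Hs). unfold rs. lra. }
  assert (Nrs : forall r, rh < r -> rs r < 0).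
  { intros r Hr. specialize (Hmono r (r + 1) Hr ltac:(lra)).
    assert (F (r + 1) <= l) by (apply Hub; exists (r + 1); split; auto; lra).
    unfold rs. lra. }
  (* The condition [x < 0] sits under the existential so that the choice function [rad] is total;
     for [x >= 0] the witness is arbitrary. *)
  assert (Hsurj : forall x, exists r, x < 0 -> rh < r /\ rs r = x).
  { intros x. destruct (Rlt_le_dec x 0) as [Hx|Hx]; [|exists 0; lra].
    destruct (log_divergent_radius F f rh c (x + l) DF Hc0 Hlow) as [r1 [Hr1 H1]].
    destruct (Hsup (- x)) as [r2 [Hr2 H2]]; [lra|].
    assert (Hr12 : r1 < r2).
    { apply Rnot_le_lt. intros [Hle| ->]; [|lra].
      specialize (Hmono r2 r1 Hr2 Hle). lra. }
    destruct (Ranalysis5.IVT_interv (fun r => rs r - x) r1 r2) as [z [Hz Hz0]]; unfold rs in *; try lra.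
    - intros a Ha. apply continuity_pt_filterlim.
      apply (continuous_Rminus (fun r => F r - l) (fun _ => x)).
      + apply (is_derive_cont _ a (f a)). apply Drs. lra.
      + apply continuous_const.
    - exists z. intros _. lra. }
  set (rad := fun x => proj1_sig (constructive_indefinite_description _ (Hsurj x))).
  assert (Hrad : forall x, x < 0 -> rh < rad x /\ rs (rad x) = x).
  { intros x Hx. unfold rad.
    now destruct (constructive_indefinite_description _ (Hsurj x)) as [r Hr]; apply Hr. }
  exists rs, rad. split; [exact Drs|split; [|split; [|split; [exact Hrad|]]]].
  - apply is_lim_spec. intros [eps He]. destruct (Hsup eps He) as [r0 [Hr0 H0]].
    exists r0. intros r Hr. simpl.
    specialize (Hmono r0 r Hr0 Hr). specialize (Nrs r ltac:(lra)).
    unfold rs in *. apply Rabs_lt_between. lra.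
  - intros r Hr. split; auto. destruct (Hrad (rs r) (Nrs r Hr)) as [H1 H2].
    destruct (Rtotal_order (rad (rs r)) r) as [Hlt|[Heq|Hgt]]; auto.
    + specialize (Mrs _ _ H1 Hlt). lra.
    + specialize (Mrs _ _ Hr Hgt). lra.
  - intros x Hx. destruct (Hrad x Hx) as [H1 H2].
    apply (is_derive_reciprocal rs rad x (f (rad x)) rh); auto.
Qed.

(** * Normal forms and bounds of the coefficients *)

Lemma Rabs_mult_bound (a b A B : R) :
  Rabs a <= A -> Rabs b <= B -> Rabs (a * b) <= A * B.
Proof. intros. rewrite Rabs_mult. apply Rmult_le_compat; auto using Rabs_pos. Qed.

Lemma Rabs_plus_bound (a b A B : R) :
  Rabs a <= A -> Rabs b <= B -> Rabs (a + b) <= A + B.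
Proof. intros. eapply Rle_trans; [apply Rabs_triang|]. lra. Qed.

Lemma Rabs_minus_bound (a b A B : R) :
  Rabs a <= A -> Rabs b <= B -> Rabs (a - b) <= A + B.
Proof.
  intros. unfold Rminus. apply Rabs_plus_bound; auto. now rewrite Rabs_Ropp.
Qed.

Lemma Rabs_opp_bound (a A : R) : Rabs a <= A -> Rabs (- a) <= A.
Proof. now rewrite Rabs_Ropp. Qed.

Lemma Rabs_pow_bound (a A : R) (n : nat) : Rabs a <= A -> Rabs (a ^ n) <= A ^ n.
Proof.
  intros H. rewrite <- RPow_abs. apply pow_incr. split; auto using Rabs_pos.
Qed.

(** Works by matching shapes: the right-hand side must be the term itself with each minus turned
    into plus and each atom replaced by its bound. This dictates the unsimplified form of many
    bounds below, such as factors [1] and powers of [1]. *)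
Ltac bound :=
  first
    [ eassumption
    | apply Rabs_plus_bound; bound
    | apply Rabs_minus_bound; bound
    | apply Rabs_opp_bound; bound
    | apply Rabs_mult_bound; bound
    | apply Rabs_pow_bound; bound
    | rewrite Rabs_right by lra; apply Rle_refl ].

(* [x], [y], [io], [p] stand for [1/r], [mu'/r], [1/omega], [S'/S]. *)
Definition e1n (x n y q w a o S io p : R) : R :=
  q ^ 2 * n + 2 * n * S ^ 2 * w ^ 2 * io ^ 2 + 8 * q * a * x ^ 3 * o ^ 2
  - 4 * q ^ 2 * n * o ^ 2 * x ^ 2 - 4 * q ^ 2 * o ^ 2 * y * x ^ 2
  - 4 * q ^ 2 * n * o ^ 2 * x * p.

Definition e3n (x n y q w a o io p : R) : R :=
  - (4 * q * o ^ 2 * (1 - o ^ 2) * x ^ 3) + 4 * o * w * a * x ^ 3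
  - 4 * q * n * o * w * x ^ 2 - 4 * q * o * w * y * x ^ 2
  - 4 * q * n * o * w * x * p - 2 * q * n * w * io.

Definition e4n (x n y q w o S p : R) : R :=
  3 * q ^ 2 * n - 4 * S ^ 2 * w ^ 2 * x ^ 2 * y - 4 * S ^ 2 * w ^ 2 * n * x * p
  - 8 * S ^ 2 * w * x ^ 3 * o * (1 - o ^ 2) - 4 * S ^ 2 * w ^ 2 * x ^ 2 * n.

(** The apparent poles at the horizon come from [mu' / mu]. In [E1] it is multiplied by [alpha^2],
    and [alpha^2 / mu = q^2 n / r^2] leaves a factor [n] to spare; in [E3 / (mu S)] it is multiplied
    by [alpha] only, and [alpha / mu = q / r^2] is still bounded. *)
Lemma E_normal_forms (ell r : R) (s : fields) :
  0 < r -> fmu ell s r <> 0 -> fS s r <> 0 -> fomega s r <> 0 ->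
  let x := / r in
  let n := fmu ell s r / r ^ 2 in
  let y := Derive (fmu ell s) r / r in
  let q := falpha s r * r ^ 2 / fmu ell s r in
  let w := r ^ 2 * Derive (fomega s) r in
  let a := r ^ 2 * Derive (falpha s) r in
  let o := fomega s r in
  let S := fS s r in
  let p := Derive (fS s) r / S in
  Defs.E1 ell s r = n * (S ^ 2 * (1 + o ^ 2) + e1n x n y q w a o S (/ o) p) /\
  E3 ell s r / (fmu ell s r * S) = e3n x n y q w a o (/ o) p / r ^ 2 /\
  E2 ell s r / (fmu ell s r * S) = (e3n x n y q w a o (/ o) p + 2 * a) / r ^ 2 /\
  E4 ell s r = n * (S ^ 2 * (3 * o ^ 2 - 1) + e4n x n y q w o S p).
Proof.
  intros Hr Hmu HS Ho. cbv zeta.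
  unfold e1n, e3n, e4n, E3, E2, E4, Defs.E1.
  generalize (Derive (fmu ell s) r) (Derive (fomega s) r) (Derive (falpha s) r)
    (Derive (fS s) r).
  revert Hmu HS Ho.
  generalize (fmu ell s r) (fS s r) (fomega s r) (falpha s r).
  intros mu S o al Hmu HS Ho m1 o1 a1 S1.
  assert (Hr0 : r <> 0) by lra.
  repeat split; field; auto.
Qed.

(** [d] is the small size and [K] a fixed comparison constant. The weight [r (r - rh)] has the
    behaviour of [mu] at both ends, a simple zero at the horizon and quadratic growth at infinity.
    The bound on [alpha] is weighted so that [q = alpha r^2 / mu] is at most [K * d]. *)
Record near_vacuum (ell rh K d : R) (s : fields) (r : R) : Prop := {
  nv_S : Rabs (fS s r - 1) <= d;
  nv_omega : Rabs (fomega s r - 1) <= d;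
  nv_omega1 : Rabs (r ^ 2 * Derive (fomega s) r) <= d;
  nv_alpha1 : Rabs (r ^ 2 * Derive (falpha s) r) <= d;
  nv_alpha : Rabs (falpha s r) * r <= d * (r - rh);
  nv_mu_lower : r * (r - rh) <= K * fmu ell s r;
  nv_mu_upper : fmu ell s r <= K * (r * (r - rh));
  nv_mu1 : Rabs (Derive (fmu ell s) r) <= K * r }.

(* [pb], [b1], [b3] and [b4] are [S'/S], [e1n], [e3n] and [e4n] with every term made
   positive, the small variables replaced by [d] and the others by [L]. *)
Definition pb (L d : R) : R := 2 * d ^ 2 * L ^ 5 + 2 * d ^ 2 * L ^ 2 * L ^ 5 * L ^ 2.

Definition b1 (L d : R) : R :=
  d ^ 2 * L + 2 * L * L ^ 2 * d ^ 2 * L ^ 2 + 8 * d * d * L ^ 3 * L ^ 2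
  + 4 * d ^ 2 * L * L ^ 2 * L ^ 2 + 4 * d ^ 2 * L ^ 2 * L * L ^ 2
  + 4 * d ^ 2 * L * L ^ 2 * L * pb L d.

Definition b3 (L d : R) : R :=
  4 * d * L ^ 2 * (1 + L ^ 2) * L ^ 3 + 4 * L * d * d * L ^ 3
  + 4 * d * L * L * d * L ^ 2 + 4 * d * L * d * L * L ^ 2
  + 4 * d * L * L * d * L * pb L d + 2 * d * L * d * L.

Definition b4 (L d : R) : R :=
  3 * d ^ 2 * L + 4 * L ^ 2 * d ^ 2 * L ^ 2 * L + 4 * L ^ 2 * d ^ 2 * L * L * pb L d
  + 8 * L ^ 2 * d * L ^ 3 * L * (1 + L ^ 2) + 4 * L ^ 2 * d ^ 2 * L ^ 2 * L.

Lemma near_vacuum_normal_bounds (ell rh K d L : R) (s : fields) (r : R) :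
  0 < rh < r -> 0 < K -> K <= L -> 2 <= L -> / rh <= L -> d <= / 2 ->
  near_vacuum ell rh K d s r ->
  Rabs (/ r) <= L /\
  Rabs (fmu ell s r / r ^ 2) <= L /\
  Rabs (Derive (fmu ell s) r / r) <= L /\
  Rabs (falpha s r * r ^ 2 / fmu ell s r) <= K * d /\
  Rabs (fomega s r) <= L /\ Rabs (/ fomega s r) <= L /\
  Rabs (fS s r) <= L /\ Rabs (/ fS s r) <= L /\
  0 < fmu ell s r /\ / 2 <= fS s r /\ / 2 <= fomega s r.
Proof.
  intros Hr HK HKL HL2 Hrh Hd [N1 N2 N3 N4 N5 N6 N7 N8].
  assert (Hmu : 0 < fmu ell s r).
  { apply Rmult_lt_reg_l with K; auto. rewrite Rmult_0_r.
    apply Rlt_le_trans with (2 := N6). apply Rmult_lt_0_compat; lra. }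
  assert (Hr2 : 0 < r ^ 2) by (apply pow_lt; lra).
  apply Rabs_le_between in N1. apply Rabs_le_between in N2.
  assert (Hinv : forall z, / 2 <= z -> Rabs (/ z) <= L).
  { intros z Hz. rewrite Rabs_right.
    - apply Rle_trans with (/ / 2); [|lra]. apply Rinv_le_contravar; lra.
    - apply Rle_ge, Rlt_le, Rinv_0_lt_compat. lra. }
  repeat split; try lra; try (apply Rabs_le; lra); try (apply Hinv; lra).
  - rewrite Rabs_right.
    + apply Rle_trans with (2 := Hrh). apply Rinv_le_contravar; lra.
    + apply Rle_ge, Rlt_le, Rinv_0_lt_compat. lra.
  - rewrite Rabs_right.
    + apply Rle_trans with K; auto. apply Rle_div_l; auto.
      apply Rle_trans with (1 := N7). apply Rmult_le_compat_l; nra.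
    + apply Rle_ge, Rlt_le, Rdiv_lt_0_compat; auto.
  - unfold Rdiv. rewrite Rabs_mult, (Rabs_right (/ r)).
    + apply Rle_trans with K; auto. apply Rle_div_l; auto. lra.
    + apply Rle_ge, Rlt_le, Rinv_0_lt_compat. lra.
  - unfold Rdiv. rewrite !Rabs_mult, (Rabs_right (/ _)), (Rabs_right (r ^ 2)) by
      first [apply Rle_ge, Rlt_le, Rinv_0_lt_compat; auto | lra].
    apply Rle_div_l; auto.
    apply Rle_trans with (d * (r * (r - rh))).
    + replace (Rabs (falpha s r) * r ^ 2) with (r * (Rabs (falpha s r) * r)) by ring.
      replace (d * (r * (r - rh))) with (r * (d * (r - rh))) by ring.
      apply Rmult_le_compat_l; lra.
    + rewrite (Rmult_comm K d), Rmult_assoc. apply Rmult_le_compat_l; auto.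
      eapply Rle_trans; [apply Rabs_pos|exact N3].
Qed.

Lemma normal_bounds (L d x n y q w a o S io iS : R) :
  Rabs x <= L -> Rabs n <= L -> Rabs y <= L -> Rabs q <= d -> Rabs w <= d ->
  Rabs a <= d -> Rabs o <= L -> Rabs S <= L -> Rabs io <= L -> Rabs iS <= L ->
  let p := 2 * w ^ 2 * x ^ 5 + 2 * q ^ 2 * o ^ 2 * x ^ 5 * iS ^ 2 in
  Rabs (e1n x n y q w a o S io p) <= b1 L d /\
  Rabs (e3n x n y q w a o io p) <= b3 L d /\
  Rabs (e4n x n y q w o S p) <= b4 L d.
Proof.
  intros Hx Hn Hy Hq Hw Ha Ho HS Hio HiS p.
  assert (Hp : Rabs p <= pb L d) by (unfold p, pb; bound).
  clearbody p.
  unfold e1n, e3n, e4n, b1, b3, b4. repeat split; bound.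
Qed.

(** The field equation makes [S' / S] quadratically small in [w] and [q]; it is eliminated in this
    way because [near_vacuum] says nothing about the derivative of [S]. *)
Lemma S_log_derivative (ell r : R) (s : fields) :
  0 < r -> fmu ell s r <> 0 -> fS s r <> 0 -> static_eym ell s r ->
  Derive (fS s) r / fS s r =
    2 * (r ^ 2 * Derive (fomega s) r) ^ 2 * (/ r) ^ 5
    + 2 * (falpha s r * r ^ 2 / fmu ell s r) ^ 2 * fomega s r ^ 2 * (/ r) ^ 5
      * (/ fS s r) ^ 2.
Proof.
  intros Hr Hmu HS (_ & E & _). rewrite E. field. repeat split; auto; lra.
Qed.

Lemma small_of_continuous (B : R -> R) (c : R) :
  continuous B 0 -> B 0 = 0 -> 0 < c ->
  exists d0, 0 < d0 /\ forall d, 0 <= d <= d0 -> B d <= c.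
Proof.
  intros HB H0 Hc.
  destruct (proj1 (filterlim_locally B (B 0)) HB (mkposreal _ Hc)) as [[e He] H].
  exists (e / 2). split; [lra|]. intros d Hd.
  assert (Hb : Rabs (B d - B 0) < c).
  { apply (H d). change (Rabs (d - 0) < e). apply Rabs_lt_between. lra. }
  rewrite H0 in Hb. apply Rabs_lt_between in Hb. lra.
Qed.

(** * The integrals [Z12] and [Z21] *)

(** Frozen at [l] to the left of [a], a function with right limit [l] becomes continuous in the
    two-sided sense, so the ordinary calculus of [RInt] applies at the horizon itself. *)
Definition ext_left (a l : R) (f : R -> R) (r : R) : R :=
  if Rle_dec r a then l else f r.

Lemma ext_left_eq (a l : R) (f : R -> R) (r : R) : a < r -> ext_left a l f r = f r.
Proof. intros H. unfold ext_left. destruct (Rle_dec r a); [lra|auto]. Qed.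

Lemma ext_left_at (a l : R) (f : R -> R) : ext_left a l f a = l.
Proof. unfold ext_left. destruct (Rle_dec a a); [auto|lra]. Qed.

Lemma continuous_ext_left (a l : R) (f : R -> R) (r : R) :
  right_limit f a l -> (forall r, a < r -> continuous f r) ->
  continuous (ext_left a l f) r.
Proof.
  intros Hl Hc. destruct (Rtotal_order r a) as [Hlt|[Heq|Hgt]].
  - apply (continuous_ext_loc _ (fun _ => l)).
    + generalize (locally_lt a r Hlt). apply filter_imp. intros y Hy.
      unfold ext_left. destruct (Rle_dec y a); [auto|lra].
    + apply continuous_const.
  - subst r. apply filterlim_locally. intros [eps He].
    destruct (proj1 (right_limit_eps f a l) Hl eps He) as [d [Hd Hx]].
    exists (mkposreal d Hd). intros y Hy.
    change (Rabs (y - a) < d) in Hy. apply Rabs_lt_between in Hy.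
    change (Rabs (ext_left a l f y - ext_left a l f a) < eps).
    rewrite ext_left_at. unfold ext_left. destruct (Rle_dec y a) as [Hle|Hgt].
    + rewrite Rminus_diag, Rabs_R0. lra.
    + apply Hx. lra.
  - apply (continuous_ext_loc _ f).
    + generalize (locally_gt a r Hgt). apply filter_imp. intros y Hy.
      symmetry. now apply ext_left_eq.
    + auto.
Qed.

Lemma right_limit_of_continuous (f : R -> R) (a : R) :
  continuous f a -> right_limit f a (f a).
Proof.
  intros H. apply right_limit_eps. intros eps He.
  destruct (proj1 (filterlim_locally f (f a)) H (mkposreal _ He)) as [d Hd].
  exists d. split; [apply cond_pos|]. intros x Hx. apply (Hd x).
  change (Rabs (x - a) < d). rewrite Rabs_right; lra.
Qed.

Lemma right_limit_ge (f : R -> R) (a l c b : R) :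
  a < b -> right_limit f a l -> (forall x, a < x < b -> c <= f x) -> c <= l.
Proof.
  intros Hab Hf Hle. apply Ropp_le_cancel.
  apply (right_limit_le (fun x => - f x) a _ _ b Hab).
  - apply right_limit_eps. intros eps He.
    destruct (proj1 (right_limit_eps f a l) Hf eps He) as [d [Hd Hx]].
    exists d. split; auto. intros x Hax.
    replace (- f x - - l) with (- (f x - l)) by ring. rewrite Rabs_Ropp. auto.
  - intros x Hx. specialize (Hle x Hx). lra.
Qed.

Lemma continuous_C1_right (f : R -> R) (a l r : R) :
  C1_right a f l -> a < r -> continuous f r /\ continuous (Derive f) r.
Proof.
  intros [H _] Hr. destruct (H r Hr) as [H1 H2]. split; auto.
  exact (ex_derive_continuous f r H1).
Qed.

Lemma right_derivative_slope (a : R) (f : R -> R) (l : R) :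
  right_derivative a f l -> right_limit (fun x => (f x - f a) / (x - a)) a l.
Proof. intros H. exact (D_in_slope a f (fun _ => l) H). Qed.

(* The regular extension of [E3 / (mu S)] and [E2 / (mu S)] to the horizon:
   [alpha / mu] has a limit there because both factors have simple zeros. *)
Lemma Z_integrands_extend ell rh p s :
  0 < rh -> static_black_hole ell rh p s ->
  (forall r, rh < r -> 0 < fmu ell s r /\ / 2 <= fS s r /\ / 2 <= fomega s r) ->
  exists G3 G2 : R -> R,
    (forall r, 0 < r -> continuous G3 r /\ continuous G2 r) /\
    (forall r, rh < r ->
       G3 r = E3 ell s r / (fmu ell s r * fS s r) /\
       G2 r = E2 ell s r / (fmu ell s r * fS s r)).
Proof.
  intros Hrh (Cmu & CS & Cal & Com & _ & Hmu0 & [dm [Hdm Smu]] & _ & _ & Hal0 & Sal) Hpos.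
  apply C2_on_C1_on in Cal. apply C2_on_C1_on in Com.
  apply C1_on_right in Cmu as [mu1 RM]. apply C1_on_right in CS as [S1 RS].
  apply C1_on_right in Cal as [al1 RA]. apply C1_on_right in Com as [om1 RO].
  apply right_derivative_slope in Smu. apply right_derivative_slope in Sal.
  assert (Slope : forall f l k, C1_right rh f l ->
            right_limit (fun x => (f x - f rh) / (x - rh)) rh k ->
            forall r, continuous (ext_left rh k (fun x => (f x - f rh) / (x - rh))) r).
  { intros f l k Hf Hk r. apply continuous_ext_left; auto. intros z Hz.
    destruct (continuous_C1_right f rh l z Hf Hz) as [Hc _].
    assert (Hid : continuous (fun y : R => y) z) by apply continuous_id.
    cont. lra. }
  set (Ym := ext_left rh dm (fun x => (fmu ell s x - fmu ell s rh) / (x - rh))).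
  set (Ya := ext_left rh (data_alpha1 p) (fun x => (falpha s x - falpha s rh) / (x - rh))).
  assert (CYm : forall r, continuous Ym r) by (intros; eapply Slope; eauto).
  assert (CYa : forall r, continuous Ya r) by (intros; eapply Slope; eauto).
  assert (Ym0 : forall r, Ym r <> 0).
  { intros r. unfold Ym, ext_left. destruct (Rle_dec r rh) as [Hle|Hgt]; [lra|].
    destruct (Hpos r ltac:(lra)) as [Hm _].
    rewrite Hmu0, Rminus_0_r.
    assert (0 < fmu ell s r / (r - rh)) by (apply Rdiv_lt_0_compat; lra). lra. }
  assert (Full : forall f l, C1_right rh f l ->
    (forall r, continuous (ext_left rh (f rh) f) r) /\
    (forall r, continuous (ext_left rh l (Derive f)) r)).
  { intros f l Hf. assert (Hf' := Hf). destruct Hf as (_ & Hf1 & Hf2 & _). split; intros r;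
      apply continuous_ext_left; auto; intros z Hz;
      destruct (continuous_C1_right f rh l z Hf' Hz); auto. }
  destruct (Full _ _ RM) as [_ CM1]. destruct (Full _ _ RS) as [CS0 CS1].
  destruct (Full _ _ RA) as [CA0 CA1]. destruct (Full _ _ RO) as [CO0 CO1].
  set (M1 := ext_left rh mu1 (Derive (fmu ell s))) in *.
  set (X0 := ext_left rh (fS s rh) (fS s)) in *.
  set (X1 := ext_left rh S1 (Derive (fS s))) in *.
  set (A0 := ext_left rh (falpha s rh) (falpha s)) in *.
  set (A1 := ext_left rh al1 (Derive (falpha s))) in *.
  set (O0 := ext_left rh (fomega s rh) (fomega s)) in *.
  set (O1 := ext_left rh om1 (Derive (fomega s))) in *.
  assert (X0n : forall r, X0 r <> 0).
  { assert (/ 2 <= fS s rh).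
    { apply (right_limit_ge (fS s) rh _ _ (rh + 1)); [lra | apply RS |].
      intros x Hx. apply Hpos. lra. }
    intros r. unfold X0, ext_left. destruct (Rle_dec r rh); [lra|].
    destruct (Hpos r ltac:(lra)). lra. }
  assert (O0n : forall r, O0 r <> 0).
  { assert (/ 2 <= fomega s rh).
    { apply (right_limit_ge (fomega s) rh _ _ (rh + 1)); [lra | apply RO |].
      intros x Hx. apply Hpos. lra. }
    intros r. unfold O0, ext_left. destruct (Rle_dec r rh); [lra|].
    destruct (Hpos r ltac:(lra)). lra. }
  set (G3 := fun r =>
    - (4 * (Ya r * / Ym r) * O0 r ^ 2 * (1 - O0 r ^ 2) * / r ^ 3)
    + 4 * O0 r * O1 r * A1 r * / r
    - 4 * A0 r * O0 r * O1 r * / r * (/ r + r * / (2 * O0 r ^ 2) + X1 r * / X0 r)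
    - 4 * (Ya r * / Ym r) * O0 r * O1 r * M1 r * / r).
  exists G3, (fun r => G3 r + 2 * A1 r). split.
  - intros r Hr.
    specialize (CYm r). specialize (CYa r). specialize (CM1 r). specialize (CS0 r).
    specialize (CS1 r). specialize (CA0 r). specialize (CA1 r). specialize (CO0 r).
    specialize (CO1 r).
    assert (Hid : continuous (fun y : R => y) r) by apply continuous_id.
    assert (C3 : continuous G3 r).
    { unfold G3. cont; auto; try lra.
      - apply pow_nonzero. lra.
      - specialize (O0n r). apply Rmult_integral_contrapositive_currified; [lra|].
        now apply pow_nonzero. }
    split; auto. cont.
  - intros r Hr. destruct (Hpos r Hr) as (Hm & HS & HO).
    unfold G3, Ya, Ym, A0, A1, O0, O1, X0, X1, M1.
    rewrite !ext_left_eq by auto. rewrite Hmu0, Hal0.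
    unfold E3, E2. cbv zeta.
    generalize (Derive (fmu ell s) r) (Derive (fomega s) r) (Derive (falpha s) r)
      (Derive (fS s) r).
    intros. split; field; repeat split; lra.
Qed.

Lemma increment_bound_right_le (f g f' g' : R -> R) (c a b : R) :
  a < b -> right_limit f a (f a) ->
  (forall s, a < s <= b -> is_derive f s (f' s)) ->
  (forall s, a < s <= b -> is_derive g s (g' s)) ->
  (forall s, a < s <= b -> Rabs (f' s) <= g' s) ->
  (forall s, a < s <= b -> g b - g s <= c) ->
  Rabs (f b - f a) <= c.
Proof.
  intros Hab Hlim Hf Hg Hle Hc.
  apply (right_limit_le (fun x => Rabs (f b - f x)) a _ _ b Hab).
  - now apply right_limit_abs_minus.
  - intros x Hx. apply Rle_trans with (g b - g x); [|apply Hc; lra].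
    apply (increment_bound f g f' g'); try lra; intros s Hs;
      [apply Hf | apply Hg | apply Hle]; lra.
Qed.

(** The integral of [1 / z^2] from [rh] is [/ rh - / r]. It vanishes linearly at the horizon, which
    pays for the zero of [mu], and stays bounded at infinity. *)
Lemma Z_bound (G : R -> R) (rh r B : R) :
  0 < rh < r -> 0 <= B -> (forall z, 0 < z -> continuous G z) ->
  (forall z, rh < z -> Rabs (G z) <= B / z ^ 2) ->
  Rabs (RInt G rh r) <= B * ((r - rh) / (r * rh)).
Proof.
  intros Hr HB Hc HG.
  assert (HD : forall z, 0 < z -> is_derive (fun y => RInt G rh y) z (G z)).
  { intros z Hz. apply (is_derive_RInt_right G 0); auto. lra. }
  assert (E : RInt G rh rh = 0) by apply (RInt_point (V := R_CompleteNormedModule)).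
  replace (RInt G rh r) with (RInt G rh r - RInt G rh rh) by lra.
  apply (increment_bound_right_le (fun y => RInt G rh y) (fun z => - B / z) G
           (fun z => B / z ^ 2)); try lra.
  - apply (right_limit_of_continuous (fun y => RInt G rh y)).
    apply (is_derive_cont _ rh (G rh)). apply HD. lra.
  - intros z Hz. apply HD. lra.
  - intros z Hz. apply is_derive_opp_inv. lra.
  - intros z Hz. apply HG. lra.
  - intros z Hz.
    replace (B * ((r - rh) / (r * rh))) with (B * / rh - B * / r) by (field; lra).
    assert (B * / z <= B * / rh).
    { apply Rmult_le_compat_l; auto. apply Rinv_le_contravar; lra. }
    unfold Rdiv. lra.
Qed.

Lemma Z_properties ell rh p s B3 B2 :
  0 < rh -> static_black_hole ell rh p s ->
  (forall r, rh < r -> 0 < fmu ell s r /\ / 2 <= fS s r /\ / 2 <= fomega s r) ->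
  0 <= B3 -> 0 <= B2 ->
  (forall r, rh < r -> Rabs (E3 ell s r / (fmu ell s r * fS s r)) <= B3 / r ^ 2) ->
  (forall r, rh < r -> Rabs (E2 ell s r / (fmu ell s r * fS s r)) <= B2 / r ^ 2) ->
  forall r, rh < r ->
    is_derive (Z21 ell rh s) r (E3 ell s r / (fmu ell s r * fS s r)) /\
    is_derive (Z12 ell rh s) r (E2 ell s r / (fmu ell s r * fS s r)) /\
    Z12 ell rh s r = Z21 ell rh s r + 2 * falpha s r /\
    Rabs (Z21 ell rh s r) <= B3 * ((r - rh) / (r * rh)) /\
    Rabs (Z12 ell rh s r) <= B2 * ((r - rh) / (r * rh)).
Proof.
  intros Hrh Hbh Hpos HB3 HB2 H3 H2.
  destruct (Z_integrands_extend ell rh p s Hrh Hbh Hpos) as (G3 & G2 & HG & HE).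
  assert (Q21 : forall r, rh < r -> Z21 ell rh s r = RInt G3 rh r).
  { intros r Hr. unfold Z21. apply (RInt_ext (V := R_CompleteNormedModule)).
    rewrite Rmin_left, Rmax_right by lra. intros x Hx. symmetry. apply HE. lra. }
  assert (Q12 : forall r, rh < r -> Z12 ell rh s r = RInt G2 rh r).
  { intros r Hr. unfold Z12. apply (RInt_ext (V := R_CompleteNormedModule)).
    rewrite Rmin_left, Rmax_right by lra. intros x Hx. symmetry. apply HE. lra. }
  assert (HD3 : forall z, 0 < z -> is_derive (fun y => RInt G3 rh y) z (G3 z)).
  { intros z Hz. apply (is_derive_RInt_right G3 0); auto. intros; now apply HG. }
  assert (HD2 : forall z, 0 < z -> is_derive (fun y => RInt G2 rh y) z (G2 z)).
  { intros z Hz. apply (is_derive_RInt_right G2 0); auto. intros; now apply HG. }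
  intros r Hr. destruct (HE r Hr) as [T3 T2]. split; [|split; [|split; [|split]]].
  - rewrite <- T3. apply (is_derive_ext_loc (fun y => RInt G3 rh y)).
    + generalize (locally_gt rh r Hr). apply filter_imp. intros y Hy.
      symmetry. auto.
    + apply HD3. lra.
  - rewrite <- T2. apply (is_derive_ext_loc (fun y => RInt G2 rh y)).
    + generalize (locally_gt rh r Hr). apply filter_imp. intros y Hy.
      symmetry. auto.
    + apply HD2. lra.
  - rewrite Q12, Q21 by auto.
    destruct Hbh as (_ & _ & Cal & _ & _ & _ & _ & _ & _ & Hal0 & _).
    apply C2_on_C1_on, C1_on_right in Cal as [l (RA1 & RA2 & _)].
    (* [E2 - E3 = 2 mu S alpha'], so [h] has derivative [0] outside the horizon; it tends to [0] at
       the horizon, where both integrals start and [alpha] vanishes. *)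
    set (h := fun y => RInt G2 rh y - RInt G3 rh y - 2 * falpha s y).
    assert (E0 : h rh = 0).
    { unfold h. rewrite Hal0.
      assert (E3' : RInt G3 rh rh = 0) by apply (RInt_point (V := R_CompleteNormedModule)).
      assert (E2' : RInt G2 rh rh = 0) by apply (RInt_point (V := R_CompleteNormedModule)).
      lra. }
    assert (Hh : Rabs (h r - h rh) <= 0 * (r - rh)).
    { apply (increment_bound_right h (fun _ => 0)); auto; try lra.
      - rewrite E0. apply right_limit_eps. intros eps He.
        assert (C3 : continuous (fun y => RInt G3 rh y) rh)
          by (apply (is_derive_cont _ rh (G3 rh)); apply HD3; lra).
        assert (C2 : continuous (fun y => RInt G2 rh y) rh)
          by (apply (is_derive_cont _ rh (G2 rh)); apply HD2; lra).
        apply right_limit_of_continuous in C3. apply right_limit_of_continuous in C2.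
        destruct (proj1 (right_limit_eps _ _ _) C3 (eps / 4)) as [d3 [Hd3 L3]]; [lra|].
        destruct (proj1 (right_limit_eps _ _ _) C2 (eps / 4)) as [d2 [Hd2 L2]]; [lra|].
        destruct (proj1 (right_limit_eps _ _ _) RA2 (eps / 8)) as [d1 [Hd1 L1]]; [lra|].
        exists (Rmin d1 (Rmin d2 d3)). split; [repeat apply Rmin_pos; lra|].
        intros x Hx.
        assert (M1 := Rmin_l d1 (Rmin d2 d3)).
        assert (M2 : Rmin d1 (Rmin d2 d3) <= d2)
          by (eapply Rle_trans; [apply Rmin_r | apply Rmin_l]).
        assert (M3 : Rmin d1 (Rmin d2 d3) <= d3)
          by (eapply Rle_trans; [apply Rmin_r | apply Rmin_r]).
        specialize (L1 x ltac:(lra)). specialize (L2 x ltac:(lra)).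
        specialize (L3 x ltac:(lra)). unfold h in *. rewrite Hal0 in *.
        apply Rabs_lt_between in L1. apply Rabs_lt_between in L2.
        apply Rabs_lt_between in L3. apply Rabs_lt_between. lra.
      - intros z Hz. destruct (RA1 z ltac:(lra)) as [DA _].
        apply Derive_correct in DA. unfold h. evar_last.
        + apply (is_derive_minus (V := R_NormedModule)
                   (fun y => RInt G2 rh y - RInt G3 rh y) (fun y => 2 * falpha s y) z
                   (G2 z - G3 z) (2 * Derive (falpha s) z)).
          * apply (is_derive_minus (V := R_NormedModule)
                     (fun y => RInt G2 rh y) (fun y => RInt G3 rh y)).
            -- apply HD2. lra.
            -- apply HD3. lra.
          * apply (is_derive_scal (falpha s) z 2 (Derive (falpha s) z) DA).
        + destruct (HE z ltac:(lra)) as [-> ->].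
          destruct (Hpos z ltac:(lra)) as (Hm & HS & HO).
          unfold minus, plus, opp; simpl. unfold E3. cbv zeta. field. lra.
      - intros. rewrite Rabs_R0. lra. }
    rewrite E0, Rmult_0_l, Rminus_0_r in Hh.
    assert (E : h r = 0).
    { apply Rabs_le_between in Hh. lra. }
    unfold h in E. lra.
  - rewrite Q21 by auto. apply Z_bound; auto; try lra.
    + intros; now apply HG.
    + intros z Hz. destruct (HE z Hz) as [-> _]. auto.
  - rewrite Q12 by auto. apply Z_bound; auto; try lra.
    + intros; now apply HG.
    + intros z Hz. destruct (HE z Hz) as [_ ->]. auto.
Qed.

(** * Stability of near-vacuum solutions *)

Lemma continuous_E ell rh p s r :
  0 < rh < r -> static_black_hole ell rh p s ->
  0 < fmu ell s r -> 0 < fS s r -> 0 < fomega s r ->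
  continuous (Defs.E1 ell s) r /\ continuous (E2 ell s) r /\
  continuous (E3 ell s) r /\ continuous (E4 ell s) r.
Proof.
  intros Hr (Cmu & CS & Cal & Com & _) Hmu HS Ho.
  apply C2_on_C1_on in Cal. apply C2_on_C1_on in Com.
  apply C1_on_right in Cmu as [mu1 RM]. apply C1_on_right in CS as [S1 RS].
  apply C1_on_right in Cal as [al1 RA]. apply C1_on_right in Com as [om1 RO].
  assert (Har : rh < r) by lra.
  destruct (continuous_C1_right _ _ _ _ RM Har) as [M0 M1].
  destruct (continuous_C1_right _ _ _ _ RS Har) as [X0 X1].
  destruct (continuous_C1_right _ _ _ _ RA Har) as [A0 A1].
  destruct (continuous_C1_right _ _ _ _ RO Har) as [O0 O1].
  assert (Hid : continuous (fun y : R => y) r) by apply continuous_id.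
  assert (Hr2 : r ^ 2 <> 0) by (apply pow_nonzero; lra).
  assert (Hr3 : r ^ 3 <> 0) by (apply pow_nonzero; lra).
  assert (Ho2 : 0 < fomega s r ^ 2) by (apply pow_lt; lra).
  unfold Defs.E1, E2, E3, E2, E4; repeat split; cont; lra.
Qed.

(** The budget in units of [n]: with [d <= / 10] the squares of [S] and [omega] are at least
    [3 / 4], so the main factors are at least [15 / 16]. The errors [e1n] and [e4n] cost at most
    [/ 4], and the squares of [Z21] and [Z12] another [/ 4]. *)
Lemma near_vacuum_K_positive ell rh K d L p s :
  0 < rh -> 1 <= K -> K <= L -> 2 <= L -> / rh <= L -> 0 <= d <= / 10 ->
  b1 L (K * d) + b4 L (K * d) + (b3 L (K * d) + 2 * (K * d)) ^ 2 * (L ^ 2 * K) <= / 4 ->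
  static_black_hole ell rh p s ->
  (forall r, rh < r -> near_vacuum ell rh K d s r) ->
  (forall r, rh < r -> 0 < fmu ell s r /\ / 2 <= fS s r /\ / 2 <= fomega s r) /\
  (forall r, rh < r -> 0 < K1 ell rh s r /\ 0 < K2 ell rh s r) /\
  exists M, forall r, rh < r ->
    is_derive (Z21 ell rh s) r (E3 ell s r / (fmu ell s r * fS s r)) /\
    is_derive (Z12 ell rh s) r (E2 ell s r / (fmu ell s r * fS s r)) /\
    Z12 ell rh s r = Z21 ell rh s r + 2 * falpha s r /\
    Rabs (Z21 ell rh s r) <= M /\ Rabs (Z12 ell rh s r) <= M.
Proof.
  intros Hrh HK HKL HL HrL Hd HB Hbh Hnv.
  assert (Hnb := fun r (Hr : rh < r) => near_vacuum_normal_bounds ell rh K d L s r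
    (conj Hrh Hr) ltac:(lra) HKL HL HrL ltac:(lra) (Hnv r Hr)).
  assert (Hpos : forall r, rh < r ->
    0 < fmu ell s r /\ / 2 <= fS s r /\ / 2 <= fomega s r).
  { intros r Hr. now destruct (Hnb r Hr) as (_ & _ & _ & _ & _ & _ & _ & _ & H). }
  split; auto.
  set (D := K * d) in *.
  assert (HD0 : 0 <= D) by (apply Rmult_le_pos; lra).
  set (B := b3 L D + 2 * D) in *.
  assert (Hb1 : 0 <= b1 L D) by (unfold b1, pb; repeat (apply Rplus_le_le_0_compat || apply Rmult_le_pos || apply pow_le); lra).
  assert (Hb3 : 0 <= b3 L D) by (unfold b3, pb; repeat (apply Rplus_le_le_0_compat || apply Rmult_le_pos || apply pow_le); lra).
  assert (Hb4 : 0 <= b4 L D) by (unfold b4, pb; repeat (apply Rplus_le_le_0_compat || apply Rmult_le_pos || apply pow_le); lra).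
  assert (HB2 : 0 <= B ^ 2 * (L ^ 2 * K)).
  { apply Rmult_le_pos; [apply pow2_ge_0|].
    apply Rmult_le_pos; [apply pow2_ge_0|lra]. }
  assert (Hdata : forall r, rh < r ->
    exists n e1 e4, n = fmu ell s r / r ^ 2 /\
      Defs.E1 ell s r = n * (fS s r ^ 2 * (1 + fomega s r ^ 2) + e1) /\
      E4 ell s r = n * (fS s r ^ 2 * (3 * fomega s r ^ 2 - 1) + e4) /\
      Rabs e1 <= b1 L D /\ Rabs e4 <= b4 L D /\
      Rabs (E3 ell s r / (fmu ell s r * fS s r)) <= B / r ^ 2 /\
      Rabs (E2 ell s r / (fmu ell s r * fS s r)) <= B / r ^ 2).
  { intros r Hr.
    destruct (Hnb r Hr) as (N1 & N2 & N3 & N4 & N5 & N6 & N7 & N8 & N9 & N10 & N11).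
    destruct (Hnv r Hr) as [_ _ V3 V4 _ _ _ _].
    assert (HdD : d <= D) by (unfold D; nra).
    destruct (E_normal_forms ell r s) as (F1 & F3 & F2 & F4); try lra.
    assert (Hst : static_eym ell s r) by (apply Hbh; auto).
    rewrite (S_log_derivative ell r s) in F1, F2, F3, F4; auto; try lra.
    destruct (normal_bounds L D (/ r) (fmu ell s r / r ^ 2)
      (Derive (fmu ell s) r / r) (falpha s r * r ^ 2 / fmu ell s r)
      (r ^ 2 * Derive (fomega s) r) (r ^ 2 * Derive (falpha s) r) (fomega s r)
      (fS s r) (/ fomega s r) (/ fS s r)) as (G1 & G3 & G4); auto; try lra.
    cbv zeta in *.
    do 3 eexists. split; [reflexivity|].
    split; [exact F1|]. split; [exact F4|]. split; [exact G1|]. split; [exact G4|].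
    assert (Hr2 : 0 < r ^ 2) by (apply pow_lt; lra).
    rewrite F3, F2. unfold Rdiv. rewrite !(Rabs_mult _ (/ r ^ 2)).
    rewrite (Rabs_right (/ r ^ 2)) by (apply Rle_ge, Rlt_le, Rinv_0_lt_compat; auto).
    split; apply Rmult_le_compat_r; try (apply Rlt_le, Rinv_0_lt_compat; auto).
    - unfold B. lra.
    - unfold B. apply Rabs_plus_bound; auto.
      rewrite Rabs_mult, (Rabs_right 2) by lra. lra. }
  assert (HZ := Z_properties ell rh p s B B Hrh Hbh Hpos ltac:(unfold B; lra)
                  ltac:(unfold B; lra)
                  ltac:(intros r Hr; destruct (Hdata r Hr) as (? & ? & ? & H); apply H)
                  ltac:(intros r Hr; destruct (Hdata r Hr) as (? & ? & ? & H); apply H)).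
  assert (HB0 : 0 <= B) by (unfold B; lra).
  assert (HrL' : forall r, rh < r -> (r - rh) / (r * rh) <= L * ((r - rh) / r)).
  { intros r Hr. replace ((r - rh) / (r * rh)) with (/ rh * ((r - rh) / r)) by (field; lra).
    apply Rmult_le_compat_r; auto. apply Rdiv_le_0_compat; lra. }
  assert (Hfrac : forall r, rh < r -> 0 <= (r - rh) / r <= 1).
  { intros r Hr. split.
    - apply Rdiv_le_0_compat; lra.
    - apply Rle_div_l; lra. }
  split.
  - intros r Hr.
    destruct (Hdata r Hr) as (n & e1 & e4 & Hn & F1 & F4 & G1 & G4 & _ & _).
    destruct (HZ r Hr) as (_ & _ & _ & Z1 & Z2).
    destruct (Hnv r Hr) as [V1 V2 _ _ _ V6 _ _].
    destruct (Hpos r Hr) as (Hmu & _ & _).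
    assert (Hr2 : 0 < r ^ 2) by (apply pow_lt; lra).
    assert (Hn0 : 0 < n) by (rewrite Hn; apply Rdiv_lt_0_compat; auto).
    set (t := (r - rh) / r) in *.
    assert (Ht := Hfrac r Hr). fold t in Ht.
    assert (Htn : t <= K * n).
    { rewrite Hn. replace (K * (fmu ell s r / r ^ 2)) with (K * fmu ell s r / r ^ 2)
        by (field; lra).
      apply (Rle_div_r t (K * fmu ell s r) (r ^ 2)); [lra|].
      replace (t * r ^ 2) with (r * (r - rh)) by (unfold t; field; lra). exact V6. }
    (* Squaring produces [t * t <= t <= K * n]: one vanishing factor pays for [n], the other is only
       bounded by [1]. *)
    assert (HZsq : forall z, Rabs z <= B * ((r - rh) / (r * rh)) -> z ^ 2 <= n * / 4).
    { intros z Hz.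
      assert (Hz' : Rabs z <= B * (L * t)).
      { eapply Rle_trans; [exact Hz|]. apply Rmult_le_compat_l; [auto|].
        exact (HrL' r Hr). }
      rewrite <- pow2_abs.
      apply Rle_trans with ((B * (L * t)) ^ 2).
      { apply pow_incr. split; auto using Rabs_pos. }
      replace ((B * (L * t)) ^ 2) with (B ^ 2 * L ^ 2 * (t * t)) by ring.
      apply Rle_trans with (B ^ 2 * L ^ 2 * (K * n)).
      - apply Rmult_le_compat_l.
        + apply Rmult_le_pos; apply pow2_ge_0.
        + nra.
      - replace (B ^ 2 * L ^ 2 * (K * n)) with (n * (B ^ 2 * (L ^ 2 * K))) by ring.
        apply Rmult_le_compat_l; lra. }
    apply HZsq in Z1. apply HZsq in Z2.
    apply Rabs_le_between in V1. apply Rabs_le_between in V2.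
    apply Rabs_le_between in G1. apply Rabs_le_between in G4.
    assert (HS2 : / 4 * 3 <= fS s r ^ 2) by nra.
    assert (HO2 : / 4 * 3 <= fomega s r ^ 2) by nra.
    unfold K1, K2. rewrite F1, F4. split.
    + assert (n * / 2 <= n * (fS s r ^ 2 * (1 + fomega s r ^ 2) + e1)).
      { apply Rmult_le_compat_l; [lra|]. nra. }
      nra.
    + assert (n * / 2 <= n * (fS s r ^ 2 * (3 * fomega s r ^ 2 - 1) + e4)).
      { apply Rmult_le_compat_l; [lra|]. nra. }
      nra.
  - exists (B * (L * 1)). intros r Hr. destruct (HZ r Hr) as (H1 & H2 & H3 & Z1 & Z2).
    assert (HBL : B * ((r - rh) / (r * rh)) <= B * (L * 1)).
    { apply Rmult_le_compat_l; auto. apply Rle_trans with (1 := HrL' r Hr).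
      apply Rmult_le_compat_l; [lra|]. now apply Hfrac. }
    split; auto. split; auto. split; auto. split; lra.
Qed.

Lemma near_vacuum_tortoise ell rh K d p s :
  0 < rh -> 1 <= K -> 0 <= d <= / 10 ->
  static_black_hole ell rh p s ->
  (forall r, rh < r -> near_vacuum ell rh K d s r) ->
  (forall r, rh < r -> 0 < fmu ell s r) ->
  exists rs rad : R -> R, tortoise ell rh s rs rad /\
    forall x, x < 0 -> is_derive rad x (fmu ell s (rad x) * fS s (rad x)).
Proof.
  intros Hrh HK Hd Hbh Hnv Hmu.
  assert (HS : forall r, rh < r -> / 2 <= fS s r <= 2).
  { intros r Hr. destruct (Hnv r Hr) as [V1 _ _ _ _ _ _ _].
    apply Rabs_le_between in V1. lra. }
  assert (Hp : forall r, rh < r -> 0 < fmu ell s r * fS s r).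
  { intros r Hr. specialize (Hmu r Hr). specialize (HS r Hr). nra. }
  (* With [/ 2 <= S <= 2]: on the unit interval after the horizon [mu S <= 2 K (rh + 1) (r - rh)],
     and beyond [2 * rh], where [r - rh >= r / 2], one has [mu S >= r^2 / (4 K)]. *)
  destruct (tortoise_exists (fun r => / (fmu ell s r * fS s r)) rh
    (/ (2 * K * (rh + 1))) (4 * K) (2 * rh)) as (rs & rad & T1 & T2 & T3 & T4 & T5); try lra.
  - intros r Hr. destruct Hbh as (Cmu & CS & _).
    apply C1_on_right in Cmu as [mu1 RM]. apply C1_on_right in CS as [S1 RS].
    destruct (continuous_C1_right _ _ _ _ RM Hr) as [M0 _].
    destruct (continuous_C1_right _ _ _ _ RS Hr) as [X0 _].
    specialize (Hp r Hr). cont. lra.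
  - intros r Hr. apply Rinv_0_lt_compat. auto.
  - apply Rinv_0_lt_compat. nra.
  - intros r Hr. unfold Rdiv. rewrite <- Rinv_mult.
    apply Rinv_le_contravar; [apply Hp; lra|].
    destruct (Hnv r ltac:(lra)) as [_ _ _ _ _ _ V7 _].
    specialize (HS r ltac:(lra)). specialize (Hmu r ltac:(lra)).
    apply Rle_trans with (K * (r * (r - rh)) * 2).
    + apply Rmult_le_compat; lra.
    + assert (r * (r - rh) <= (rh + 1) * (r - rh)) by (apply Rmult_le_compat_r; lra).
      replace (2 * K * (rh + 1) * (r - rh)) with (2 * K * ((rh + 1) * (r - rh))) by ring.
      replace (K * (r * (r - rh)) * 2) with (2 * K * (r * (r - rh))) by ring.
      apply Rmult_le_compat_l; lra.
  - intros r Hr. destruct (Hnv r ltac:(lra)) as [_ _ _ _ _ V6 _ _].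
    specialize (HS r ltac:(lra)). specialize (Hmu r ltac:(lra)).
    assert (Hr2 : 0 < r ^ 2) by (apply pow_lt; lra).
    assert (Hp' := Hp r ltac:(lra)).
    apply Rle_div_r; auto. rewrite Rmult_comm. apply Rle_div_l; auto.
    assert (r ^ 2 <= 2 * (K * fmu ell s r)) by nra.
    assert (K * fmu ell s r * / 2 <= K * fmu ell s r * fS s r).
    { apply Rmult_le_compat_l; nra. }
    lra.
  - exists rs, rad. split.
    + split; [|split; [exact T2|split; [exact T3|exact T4]]].
      intros r Hr. unfold Rdiv. rewrite Rmult_1_l. auto.
    + intros x Hx. rewrite <- (Rinv_inv (fmu ell s (rad x) * fS s (rad x))). auto.
Qed.

(** The threshold comes from the continuity at [0] of an error polynomial in [d] that vanishes
    there. It depends on the solution only through [K]. *)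
Lemma near_vacuum_stable ell rh K :
  0 < rh -> 1 <= K ->
  exists d0, 0 < d0 /\
    forall d p s, 0 <= d <= d0 -> static_black_hole ell rh p s ->
      (forall r, rh < r -> near_vacuum ell rh K d s r) ->
      (forall r, rh < r -> 0 < K1 ell rh s r /\ 0 < K2 ell rh s r) /\
      linearly_stable ell rh s.
Proof.
  intros Hrh HK. set (L := K + 2 + / rh).
  assert (Hrh' : 0 < / rh) by (now apply Rinv_0_lt_compat).
  destruct (small_of_continuous (fun d => b1 L (K * d) + b4 L (K * d)
    + (b3 L (K * d) + 2 * (K * d)) ^ 2 * (L ^ 2 * K)) (/ 4)) as (d1 & Hd1 & HB).
  - assert (Hid : continuous (fun y : R => y) 0) by apply continuous_id.
    unfold b1, b3, b4, pb. cont.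
  - unfold b1, b3, b4, pb. ring.
  - lra.
  - exists (Rmin d1 (/ 10)). split; [apply Rmin_pos; lra|].
    intros d p s Hd Hbh Hnv.
    assert (Hm1 := Rmin_l d1 (/ 10)). assert (Hm2 := Rmin_r d1 (/ 10)).
    assert (Hd10 : 0 <= d <= / 10) by lra.
    destruct (near_vacuum_K_positive ell rh K d L p s) as (Hpos & HKp & M & HZ);
      auto; try (unfold L; lra); try lra.
    { apply HB. lra. }
    split; auto.
    destruct (near_vacuum_tortoise ell rh K d p s) as (rs & rad & Ht & Hrad); auto.
    { intros r Hr. now apply Hpos. }
    assert (Hradgt : forall x, x < 0 -> rh < rad x).
    { intros x Hx. now apply Ht. }
    (* Along the tortoise coordinate the derivative [mu S] of [rad] cancels the weight [1 / (mu S)]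
       in the integrands of [Z12] and [Z21]. *)
    assert (Hco : coefficients ell s rad (fun x => Z12 ell rh s (rad x))
                    (fun x => Z21 ell rh s (rad x)) M).
    { intros x Hx. specialize (Hradgt x Hx). specialize (Hrad x Hx).
      destruct (HZ (rad x) Hradgt) as (D21 & D12 & E12 & B21 & B12).
      destruct (Hpos (rad x) Hradgt) as (Hmu & HS & HO).
      assert (Cr : continuous rad x) by (exact (is_derive_cont _ _ _ Hrad)).
      destruct (continuous_E ell rh p s (rad x)) as (C1 & C2 & C3 & C4); auto; try lra.
      split; [|split; [|split; [exact E12|split; [exact B12|split; [exact B21|repeat split]]]]].
      - evar_last; [exact (is_derive_comp _ _ _ _ _ D12 Hrad)|].
        unfold scal; simpl; unfold mult; simpl. field. lra.
      - evar_last; [exact (is_derive_comp _ _ _ _ _ D21 Hrad)|].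
        unfold scal; simpl; unfold mult; simpl. field. lra.
      - now apply (continuous_comp rad (Defs.E1 ell s)).
      - now apply (continuous_comp rad (E2 ell s)).
      - now apply (continuous_comp rad (E3 ell s)).
      - now apply (continuous_comp rad (E4 ell s)). }
    exists rs, rad. split; [exact Ht|]. split.
    + intros u v Hu Hv. exact (Uop_symmetric _ _ _ _ _ _ _ _ Hco Hu Hv).
    + intros v Hv Hv0. apply (Uop_positive _ _ _ _ _ _ _ Hco); auto.
      intros x Hx. exact (HKp (rad x) (Hradgt x Hx)).
Qed.

(** * Uniform control towards infinity *)

(** The second-order equations are in divergence form for these fluxes: [(r^2 alpha' / S)' = 2 alpha
    omega^2 / (mu S)] and [(mu S omega')' = - S (omega (1 - omega^2) / r^2 + alpha^2 omega / (mu
    S^2))]. No derivative of [mu] or [S] remains. *)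
Definition flux_alpha (s : fields) (r : R) : R := r ^ 2 * Derive (falpha s) r / fS s r.

Definition flux_omega (ell : R) (s : fields) (r : R) : R :=
  fmu ell s r * fS s r * Derive (fomega s) r.

Definition differentiable_at (ell : R) (s : fields) (r : R) : Prop :=
  ex_derive (fmu ell s) r /\ ex_derive (fm s) r /\ ex_derive (fS s) r /\
  ex_derive (falpha s) r /\ ex_derive (fomega s) r /\
  ex_derive (Derive (falpha s)) r /\ ex_derive (Derive (fomega s)) r.

Lemma black_hole_differentiable ell rh p s r :
  0 < rh < r -> ell ^ 2 <> 0 -> static_black_hole ell rh p s ->
  differentiable_at ell s r.
Proof.
  intros Hr Hell (Cmu & CS & Cal & Com & _).
  assert (Har : rh < r) by lra.
  assert (Xal := C2_on_interior _ _ _ Cal Har).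
  assert (Xom := C2_on_interior _ _ _ Com Har).
  apply C2_on_C1_on in Cal. apply C2_on_C1_on in Com.
  apply C1_on_right in Cmu as [mu1 [RM _]]. apply C1_on_right in CS as [S1 [RS _]].
  apply C1_on_right in Cal as [al1 [RA _]]. apply C1_on_right in Com as [om1 [RO _]].
  assert (HM := proj1 (RM r Har)).
  repeat split; auto; try (now apply RS); try (now apply RA); try (now apply RO).
  (* Regularity is assumed of [fmu], not of [fm], so [fm] is recovered by solving the definition of
     [fmu] for it. *)
  apply (ex_derive_ext_loc (fun y => (1 + y ^ 2 / ell ^ 2 - fmu ell s y) * y / 2)).
  - generalize (locally_gt 0 r ltac:(lra)). apply filter_imp. intros y Hy.
    unfold fmu. simpl. field. split; [|lra].
    intros E. apply Hell. rewrite E. simpl; ring.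
  - auto_derive. repeat split; auto.
Qed.

Lemma Derive_fmu ell s r :
  r <> 0 -> ell ^ 2 <> 0 -> ex_derive (fm s) r ->
  Derive (fmu ell s) r = 2 * fm s r / r ^ 2 - 2 * Derive (fm s) r / r + 2 * r / ell ^ 2.
Proof.
  intros Hr Hell Hm. apply is_derive_unique.
  assert (He : ell <> 0) by (intros E; apply Hell; rewrite E; simpl; ring).
  unfold fmu. auto_derive; auto.
  change (Derive (fun x => fm s x) r) with (Derive (fm s) r). field. auto.
Qed.

(** Every right-hand side is a bounded expression over [r^2], because [v = r^2 / mu] is bounded at
    infinity. The factor [1 - omega^2] is written through [u = omega - 1], and in the quadratic
    terms one small variable is pulled out front, in the form that [flow_bounds] estimates. *)
Lemma eym_radial_flow ell s r :
  0 < r -> ell ^ 2 <> 0 -> differentiable_at ell s r ->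
  fmu ell s r <> 0 -> fS s r <> 0 -> static_eym ell s r ->
  let v := r ^ 2 / fmu ell s r in
  let iS := / fS s r in
  let al := falpha s r in let o := fomega s r in let u := o - 1 in
  let A := flux_alpha s r in let B := flux_omega ell s r in
  is_derive (falpha s) r (A * fS s r / r ^ 2) /\
  is_derive (flux_alpha s) r (2 * al * o ^ 2 * v * iS / r ^ 2) /\
  is_derive (fun y => fomega s y - 1) r (B * v * iS / r ^ 2) /\
  is_derive (flux_omega ell s) r
    (- (fS s r * (- (u * (1 + o) * o) + al * al * o * v * iS ^ 2)) / r ^ 2) /\
  is_derive (fun y => fS s y - 1) r
    (fS s r * (2 * B * (B * v * iS * v * iS * (/ r) ^ 3)
               + 2 * al * (al * o ^ 2 * v ^ 2 * iS ^ 2 * (/ r) ^ 3)) / r ^ 2) /\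
  is_derive (fm s) r
    ((A * (A * / 2) + al * (al * o ^ 2 * v * iS ^ 2) + B * (B * v * iS ^ 2)
      + u * (u * (1 + o) ^ 2 * / 2)) / r ^ 2) /\
  r ^ 2 * Derive (fomega s) r = B * v * iS /\
  r ^ 2 * Derive (falpha s) r = A * fS s r.
Proof.
  intros Hr Hell (Xmu & Xm & XS & Xal & Xom & Xal1 & Xom1) Hmu HS (Em & ES & Eal & Eom).
  cbv zeta.
  change (Derive_n (falpha s) 2 r) with (Derive (Derive (falpha s)) r) in Eal.
  change (Derive_n (fomega s) 2 r) with (Derive (Derive (fomega s)) r) in Eom.
  assert (Hr0 : r <> 0) by lra.
  assert (Dm := Derive_correct _ _ Xm). assert (DS := Derive_correct _ _ XS).
  assert (Dal := Derive_correct _ _ Xal). assert (Dom := Derive_correct _ _ Xom).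
  assert (Dal1 := Derive_correct _ _ Xal1). assert (Dom1 := Derive_correct _ _ Xom1).
  assert (Dmu := Derive_correct _ _ Xmu).
  assert (ES' : Derive (fS s) r = fS s r *
    (2 * Derive (fomega s) r ^ 2 / r + 2 * falpha s r ^ 2 * fomega s r ^ 2
       / (r * fmu ell s r ^ 2 * fS s r ^ 2))).
  { rewrite <- ES. field. auto. }
  assert (Eal' : Derive (Derive (falpha s)) r =
    (2 * falpha s r * fomega s r ^ 2 / r ^ 2
     - (2 * fmu ell s r / r - fmu ell s r * Derive (fS s) r / fS s r)
       * Derive (falpha s) r) / fmu ell s r).
  { apply (Rmult_eq_reg_l (fmu ell s r)); auto.
    replace (fmu ell s r * ((2 * falpha s r * fomega s r ^ 2 / r ^ 2
     - (2 * fmu ell s r / r - fmu ell s r * Derive (fS s) r / fS s r)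
       * Derive (falpha s) r) / fmu ell s r))
    with (2 * falpha s r * fomega s r ^ 2 / r ^ 2
     - (2 * fmu ell s r / r - fmu ell s r * Derive (fS s) r / fS s r)
       * Derive (falpha s) r) by (field; auto).
    lra. }
  assert (Eom' : fmu ell s r * Derive (Derive (fomega s)) r =
    - ((Derive (fmu ell s) r + fmu ell s r * Derive (fS s) r / fS s r)
         * Derive (fomega s) r)
    - fomega s r * (1 - fomega s r ^ 2) / r ^ 2
    - falpha s r ^ 2 * fomega s r / (fmu ell s r * fS s r ^ 2)) by lra.
  split; [|split; [|split; [|split; [|split; [|split; [|split]]]]]].
  - evar_last; [exact Dal|]. unfold flux_alpha. field. auto.
  - unfold flux_alpha. auto_derive; [auto|].
    change (Derive (fun x => fS s x) r) with (Derive (fS s) r).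
    change (Derive (fun x => Derive (falpha s) x) r) with (Derive (Derive (falpha s)) r).
    rewrite Eal'. field. auto.
  - auto_derive; [auto|]. change (Derive (fun x => fomega s x) r) with (Derive (fomega s) r).
    unfold flux_omega. field. auto.
  - unfold flux_omega. auto_derive; [auto|].
    change (Derive (fun x => fS s x) r) with (Derive (fS s) r).
    change (Derive (fun x => fmu ell s x) r) with (Derive (fmu ell s) r).
    change (Derive (fun x => Derive (fomega s) x) r) with (Derive (Derive (fomega s)) r).
    match goal with |- ?X = _ =>
      replace X with (Derive (fmu ell s) r * fS s r * Derive (fomega s) r
        + fmu ell s r * Derive (fS s) r * Derive (fomega s) r
        + fS s r * (fmu ell s r * Derive (Derive (fomega s)) r)) by ring end.
    rewrite Eom'. field. auto.
  - auto_derive; [auto|]. change (Derive (fun x => fS s x) r) with (Derive (fS s) r).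
    rewrite ES'. unfold flux_omega. field. auto.
  - evar_last; [exact Dm|]. rewrite Em. unfold flux_alpha, flux_omega. field. auto.
  - unfold flux_omega. field. auto.
  - unfold flux_alpha. field. auto.
Qed.

(* One term per equation, bounding its right-hand side; see [flow_bounds]. *)
Definition flow_constant (L : R) : R :=
  L + 2 * L ^ 2 * L * L + L * L + L * ((1 + L) * L + L * L * L ^ 2)
  + L * (2 * (L * L * L * L * L ^ 3) + 2 * (L ^ 2 * L ^ 2 * L ^ 2 * L ^ 3))
  + (/ 2 + L ^ 2 * L * L ^ 2 + L * L ^ 2 + (1 + L) ^ 2 * / 2).

(** The vacuum is stationary for the flow, so each term contains a small variable. One such factor
    is bounded by [D] and any further one by [1], which gives a bound linear in [D] with a constant
    depending on [L] alone. *)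
Lemma flow_bounds (L D v iS al o u A B S x : R) :
  1 <= L -> 0 <= D <= 1 ->
  Rabs v <= L -> Rabs iS <= L -> Rabs o <= L -> Rabs S <= L -> Rabs x <= L ->
  Rabs al <= D -> Rabs u <= D -> Rabs A <= D -> Rabs B <= D ->
  let C := D * flow_constant L in
  Rabs (A * S) <= C /\ Rabs (2 * al * o ^ 2 * v * iS) <= C /\ Rabs (B * v * iS) <= C /\
  Rabs (- (S * (- (u * (1 + o) * o) + al * al * o * v * iS ^ 2))) <= C /\
  Rabs (S * (2 * B * (B * v * iS * v * iS * x ^ 3)
             + 2 * al * (al * o ^ 2 * v ^ 2 * iS ^ 2 * x ^ 3))) <= C /\
  Rabs (A * (A * / 2) + al * (al * o ^ 2 * v * iS ^ 2) + B * (B * v * iS ^ 2)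
        + u * (u * (1 + o) ^ 2 * / 2)) <= C.
Proof.
  intros HL HD Hv HiS Ho HS Hx Hal Hu HA HB C.
  assert (Hal1 : Rabs al <= 1) by lra. assert (HA1 : Rabs A <= 1) by lra.
  assert (HB1 : Rabs B <= 1) by lra. assert (Hu1 : Rabs u <= 1) by lra.
  assert (Hpos : 0 <= D) by lra.
  assert (Q1 : Rabs (A * S) <= D * L) by bound.
  assert (Q2 : Rabs (2 * al * o ^ 2 * v * iS) <= 2 * D * L ^ 2 * L * L) by bound.
  assert (Q3 : Rabs (B * v * iS) <= D * L * L) by bound.
  assert (Q4 : Rabs (- (S * (- (u * (1 + o) * o) + al * al * o * v * iS ^ 2)))
               <= L * (D * (1 + L) * L + D * 1 * L * L * L ^ 2)) by bound.
  assert (Q5 : Rabs (S * (2 * B * (B * v * iS * v * iS * x ^ 3)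
             + 2 * al * (al * o ^ 2 * v ^ 2 * iS ^ 2 * x ^ 3)))
    <= L * (2 * D * (1 * L * L * L * L * L ^ 3) + 2 * D * (1 * L ^ 2 * L ^ 2 * L ^ 2 * L ^ 3)))
    by bound.
  assert (Q6 : Rabs (A * (A * / 2) + al * (al * o ^ 2 * v * iS ^ 2) + B * (B * v * iS ^ 2)
        + u * (u * (1 + o) ^ 2 * / 2))
    <= D * (1 * / 2) + D * (1 * L ^ 2 * L * L ^ 2) + D * (1 * L * L ^ 2)
       + D * (1 * (1 + L) ^ 2 * / 2)) by bound.
  assert (N : forall a b, 0 <= a -> 0 <= b -> 0 <= a * b) by (intros; now apply Rmult_le_pos).
  assert (P1 : 0 <= D * L) by (apply N; lra).
  assert (P2 : 0 <= 2 * D * L ^ 2 * L * L)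
    by (repeat (apply N || apply pow_le); lra).
  assert (P3 : 0 <= D * L * L) by (repeat (apply N || apply pow_le); lra).
  assert (P4 : 0 <= L * (D * (1 + L) * L + D * 1 * L * L * L ^ 2))
    by (repeat (apply N || apply pow_le || apply Rplus_le_le_0_compat); lra).
  assert (P5 : 0 <= L * (2 * D * (1 * L * L * L * L * L ^ 3) + 2 * D * (1 * L ^ 2 * L ^ 2 * L ^ 2 * L ^ 3)))
    by (repeat (apply N || apply pow_le || apply Rplus_le_le_0_compat); lra).
  assert (P6 : 0 <= D * (1 * / 2) + D * (1 * L ^ 2 * L * L ^ 2) + D * (1 * L * L ^ 2)
       + D * (1 * (1 + L) ^ 2 * / 2))
    by (repeat (apply N || apply pow_le || apply Rplus_le_le_0_compat); lra).
  assert (E : C = D * L + 2 * D * L ^ 2 * L * L + D * L * L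
    + L * (D * (1 + L) * L + D * 1 * L * L * L ^ 2)
    + L * (2 * D * (1 * L * L * L * L * L ^ 3) + 2 * D * (1 * L ^ 2 * L ^ 2 * L ^ 2 * L ^ 3))
    + (D * (1 * / 2) + D * (1 * L ^ 2 * L * L ^ 2) + D * (1 * L * L ^ 2)
       + D * (1 * (1 + L) ^ 2 * / 2))) by (unfold C, flow_constant; field).
  repeat split; lra.
Qed.

Definition deviation (ell mh : R) (s : fields) (r : R) : R :=
  Rabs (falpha s r) + Rabs (flux_alpha s r) + Rabs (fomega s r - 1)
  + Rabs (flux_omega ell s r) + Rabs (fS s r - 1) + Rabs (fm s r - mh).

Lemma deviation_bounds ell mh s r D :
  deviation ell mh s r <= D ->
  Rabs (falpha s r) <= D /\ Rabs (flux_alpha s r) <= D /\ Rabs (fomega s r - 1) <= D /\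
  Rabs (flux_omega ell s r) <= D /\ Rabs (fS s r - 1) <= D /\ Rabs (fm s r - mh) <= D.
Proof.
  unfold deviation. intros H.
  assert (H1 := Rabs_pos (falpha s r)). assert (H2 := Rabs_pos (flux_alpha s r)).
  assert (H3 := Rabs_pos (fomega s r - 1)). assert (H4 := Rabs_pos (flux_omega ell s r)).
  assert (H5 := Rabs_pos (fS s r - 1)). assert (H6 := Rabs_pos (fm s r - mh)).
  repeat split; lra.
Qed.

Lemma continuous_Rabs_comp (f : R -> R) (x : R) :
  continuous f x -> continuous (fun y => Rabs (f y)) x.
Proof.
  intros H. apply (continuous_comp f Rabs); auto. apply continuous_Rabs.
Qed.

Lemma deviation_flow ell mh s r L D :
  1 <= r -> 2 <= L -> 0 < ell ^ 2 <= L -> 0 <= D <= / 4 -> 2 * (mh + 1) <= r ->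
  differentiable_at ell s r -> static_eym ell s r ->
  deviation ell mh s r <= D ->
  r ^ 2 <= ell ^ 2 * fmu ell s r /\ Rabs (/ fS s r) <= L /\ Rabs (fS s r) <= L /\
  exists f1 f2 f3 f4 f5 f6 : R,
    is_derive (falpha s) r (f1 / r ^ 2) /\ is_derive (flux_alpha s) r (f2 / r ^ 2) /\
    is_derive (fun y => fomega s y - 1) r (f3 / r ^ 2) /\
    is_derive (flux_omega ell s) r (f4 / r ^ 2) /\
    is_derive (fun y => fS s y - 1) r (f5 / r ^ 2) /\
    is_derive (fm s) r (f6 / r ^ 2) /\
    (Rabs f1 <= D * flow_constant L /\ Rabs f2 <= D * flow_constant L /\
     Rabs f3 <= D * flow_constant L /\ Rabs f4 <= D * flow_constant L /\
     Rabs f5 <= D * flow_constant L /\ Rabs f6 <= D * flow_constant L) /\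
    Rabs (r ^ 2 * Derive (fomega s) r) <= D * L * L /\
    Rabs (r ^ 2 * Derive (falpha s) r) <= D * L.
Proof.
  intros Hr HL Hell HD Hm Hdiff Heym Hdev.
  destruct (deviation_bounds _ _ _ _ _ Hdev) as (B1 & B2 & B3 & B4 & B5 & B6).
  assert (B3' := B3). assert (B5' := B5).
  apply Rabs_le_between in B3'. apply Rabs_le_between in B5'. apply Rabs_le_between in B6.
  assert (Hr2 : 0 < r ^ 2) by (apply pow_lt; lra).
  (* At these radii [m <= mh + 1] makes [1 - 2 m / r] nonnegative, so [mu] is at least its anti-de
     Sitter part [r^2 / ell^2]. *)
  assert (Hmu : r ^ 2 <= ell ^ 2 * fmu ell s r).
  { unfold fmu. assert (Hfrac : 2 * fm s r / r <= 1) by (apply Rle_div_l; lra).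
    replace (ell ^ 2 * (1 - 2 * fm s r / r + r ^ 2 / ell ^ 2))
      with (r ^ 2 + ell ^ 2 * (1 - 2 * fm s r / r)).
    - assert (0 <= ell ^ 2 * (1 - 2 * fm s r / r)) by (apply Rmult_le_pos; lra). lra.
    - field. split; [|lra]. intros E. rewrite E in Hell. simpl in Hell. lra. }
  assert (Hmu0 : 0 < fmu ell s r).
  { apply Rmult_lt_reg_l with (ell ^ 2); lra. }
  assert (HiS : Rabs (/ fS s r) <= L).
  { rewrite Rabs_right.
    - apply Rle_trans with (/ / 2); [|lra]. apply Rinv_le_contravar; lra.
    - apply Rle_ge, Rlt_le, Rinv_0_lt_compat. lra. }
  assert (HS : Rabs (fS s r) <= L) by (apply Rabs_le; lra).
  assert (Hv : Rabs (r ^ 2 / fmu ell s r) <= L).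
  { rewrite Rabs_right.
    - apply (Rle_div_l (r ^ 2) L (fmu ell s r)); auto.
      apply Rle_trans with (1 := Hmu). apply Rmult_le_compat_r; lra.
    - apply Rle_ge, Rlt_le, Rdiv_lt_0_compat; auto. }
  assert (Hx : Rabs (/ r) <= L).
  { rewrite Rabs_right.
    - apply Rle_trans with (/ 1); [|lra]. apply Rinv_le_contravar; lra.
    - apply Rle_ge, Rlt_le, Rinv_0_lt_compat. lra. }
  assert (Ho : Rabs (fomega s r) <= L) by (apply Rabs_le; lra).
  destruct (eym_radial_flow ell s r) as (F1 & F2 & F3 & F4 & F5 & F6 & F7 & F8);
    auto; try lra.
  destruct (flow_bounds L D (r ^ 2 / fmu ell s r) (/ fS s r) (falpha s r) (fomega s r)
    (fomega s r - 1) (flux_alpha s r) (flux_omega ell s r) (fS s r) (/ r))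
    as (G1 & G2 & G3 & G4 & G5 & G6); auto; try lra.
  cbv zeta in *.
  split; auto. split; auto. split; auto.
  do 6 eexists. split; [exact F1|]. split; [exact F2|]. split; [exact F3|].
  split; [exact F4|]. split; [exact F5|]. split; [exact F6|].
  split; [repeat split; assumption|].
  rewrite F7, F8. split; bound.
Qed.

(** While the deviation stays below [D], each of its six terms grows by at most
    [D * flow_constant L / R1 <= D / 24]. Together they add [D / 4] to the initial [D / 2], and
    [3 / 4 * D < D] closes the bootstrap for the normalized function [F]. *)
Lemma deviation_propagates ell rh p s mh L D R1 :
  0 < rh < R1 -> 1 <= R1 -> 2 <= L -> 0 < ell ^ 2 <= L -> 0 < D <= / 4 ->
  2 * (mh + 1) <= R1 -> 24 * flow_constant L <= R1 ->
  static_black_hole ell rh p s ->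
  (forall r, rh < r -> 0 < fmu ell s r /\ 0 < fS s r) ->
  deviation ell mh s R1 <= D / 2 ->
  forall r, R1 <= r -> deviation ell mh s r <= D.
Proof.
  intros HR1 HR1' HL Hell HD Hmh HC Hbh Hpos H0.
  assert (Hdiff : forall r, R1 <= r -> differentiable_at ell s r).
  { intros r Hr. apply (black_hole_differentiable ell rh p); auto; lra. }
  assert (Heym : forall r, R1 <= r -> static_eym ell s r).
  { intros r Hr. apply Hbh. lra. }
  set (F := fun r => deviation ell mh s r * / D).
  assert (HDi : 0 < / D) by (apply Rinv_0_lt_compat; lra).
  assert (HF : forall r k, deviation ell mh s r <= D * k <-> F r <= k).
  { intros r k. unfold F. split; intros H.
    - apply (Rmult_le_reg_l D); [lra|].
      replace (D * (deviation ell mh s r * / D)) with (deviation ell mh s r) by (field; lra).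
      exact H.
    - replace (deviation ell mh s r) with (D * (deviation ell mh s r * / D)) by (field; lra).
      apply Rmult_le_compat_l; lra. }
  assert (Hind : forall r, R1 <= r -> F r <= 3 / 4).
  { apply continuous_induction; try lra.
    - intros r Hr. destruct (Hpos r ltac:(lra)) as [Hmu HS].
      destruct (eym_radial_flow ell s r) as (F1 & F2 & F3 & F4 & F5 & F6 & _);
        auto; try lra.
      apply is_derive_cont in F1. apply is_derive_cont in F2.
      apply is_derive_cont in F3. apply is_derive_cont in F4.
      apply is_derive_cont in F5. apply is_derive_cont in F6.
      assert (F7 : continuous (fun y => fm s y - mh) r) by cont.
      apply continuous_Rabs_comp in F1. apply continuous_Rabs_comp in F2.
      apply continuous_Rabs_comp in F3. apply continuous_Rabs_comp in F4.
      apply continuous_Rabs_comp in F5. apply continuous_Rabs_comp in F7.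
      unfold F, deviation. cont.
    - apply HF. lra.
    - intros r Hr Hbelow. apply HF.
      assert (Hstep : forall t, R1 <= t <= r -> deviation ell mh s t <= D).
      { intros t Ht. specialize (Hbelow t Ht). apply HF in Hbelow. lra. }
      assert (HDC : D * flow_constant L / R1 <= D / 24).
      { apply (Rle_div_l (D * flow_constant L) (D / 24) R1); [lra|].
        replace (D / 24 * R1) with (D * (R1 / 24)) by field.
        apply Rmult_le_compat_l; lra. }
      assert (Hflow := fun t (Ht : R1 <= t <= r) =>
        deviation_flow ell mh s t L D ltac:(lra) HL Hell ltac:(lra) ltac:(lra)
          (Hdiff t (proj1 Ht)) (Heym t (proj1 Ht)) (Hstep t Ht)).
      assert (HC0 : 0 <= D * flow_constant L).
      { destruct (Hflow R1 ltac:(lra)) as (_ & _ & _ & f1 & f2 & f3 & f4 & f5 & f6 & H).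
        destruct H as (_ & _ & _ & _ & _ & _ & (H & _) & _).
        apply Rle_trans with (2 := H). apply Rabs_pos. }
      assert (Hinc : forall f : R -> R,
        (forall t, R1 <= t <= r -> exists f1, is_derive f t (f1 / t ^ 2) /\
           Rabs f1 <= D * flow_constant L) -> Rabs (f r - f R1) <= D / 24).
      { intros f Hf. apply Rle_trans with (2 := HDC).
        assert (Hf' : forall t, R1 <= t <= r -> is_derive f t (Derive f t) /\
                  Rabs (Derive f t) <= D * flow_constant L / t ^ 2).
        { intros t Ht. destruct (Hf t Ht) as (f1 & Hd & Hb).
          rewrite (is_derive_unique _ _ _ Hd). split; auto.
          assert (Ht2 : 0 < t ^ 2) by (apply pow_lt; lra).
          unfold Rdiv. rewrite Rabs_mult, (Rabs_right (/ t ^ 2)).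
          - apply Rmult_le_compat_r; auto. apply Rlt_le, Rinv_0_lt_compat; auto.
          - apply Rle_ge, Rlt_le, Rinv_0_lt_compat; auto. }
        apply (increment_bound_inverse_square f (Derive f)); auto; try lra;
          intros t Ht; apply (Hf' t Ht). }
      assert (Htri : forall x y, Rabs (x - y) <= D / 24 -> Rabs x <= Rabs y + D / 24).
      { intros x y Hxy. replace x with (y + (x - y)) by ring.
        eapply Rle_trans; [apply Rabs_triang|]. lra. }
      assert (I1 : Rabs (falpha s r - falpha s R1) <= D / 24).
      { apply Hinc. intros t Ht.
        destruct (Hflow t Ht) as (_ & _ & _ & f1 & f2 & f3 & f4 & f5 & f6 & H).
        exists f1. split; apply H. }
      assert (I2 : Rabs (flux_alpha s r - flux_alpha s R1) <= D / 24).
      { apply Hinc. intros t Ht.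
        destruct (Hflow t Ht) as (_ & _ & _ & f1 & f2 & f3 & f4 & f5 & f6 & H).
        exists f2. split; apply H. }
      assert (I3 : Rabs ((fomega s r - 1) - (fomega s R1 - 1)) <= D / 24).
      { apply (Hinc (fun y => fomega s y - 1)). intros t Ht.
        destruct (Hflow t Ht) as (_ & _ & _ & f1 & f2 & f3 & f4 & f5 & f6 & H).
        exists f3. split; apply H. }
      assert (I4 : Rabs (flux_omega ell s r - flux_omega ell s R1) <= D / 24).
      { apply Hinc. intros t Ht.
        destruct (Hflow t Ht) as (_ & _ & _ & f1 & f2 & f3 & f4 & f5 & f6 & H).
        exists f4. split; apply H. }
      assert (I5 : Rabs ((fS s r - 1) - (fS s R1 - 1)) <= D / 24).
      { apply (Hinc (fun y => fS s y - 1)). intros t Ht.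
        destruct (Hflow t Ht) as (_ & _ & _ & f1 & f2 & f3 & f4 & f5 & f6 & H).
        exists f5. split; apply H. }
      assert (I6 : Rabs ((fm s r - mh) - (fm s R1 - mh)) <= D / 24).
      { replace ((fm s r - mh) - (fm s R1 - mh)) with (fm s r - fm s R1) by ring.
        apply Hinc. intros t Ht.
        destruct (Hflow t Ht) as (_ & _ & _ & f1 & f2 & f3 & f4 & f5 & f6 & H).
        exists f6. split; apply H. }
      apply Htri in I1. apply Htri in I2. apply Htri in I3. apply Htri in I4.
      apply Htri in I5. apply Htri in I6.
      unfold deviation in *. lra. }
  intros r Hr. specialize (Hind r Hr). apply HF in Hind. lra.
Qed.

Lemma flow_constant_nonneg L : 1 <= L -> 0 <= flow_constant L.
Proof.
  intros HL. unfold flow_constant.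
  repeat (apply Rmult_le_pos || apply pow_le || apply Rplus_le_le_0_compat); lra.
Qed.

(** Beyond [2 * rh] the weights [r] and [r - rh] are comparable. The size [D * L * L] arises when
    [r^2 omega'] is recovered from its flux as [B v / S]; since [L >= 2] it also exceeds [4 * D]. *)
Lemma near_vacuum_far ell rh mh s r L K D :
  0 < rh -> 2 * rh <= r -> 1 <= r -> 2 <= L -> 0 < ell ^ 2 <= L -> 0 < D <= / 4 ->
  0 < mh -> 2 * (mh + 1) <= r ->
  ell ^ 2 <= K -> 2 * (2 + / ell ^ 2) <= K ->
  2 * (mh + 1) + 2 * flow_constant L + 2 * / ell ^ 2 <= K ->
  differentiable_at ell s r -> static_eym ell s r ->
  deviation ell mh s r <= D ->
  near_vacuum ell rh K (D * L * L) s r.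
Proof.
  intros Hrh Hr2 Hr1 HL Hell HD Hmh Hmr HK1 HK2 HK3 Hdiff Heym Hdev.
  destruct (deviation_flow ell mh s r L D) as
    (Hmu & _ & _ & f1 & f2 & f3 & f4 & f5 & f6 & _ & _ & _ & _ & _ & D6 &
     (_ & _ & _ & _ & _ & C6) & W & A); auto; try lra.
  destruct (deviation_bounds _ _ _ _ _ Hdev) as (B1 & B2 & B3 & B4 & B5 & B6).
  apply Rabs_le_between in B6.
  assert (HDL : 4 * D <= D * L * L).
  { rewrite (Rmult_comm 4 D), Rmult_assoc. apply Rmult_le_compat_l; [lra|].
    replace 4 with (2 * 2) by ring. apply Rmult_le_compat; lra. }
  assert (Hrr : 0 < r ^ 2) by (apply pow_lt; lra).
  assert (Hell' : 0 < / ell ^ 2) by (apply Rinv_0_lt_compat; lra).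
  assert (Hfc := flow_constant_nonneg L ltac:(lra)).
  assert (Hm6 : - (D * flow_constant L) <= Derive (fm s) r * r ^ 2 <= D * flow_constant L).
  { rewrite (is_derive_unique _ _ _ D6).
    replace (f6 / r ^ 2 * r ^ 2) with f6 by (field; lra).
    now apply Rabs_le_between in C6. }
  assert (Hir : 0 < / r) by (apply Rinv_0_lt_compat; lra).
  assert (Hir1 : / r <= 1).
  { replace 1 with (/ 1) by apply Rinv_1. apply Rinv_le_contravar; lra. }
  split.
  - lra.
  - lra.
  - exact W.
  - apply Rle_trans with (1 := A). rewrite <- (Rmult_1_r (D * L)) at 1.
    apply Rmult_le_compat_l; [apply Rmult_le_pos|]; lra.
  - assert (Rabs (falpha s r) * r <= D * r) by (apply Rmult_le_compat_r; lra).
    apply Rle_trans with (4 * D * (r - rh)).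
    + replace (4 * D * (r - rh)) with (D * (4 * (r - rh))) by ring.
      apply Rle_trans with (1 := H). apply Rmult_le_compat_l; lra.
    + apply Rmult_le_compat_r; lra.
  - assert (ell ^ 2 * fmu ell s r <= K * fmu ell s r).
    { apply Rmult_le_compat_r; [|lra]. nra. }
    nra.
  - assert (Hle : fmu ell s r <= 2 + r ^ 2 * / ell ^ 2).
    { unfold fmu, Rdiv. assert (- 1 <= 2 * fm s r * / r); [|lra].
      assert (- 1 <= 2 * fm s r) by lra. nra. }
    assert (fmu ell s r <= (2 + / ell ^ 2) * r ^ 2) by nra.
    assert (r ^ 2 <= 2 * (r * (r - rh))) by nra.
    assert ((2 + / ell ^ 2) * r ^ 2 <= (2 + / ell ^ 2) * (2 * (r * (r - rh))))
      by (apply Rmult_le_compat_l; lra).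
    assert (2 * (2 + / ell ^ 2) * (r * (r - rh)) <= K * (r * (r - rh))).
    { apply Rmult_le_compat_r; auto. nra. }
    lra.
  - destruct Hdiff as (_ & Xm & _).
    rewrite Derive_fmu by (auto; lra).
    replace (2 * fm s r / r ^ 2 - 2 * Derive (fm s) r / r + 2 * r / ell ^ 2)
      with (2 * fm s r * (/ r) ^ 2 - 2 * (Derive (fm s) r * r ^ 2) * (/ r) ^ 3
            + 2 * r * / ell ^ 2).
    2: { field. split; [|lra]. intros E. rewrite E in Hell. simpl in Hell. lra. }
    assert (Hx : Rabs (/ r) <= 1) by (apply Rabs_le; lra).
    assert (Hfm : Rabs (fm s r) <= mh + 1) by (apply Rabs_le; lra).
    assert (Hfm1 : Rabs (Derive (fm s) r * r ^ 2) <= flow_constant L).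
    { apply Rabs_le. assert (D * flow_constant L <= 1 * flow_constant L)
        by (apply Rmult_le_compat_r; lra). lra. }
    set (z := Derive (fm s) r * r ^ 2) in *. set (i := / ell ^ 2) in *.
    assert (Hi : Rabs i <= i) by (rewrite Rabs_right; lra).
    assert (Hrb : Rabs r <= r) by (rewrite Rabs_right; lra).
    apply Rle_trans with
      (2 * (mh + 1) * 1 ^ 2 + 2 * flow_constant L * 1 ^ 3 + 2 * r * i); [bound|].
    assert (2 * (mh + 1) * 1 <= 2 * (mh + 1) * r) by (apply Rmult_le_compat_l; lra).
    assert (2 * flow_constant L * 1 <= 2 * flow_constant L * r)
      by (apply Rmult_le_compat_l; lra).
    assert ((2 * (mh + 1) + 2 * flow_constant L + 2 * i) * r <= K * r)
      by (apply Rmult_le_compat_r; lra).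
    lra.
Qed.

(** * The neighbourhood of the Schwarzschild-anti-de Sitter solution *)

Definition horizon_mass (ell rh : R) : R := rh / 2 + rh ^ 3 / (2 * ell ^ 2).

Definition schwarzschild_AdS (ell rh : R) : fields :=
  Fields (fun _ => horizon_mass ell rh) (fun _ => 1) (fun _ => 0) (fun _ => 1).

Lemma is_derive_fmu_schwarzschild ell rh r :
  r <> 0 -> ell <> 0 ->
  is_derive (fmu ell (schwarzschild_AdS ell rh)) r
    (2 * horizon_mass ell rh / r ^ 2 + 2 * r / ell ^ 2).
Proof.
  intros Hr Hell. unfold fmu, schwarzschild_AdS; simpl fm.
  auto_derive; auto. field. auto.
Qed.

Lemma horizon_mass_pos ell rh : 0 < rh -> ell <> 0 -> 0 < horizon_mass ell rh.
Proof.
  intros Hrh Hell. assert (0 < ell ^ 2) by (apply pow2_gt_0; auto).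
  unfold horizon_mass. apply Rplus_lt_0_compat; apply Rdiv_lt_0_compat; try lra.
  now apply pow_lt.
Qed.

Lemma continue_D_in_const (a c r : R) :
  D_in (fun _ => c) (fun _ => 0) (halfline a) r /\
  continue_in (fun _ => c) (halfline a) r.
Proof.
  split.
  - apply D_in_of_is_derive. apply (is_derive_const (K := R_AbsRing) (V := R_NormedModule) c r).
  - apply continue_in_of_continuous. apply continuous_const.
Qed.

Lemma schwarzschild_AdS_black_hole ell rh :
  0 < rh -> ell <> 0 ->
  static_black_hole ell rh trivial_data (schwarzschild_AdS ell rh).
Proof.
  intros Hrh Hell.
  assert (Hm := horizon_mass_pos ell rh Hrh Hell).
  assert (Hell2 : 0 < ell ^ 2) by (apply pow2_gt_0; auto).
  set (s := schwarzschild_AdS ell rh).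
  set (f1 := fun r => 2 * horizon_mass ell rh / r ^ 2 + 2 * r / ell ^ 2).
  assert (Hmu : forall r, rh <= r ->
    D_in (fmu ell s) f1 (halfline rh) r /\ continue_in f1 (halfline rh) r).
  { intros r Hr. split.
    - apply D_in_of_is_derive. apply is_derive_fmu_schwarzschild; lra.
    - apply continue_in_of_continuous. unfold f1.
      assert (Hid : continuous (fun y : R => y) r) by apply continuous_id.
      cont. apply pow_nonzero. lra. }
  assert (C1c : forall c, C1_on rh (fun _ => c)).
  { intros c. exists (fun _ => 0). intros r Hr. split; apply continue_D_in_const. }
  assert (C2c : forall c, C2_on rh (fun _ => c)).
  { intros c. exists (fun _ => 0), (fun _ => 0). intros r Hr.
    split; [|split]; apply continue_D_in_const. }
  unfold s, schwarzschild_AdS in *.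
  repeat split; try apply C1c; try apply C2c.
  - now exists f1.
  - cbn [fm fS falpha fomega]. rewrite !Derive_const. unfold Rdiv. ring.
  - cbn [fm fS falpha fomega]. rewrite !Derive_const. unfold Rdiv. ring.
  - cbn [fm fS falpha fomega]. rewrite Derive_n_const, !Derive_const. unfold Rdiv. ring.
  - cbn [fm fS falpha fomega]. rewrite Derive_n_const, !Derive_const. unfold Rdiv. ring.
  - unfold fmu; simpl fm. unfold horizon_mass. field. lra.
  - exists (f1 rh). split.
    + unfold f1. apply Rplus_lt_0_compat; apply Rdiv_lt_0_compat; try lra.
      apply pow_lt; auto.
    + apply Hmu. lra.
  - simpl. apply continue_D_in_const.
Qed.

(** Exhibits the simple zero at the horizon with a positive cofactor, from which the comparison with
    [r (r - rh)] follows. *)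
Lemma fmu_schwarzschild_factor ell rh r :
  r <> 0 -> ell <> 0 ->
  fmu ell (schwarzschild_AdS ell rh) r =
    (r - rh) * (r ^ 2 + r * rh + rh ^ 2 + ell ^ 2) / (r * ell ^ 2).
Proof.
  intros Hr Hell. unfold fmu, schwarzschild_AdS; simpl fm. unfold horizon_mass.
  field. auto.
Qed.

Definition close_to_schwarzschild (ell rh R1 eps : R) (s : fields) : Prop :=
  forall r, rh < r <= R1 ->
    Rabs (fmu ell s r - fmu ell (schwarzschild_AdS ell rh) r) <= eps /\
    Rabs (Derive (fmu ell s) r - Derive (fmu ell (schwarzschild_AdS ell rh)) r) <= eps /\
    Rabs (fS s r - 1) <= eps /\ Rabs (fomega s r - 1) <= eps /\
    Rabs (Derive (falpha s) r) <= eps /\ Rabs (Derive (fomega s) r) <= eps.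

(** Continuous dependence compares with the abstract [sol trivial_data]. Uniqueness identifies it
    with the explicit vacuum on the half-line, hence on a neighbourhood of each [r > rh], so the
    derivatives agree there too. *)
Lemma close_neighbourhood ell rh (V : horizon_data -> Prop)
    (sol : horizon_data -> fields) R1 eps :
  0 < rh -> ell <> 0 -> rh < R1 -> 0 < eps ->
  nbhd trivial_data V ->
  (forall p, V p -> unique_static_black_hole ell rh p (sol p)) ->
  depends_continuously ell rh V sol ->
  nbhd trivial_data (fun p => V p /\ close_to_schwarzschild ell rh R1 eps (sol p)).
Proof.
  intros Hrh Hell HR1 Heps HV Huni Hdep.
  assert (HV0 : V trivial_data) by (apply (locally_singleton _ _ HV)).
  set (t := schwarzschild_AdS ell rh).
  assert (Hagree : agree_from rh (sol trivial_data) t).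
  { apply (Huni _ HV0). now apply schwarzschild_AdS_black_hole. }
  assert (Hloc : forall r, rh < r -> forall n,
    Derive_n (fmu ell (sol trivial_data)) n r = Derive_n (fmu ell t) n r /\
    Derive_n (fS (sol trivial_data)) n r = Derive_n (fS t) n r /\
    Derive_n (falpha (sol trivial_data)) n r = Derive_n (falpha t) n r /\
    Derive_n (fomega (sol trivial_data)) n r = Derive_n (fomega t) n r).
  { intros r Hr n. repeat split; apply Derive_n_ext_loc;
      generalize (locally_gt rh r Hr); apply filter_imp; intros y Hy;
      destruct (Hagree y ltac:(lra)) as (A1 & A2 & A3 & A4); auto.
    unfold fmu. rewrite A1. reflexivity. }
  specialize (Hdep trivial_data HV0 R1 eps HR1 Heps).
  generalize (filter_and _ _ HV Hdep). apply filter_imp.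
  intros q [HVq Hq]. split; auto. intros r Hr.
  destruct (Hq HVq r Hr) as (Q1 & Q2 & Q3 & Q4).
  destruct (Hloc r (proj1 Hr) 0%nat) as (A0 & S0 & _ & O0).
  destruct (Hloc r (proj1 Hr) 1%nat) as (A1 & _ & L1 & O1).
  assert (Q10 := Q1 0%nat ltac:(auto)). assert (Q11 := Q1 1%nat ltac:(auto)).
  assert (Q20 := Q2 0%nat ltac:(auto)). assert (Q31 := Q3 1%nat ltac:(auto)).
  assert (Q40 := Q4 0%nat ltac:(auto)). assert (Q41 := Q4 1%nat ltac:(auto)).
  rewrite A0 in Q10. rewrite A1 in Q11. rewrite S0 in Q20. rewrite L1 in Q31.
  rewrite O0 in Q40. rewrite O1 in Q41.
  change (Derive_n (falpha t) 1 r) with (Derive (fun _ => 0) r) in Q31.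
  change (Derive_n (fomega t) 1 r) with (Derive (fun _ => 1) r) in Q41.
  rewrite Derive_const, Rminus_0_r in Q31, Q41.
  repeat split; assumption.
Qed.

(** Both quantities vanish at the horizon, so closeness of their first derivatives integrates to a
    factor [r - rh], which closeness of the values alone could not provide. *)
Lemma near_horizon_estimates ell rh p R1 eps s r :
  0 < rh -> ell <> 0 -> 0 < eps -> static_black_hole ell rh p s ->
  close_to_schwarzschild ell rh R1 eps s -> rh < r <= R1 ->
  Rabs (fmu ell s r - fmu ell (schwarzschild_AdS ell rh) r) <= eps * (r - rh) /\
  Rabs (falpha s r) <= eps * (r - rh).
Proof.
  intros Hrh Hell Heps Hbh Hclose Hr.
  assert (Hbt := schwarzschild_AdS_black_hole ell rh Hrh Hell).
  set (t := schwarzschild_AdS ell rh) in *.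
  destruct Hbh as (Cmu & _ & Cal & _ & _ & Hmu0 & _ & _ & _ & Hal0 & _).
  destruct Hbt as (Ct & _ & _ & _ & _ & Ht0 & _).
  apply C2_on_C1_on in Cal.
  apply C1_on_right in Cmu as [l1 (RM & RM0 & _)].
  apply C1_on_right in Ct as [l2 (RT & RT0 & _)].
  apply C1_on_right in Cal as [l3 (RA & RA0 & _)].
  split.
  - set (h := fun y => fmu ell s y - fmu ell t y).
    assert (E : h rh = 0) by (unfold h; lra).
    replace (fmu ell s r - fmu ell t r) with (h r - h rh) by (rewrite E; unfold h; ring).
    apply (increment_bound_right h (fun y => Derive (fmu ell s) y - Derive (fmu ell t) y));
      try lra.
    + rewrite E. apply right_limit_eps. intros e He.
      destruct (proj1 (right_limit_eps _ _ _) RM0 (e / 2)) as [d1 [Hd1 L1]]; [lra|].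
      destruct (proj1 (right_limit_eps _ _ _) RT0 (e / 2)) as [d2 [Hd2 L2]]; [lra|].
      exists (Rmin d1 d2). split; [now apply Rmin_pos|]. intros x Hx.
      assert (M1 := Rmin_l d1 d2). assert (M2 := Rmin_r d1 d2).
      specialize (L1 x ltac:(lra)). specialize (L2 x ltac:(lra)).
      rewrite Hmu0 in L1. rewrite Ht0 in L2. unfold h.
      apply Rabs_lt_between in L1. apply Rabs_lt_between in L2.
      apply Rabs_lt_between. lra.
    + intros z Hz. destruct (RM z ltac:(lra)) as [D1 _].
      destruct (RT z ltac:(lra)) as [D2 _].
      apply (is_derive_minus (V := R_NormedModule) (fmu ell s) (fmu ell t));
        now apply Derive_correct.
    + intros z Hz. apply (Hclose z). lra.
  - replace (falpha s r) with (falpha s r - falpha s rh) by (rewrite Hal0; ring).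
    apply (increment_bound_right (falpha s) (Derive (falpha s))); try lra; auto.
    + intros z Hz. apply Derive_correct. apply RA. lra.
    + intros z Hz. apply (Hclose z). lra.
Qed.

(** The unperturbed [mu] is at least [r (r - rh) / ell^2], and [eps <= rh / (2 * ell ^ 2)] lets the
    perturbation remove at most half of it; hence the requirement [2 * ell ^ 2 <= K]. The bound on
    [R1 ^ 2 * eps] pays for the weights [r ^ 2] on the derivatives. *)
Lemma near_vacuum_compact ell rh p R1 eps K d s r :
  0 < rh -> 1 <= R1 -> ell <> 0 -> 0 < eps <= rh / (2 * ell ^ 2) ->
  2 * ell ^ 2 <= K -> 4 / ell ^ 2 + 1 / rh ^ 2 <= K ->
  2 * horizon_mass ell rh / rh ^ 3 + 3 / ell ^ 2 <= K ->
  R1 ^ 2 * eps <= d ->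
  static_black_hole ell rh p s -> close_to_schwarzschild ell rh R1 eps s ->
  rh < r <= R1 -> near_vacuum ell rh K d s r.
Proof.
  intros Hrh HR1 Hell Heps K1 K2 K3 Hd Hbh Hclose Hr.
  destruct (near_horizon_estimates ell rh p R1 eps s r Hrh Hell (proj1 Heps) Hbh Hclose Hr)
    as [Hmu Hal].
  destruct (Hclose r Hr) as (_ & C1 & C2 & C3 & C4 & C5).
  assert (Hell2 : 0 < ell ^ 2) by (apply pow2_gt_0; auto).
  assert (Hmh := horizon_mass_pos ell rh Hrh Hell).
  set (i := / ell ^ 2).
  assert (Hi : 0 < i) by (apply Rinv_0_lt_compat; auto).
  assert (Hi1 : i * ell ^ 2 = 1) by (unfold i; field; auto).
  replace (4 / ell ^ 2) with (4 * i) in K2 by (unfold i; field; auto).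
  replace (3 / ell ^ 2) with (3 * i) in K3 by (unfold i; field; auto).
  replace (rh / (2 * ell ^ 2)) with (rh * i / 2) in Heps by (unfold i; field; auto).
  assert (Hr2 : r ^ 2 <= R1 ^ 2) by (apply pow_incr; lra).
  assert (HR12 : 1 <= R1 ^ 2) by (replace 1 with (1 ^ 2) by ring; apply pow_incr; lra).
  assert (HepsR : eps <= R1 ^ 2 * eps).
  { rewrite <- (Rmult_1_l eps) at 1. apply Rmult_le_compat_r; lra. }
  assert (Hr2p : 0 < r ^ 2) by (apply pow_lt; lra).
  assert (Hsq : forall z, Rabs z <= eps -> Rabs (r ^ 2 * z) <= d).
  { intros z Hz. rewrite Rabs_mult, (Rabs_right (r ^ 2)) by lra.
    apply Rle_trans with (2 := Hd). apply Rmult_le_compat; auto using Rabs_pos. lra. }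
  assert (Hrir : i * rh <= i * r) by (apply Rmult_le_compat_l; lra).
  assert (Hfac : fmu ell (schwarzschild_AdS ell rh) r
    = (r - rh) * (r * i + rh * i + rh ^ 2 * i / r + 1 / r)).
  { rewrite fmu_schwarzschild_factor by (auto; lra). unfold i. field. split; auto. lra. }
  set (c := r * i + rh * i + rh ^ 2 * i / r + 1 / r) in Hfac.
  assert (Hc1 : r * i <= c).
  { assert (0 <= rh ^ 2 * i / r).
    { apply Rdiv_le_0_compat; [|lra]. apply Rmult_le_pos; [apply pow_le|]; lra. }
    assert (0 <= 1 / r) by (apply Rdiv_le_0_compat; lra).
    assert (0 <= rh * i) by (apply Rmult_le_pos; lra). unfold c. lra. }
  assert (Hc2 : c <= r * (3 * i + 1 / rh ^ 2)).
  { assert (rh ^ 2 * i / r <= r * i).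
    { apply (Rle_div_l (rh ^ 2 * i) (r * i) r); [lra|].
      replace (r * i * r) with (r ^ 2 * i) by ring.
      apply Rmult_le_compat_r; [lra|]. apply pow_incr. lra. }
    assert (1 / r <= r * (1 / rh ^ 2)).
    { apply (Rle_div_l 1 (r * (1 / rh ^ 2)) r); [lra|].
      replace (r * (1 / rh ^ 2) * r) with (r ^ 2 / rh ^ 2) by (field; lra).
      apply (Rle_div_r 1 (r ^ 2) (rh ^ 2)); [apply Rlt_gt, pow_lt; lra|].
      rewrite Rmult_1_l. apply pow_incr. lra. }
    unfold c. lra. }
  apply Rabs_le_between in Hmu. rewrite Hfac in Hmu.
  assert (He : eps * (r - rh) <= (r - rh) * (r * i / 2)).
  { rewrite Rmult_comm. apply Rmult_le_compat_l; lra. }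
  assert (Hlo : (r - rh) * (r * i) <= (r - rh) * c) by (apply Rmult_le_compat_l; lra).
  assert (Hhi : (r - rh) * c <= (r - rh) * (r * (3 * i + 1 / rh ^ 2)))
    by (apply Rmult_le_compat_l; lra).
  assert (Hp : 0 < r * (r - rh)) by (apply Rmult_lt_0_compat; lra).
  assert (Hmulow : r * (r - rh) * i / 2 <= fmu ell s r) by lra.
  assert (Hmu0 : 0 <= fmu ell s r).
  { apply Rle_trans with (2 := Hmulow). apply Rdiv_le_0_compat; [|lra].
    apply Rmult_le_pos; lra. }
  split.
  - lra.
  - lra.
  - now apply Hsq.
  - now apply Hsq.
  - assert (Rabs (falpha s r) * r <= eps * (r - rh) * R1)
      by (apply Rmult_le_compat; auto using Rabs_pos; lra).
    assert (eps * R1 <= R1 ^ 2 * eps).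
    { replace (R1 ^ 2 * eps) with (eps * R1 * R1) by ring.
      rewrite <- (Rmult_1_r (eps * R1)) at 1.
      apply Rmult_le_compat_l; [apply Rmult_le_pos|]; lra. }
    assert (eps * R1 * (r - rh) <= d * (r - rh)) by (apply Rmult_le_compat_r; lra).
    lra.
  - apply Rle_trans with (2 * ell ^ 2 * fmu ell s r).
    + apply Rle_trans with (2 * ell ^ 2 * (r * (r - rh) * i / 2)).
      * replace (2 * ell ^ 2 * (r * (r - rh) * i / 2)) with (r * (r - rh) * (i * ell ^ 2))
          by field.
        rewrite Hi1. lra.
      * apply Rmult_le_compat_l; lra.
    + apply Rmult_le_compat_r; auto.
  - apply Rle_trans with ((4 * i + 1 / rh ^ 2) * (r * (r - rh))).
    + assert (0 <= r * (r - rh) * i) by (apply Rmult_le_pos; lra). lra.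
    + apply Rmult_le_compat_r; lra.
  - rewrite (is_derive_unique _ _ _ (is_derive_fmu_schwarzschild ell rh r ltac:(lra) Hell))
      in C1.
    set (m := horizon_mass ell rh) in *.
    assert (Hm : 0 <= 2 * m / r ^ 2 <= r * (2 * m / rh ^ 3)).
    { split; [apply Rdiv_le_0_compat; lra|].
      apply (Rle_div_l (2 * m) (r * (2 * m / rh ^ 3)) (r ^ 2)); [lra|].
      replace (r * (2 * m / rh ^ 3) * r ^ 2) with (2 * m * r ^ 3 / rh ^ 3) by (field; lra).
      apply (Rle_div_r (2 * m) (2 * m * r ^ 3) (rh ^ 3)); [apply Rlt_gt, pow_lt; lra|].
      apply Rmult_le_compat_l; [lra|]. apply pow_incr. lra. }
    replace (2 * r / ell ^ 2) with (2 * r * i) in C1 by (unfold i; field; auto).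
    assert ((2 * m / rh ^ 3 + 3 * i) * r <= K * r) by (apply Rmult_le_compat_r; lra).
    apply Rabs_le_between in C1.
    assert (0 < r * i) by (apply Rmult_lt_0_compat; lra).
    apply Rabs_le. lra.
Qed.

Lemma deviation_initial ell rh p R1 eps s :
  0 < rh < R1 -> 1 <= R1 -> ell <> 0 -> 0 < eps <= / 2 ->
  static_black_hole ell rh p s -> close_to_schwarzschild ell rh R1 eps s ->
  deviation ell (horizon_mass ell rh) s R1 <=
    eps * (4 + 4 * R1 ^ 2 + 2 * Rabs (fmu ell (schwarzschild_AdS ell rh) R1)).
Proof.
  intros HR1 HR1' Hell Heps Hbh Hclose.
  assert (Hr : rh < R1 <= R1) by lra.
  destruct (near_horizon_estimates ell rh p R1 eps s R1 (proj1 HR1) Hell (proj1 Heps)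
              Hbh Hclose Hr) as [_ Hal].
  destruct (Hclose R1 Hr) as (C0 & C1 & C2 & C3 & C4 & C5).
  set (M := Rabs (fmu ell (schwarzschild_AdS ell rh) R1)) in *.
  assert (HM : 0 <= M) by apply Rabs_pos.
  assert (Hmu : Rabs (fmu ell s R1) <= M + 1 / 2).
  { replace (fmu ell s R1) with (fmu ell (schwarzschild_AdS ell rh) R1
      + (fmu ell s R1 - fmu ell (schwarzschild_AdS ell rh) R1)) by ring.
    eapply Rle_trans; [apply Rabs_triang|]. fold M. lra. }
  assert (C2' := C2). apply Rabs_le_between in C2'.
  assert (HS : Rabs (fS s R1) <= 3 / 2) by (apply Rabs_le; lra).
  assert (HiS : Rabs (/ fS s R1) <= 2).
  { rewrite Rabs_right.
    - apply Rle_trans with (/ / 2); [|lra]. apply Rinv_le_contravar; lra.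
    - apply Rle_ge, Rlt_le, Rinv_0_lt_compat. lra. }
  assert (HRR : R1 <= R1 ^ 2) by (simpl; nra).
  assert (HR : Rabs R1 <= R1) by (rewrite Rabs_right; lra).
  assert (T1 : Rabs (falpha s R1) <= eps * R1).
  { apply Rle_trans with (1 := Hal). apply Rmult_le_compat_l; lra. }
  assert (T2 : Rabs (flux_alpha s R1) <= R1 ^ 2 * eps * 2)
    by (unfold flux_alpha, Rdiv; bound).
  assert (T4 : Rabs (flux_omega ell s R1) <= (M + 1 / 2) * (3 / 2) * eps)
    by (unfold flux_omega; bound).
  assert (T6 : Rabs (fm s R1 - horizon_mass ell rh) <= R1 * / 2 * eps).
  { replace (fm s R1 - horizon_mass ell rh) with
      (- (R1 * / 2 * (fmu ell s R1 - fmu ell (schwarzschild_AdS ell rh) R1))).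
    - bound.
    - unfold fmu, schwarzschild_AdS; simpl fm. field. split; auto. lra. }
  assert (E1' : eps * R1 <= eps * R1 ^ 2) by (apply Rmult_le_compat_l; lra).
  assert (E2' : 0 <= eps * M) by (apply Rmult_le_pos; lra).
  assert (E3' : 0 <= eps * R1 ^ 2) by (apply Rmult_le_pos; lra).
  unfold deviation. lra.
Qed.

(** The quantifiers put [K] and [sol] before [d], since the size that guarantees stability is known
    only once [K] is given. *)
Lemma near_vacuum_neighbourhood ell rh :
  0 < rh -> ell <> 0 -> global_existence ell rh ->
  exists K, 1 <= K /\ exists sol : horizon_data -> fields,
    forall d, 0 < d -> exists U, nbhd trivial_data U /\
      forall p, U p -> unique_static_black_hole ell rh p (sol p) /\
        forall r, rh < r -> near_vacuum ell rh K d (sol p) r.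
Proof.
  intros Hrh Hell (V & sol & HV & Hsol & Hdep).
  assert (Hell2 : 0 < ell ^ 2) by (apply pow2_gt_0; auto).
  assert (Hmh := horizon_mass_pos ell rh Hrh Hell).
  set (mh := horizon_mass ell rh) in *.
  set (L := 2 + ell ^ 2).
  assert (Hfc := flow_constant_nonneg L ltac:(unfold L; lra)).
  assert (Hi : 0 < / ell ^ 2) by (apply Rinv_0_lt_compat; auto).
  assert (Hrh2 : 0 < 1 / rh ^ 2) by (apply Rdiv_lt_0_compat; [|apply pow_lt]; lra).
  assert (Hrh3 : 0 < 2 * mh / rh ^ 3) by (apply Rdiv_lt_0_compat; [|apply pow_lt]; lra).
  (* [K] and [R1] dominate every lower bound required of them in the compact and in the far region;
     none of these involves [d]. *)
  set (K := 4 + 2 * ell ^ 2 + 4 * / ell ^ 2 + 1 / rh ^ 2 + 2 * mh / rh ^ 3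
            + 2 * (mh + 1) + 2 * flow_constant L).
  set (R1 := 1 + 2 * rh + 2 * (mh + 1) + 24 * flow_constant L).
  assert (EL : L = 2 + ell ^ 2) by reflexivity.
  assert (ER1 : R1 = 1 + 2 * rh + 2 * (mh + 1) + 24 * flow_constant L) by reflexivity.
  exists K. split; [unfold K; lra|]. exists sol. intros d Hd.
  set (D := Rmin (/ 4) (d / (L * L))).
  assert (HLL : 0 < L * L) by (apply Rmult_lt_0_compat; unfold L; lra).
  assert (HD1 : D <= / 4) by apply Rmin_l.
  assert (HD2 : D <= d / (L * L)) by apply Rmin_r.
  assert (HD0 : 0 < D) by (apply Rmin_pos; [|apply Rdiv_lt_0_compat]; lra).
  assert (HDd : D * L * L <= d).
  { rewrite Rmult_assoc. apply (Rle_div_r D d (L * L)); lra. }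
  set (H := 4 + 4 * R1 ^ 2 + 2 * Rabs (fmu ell (schwarzschild_AdS ell rh) R1)).
  assert (HR1 : 1 <= R1) by (unfold R1; lra).
  assert (HR12 : 0 <= R1 ^ 2) by apply pow2_ge_0.
  assert (HH : 4 + 4 * R1 ^ 2 <= H)
    by (unfold H; generalize (Rabs_pos (fmu ell (schwarzschild_AdS ell rh) R1)); lra).
  (* The first bound keeps [mu] comparable with its vacuum value on the compact part; the second
     starts the deviation at [R1] below [D / 2], since [deviation_initial] bounds it by
     [eps * H]. *)
  set (eps := Rmin (rh / (2 * ell ^ 2)) (D / 2 / H)).
  assert (He1 : eps <= rh / (2 * ell ^ 2)) by apply Rmin_l.
  assert (He2 : eps <= D / 2 / H) by apply Rmin_r.
  assert (He0 : 0 < eps).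
  { apply Rmin_pos; apply Rdiv_lt_0_compat; lra. }
  assert (HeH : eps * H <= D / 2) by (apply (Rle_div_r eps (D / 2) H); lra).
  assert (HeH' : eps * (4 + 4 * R1 ^ 2) <= eps * H) by (apply Rmult_le_compat_l; lra).
  assert (HeR : 0 <= eps * R1 ^ 2) by (apply Rmult_le_pos; lra).
  assert (HDL : D <= D * L * L).
  { rewrite Rmult_assoc. rewrite <- (Rmult_1_r D) at 1. apply Rmult_le_compat_l; [lra|].
    replace 1 with (1 * 1) by ring. apply Rmult_le_compat; unfold L; lra. }
  exists (fun p => V p /\ close_to_schwarzschild ell rh R1 eps (sol p)). split.
  - apply close_neighbourhood; auto; try (unfold R1; lra). intros p Hp. now apply Hsol.
  - intros p [HVp Hclose]. destruct (Hsol p HVp) as (Huni & Hpos & _).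
    split; auto. assert (Hbh := proj1 Huni).
    assert (Hfar : forall r, R1 <= r -> deviation ell mh (sol p) r <= D).
    { apply (deviation_propagates ell rh p (sol p) mh L D R1); auto;
        try lra.
      - intros r Hr. destruct (Hpos r Hr) as (? & _ & ?). auto.
      - apply Rle_trans with (eps * H); auto.
        apply (deviation_initial ell rh p R1 eps (sol p)); auto; lra. }
    intros r Hr. destruct (Rle_lt_dec r R1) as [Hle|Hlt].
    + assert (E4 : 4 / ell ^ 2 = 4 * / ell ^ 2) by reflexivity.
      assert (E3' : 3 / ell ^ 2 = 3 * / ell ^ 2) by reflexivity.
      apply (near_vacuum_compact ell rh p R1 eps); auto; try lra; fold mh;
        unfold K; lra.
    + assert (Hnv : near_vacuum ell rh K (D * L * L) (sol p) r).
      { apply (near_vacuum_far ell rh mh (sol p) r L K D); auto;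
          try lra; try (unfold K; lra).
        - apply (black_hole_differentiable ell rh p); auto; lra.
        - now apply Hbh.
        - apply Hfar. lra. }
      destruct Hnv as [N1 N2 N3 N4 N5 N6 N7 N8].
      split; auto; try lra.
      apply Rle_trans with (1 := N5). apply Rmult_le_compat_r; lra.
Qed.

Theorem proposition2 :
  forall (Lambda ell rh : R),
    Lambda < 0 ->
    ell ^ 2 = -3 / Lambda ->
    0 < rh ->
    global_existence ell rh ->
    exists U : horizon_data -> Prop,
      nbhd trivial_data U /\
      forall p : horizon_data, U p ->
        exists s : fields,
          unique_static_black_hole ell rh p s /\
          (forall r : R, rh < r -> 0 < K1 ell rh s r /\ 0 < K2 ell rh s r) /\
          linearly_stable ell rh s.
Proof.
  intros Lambda ell rh HL Hell Hrh Hex.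
  assert (Hell0 : ell <> 0).
  { intros E. rewrite E in Hell.
    assert (0 < -3 / Lambda) by (apply Rdiv_neg_neg; lra).
    simpl in Hell. lra. }
  destruct (near_vacuum_neighbourhood ell rh Hrh Hell0 Hex) as (K & HK & sol & HU).
  destruct (near_vacuum_stable ell rh K Hrh HK) as (d0 & Hd0 & Hstable).
  destruct (HU d0 Hd0) as (U & HnU & HUp).
  exists U. split; auto. intros p Hp. destruct (HUp p Hp) as [Huni Hnv].
  exists (sol p). split; auto.
  apply (Hstable d0 p); auto; [lra | apply Huni].
Qed.
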